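(* Let $K$ be an arbitrary field and let $\mathcal L_{3}=\{L_K(E)\mid E \text{ satisfies Condition (Sing) and } |E^0|=3\}$. (1) There exist exactly $50$ mutually non-isomorphic (as rings) Leavitt path algebras in $\mathcal L_3$, i.e. $\mathcal L_3$ consists of exactly $50$ ring-isomorphism classes, and a set of graphs whose Leavitt path algebras represent all the isomorphism classes in $\mathcal L_3$ is given by the following list (the list contains repetitions up to isomorphism of the Leavitt path algebras). Here a graph with vertex set $\{1,2,3\}$ is given by its set of edges, where $ij$ denotes one edge from vertex $i$ to vertex $j$. (3.1) $\{12,32\}$; $\{21,23,31\}$; $\{11,12,32\}$; $\{21,22,31,32\}$; $\{11,12,21,22\}$; $\{21,22,23,31,32\}$; $\{21,22,31,32,33\}$; $\{11,12,21,22,23\}$; $\{21,22,23,31,32,33\}$. (3.2) $\{23\}$; $\{21,23\}$; $\{22,32\}$; $\{22,23\}$; $\{11,32\}$; $\{11,21,23\}$; $\{21,22,23\}$; $\{22,23,33\}$; $\{11,22,23\}$; $\{11,21,22,23\}$; $\{11,12,32,33\}$. (3.3) $\emptyset$; $\{33\}$; $\{22,33\}$. (3.4) $\{21,23,31,32\}$; $\{21,22,23,31\}$. (3.5) $\{12,13,21,22,32,33\}$; $\{12,13,22,23,32,33\}$; $\{11,12,13,21,22,23,32,33\}$. (3.6) $\{12,22,32\}$; $\{12,13,22,32\}$; $\{11,12,22,32\}$; $\{12,13,22,32,33\}$; $\{11,12,21,22,33\}$; $\{12,13,22,31,32,33\}$; $\{11,12,13,22,32,33\}$; $\{11,12,21,22,23,33\}$;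 $\{11,12,13,22,23,32,33\}$; $\{11,12,13,22,31,32,33\}$; $\{11,12,21,22,23,32,33\}$. (3.7) $\{11,22,32\}$; $\{11,21,23,33\}$; $\{11,22,32,33\}$; $\{11,12,22,32,33\}$; $\{11,21,22,23,33\}$. (3.8) $\{11,22,33\}$. (3.9) $\{12,13,22,23,31,32,33\}$; $\{11,12,13,21,22,23,31,32,33\}$. (3.10) $\{12,13,22,31,32\}$; $\{12,22,31,32,33\}$. (3.11) $\{12,13,21,23,31,32\}$. (3.12) $\{12,13,21,22,23,31,32,33\}$. (3.13) $\{12,13,21,22,23,31,32\}$. (2) A complete system of invariants for $\mathcal L_3$ consists of $({\bf K}_0,\ \mathrm{Soc},\ L/\mathrm{Soc},\ [1],\ \mathrm{ILN},\ \mathrm{HS},\ L/I,\ \mathrm{MT3{+}L})$: two Leavitt path algebras $L_K(E)$ and $L_K(F)$ in $\mathcal L_3$ are isomorphic as rings if and only if the data of these invariants for $E$ and $F$ coincide.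
   Context: A (directed) graph $E=(E^0,E^1,r,s)$ consists of a set $E^0$ of vertices, a set $E^1$ of edges and maps $r,s:E^1\to E^0$ (range, source). Condition (Sing): $E$ has no parallel edges, i.e. for every ordered pair $(v,w)$ of vertices (including $v=w$) there is at most one edge from $v$ to $w$. The Leavitt path algebra $L_K(E)$ of a row-finite graph $E$ (each vertex emits finitely many edges) over a field $K$ is the $K$-algebra generated by $E^0\cup E^1\cup\{e^*\mid e\in E^1\}$ with relations: $vw=\delta_{v,w}v$ for $v,w\in E^0$; $s(e)e=er(e)=e$ and $r(e)e^*=e^*s(e)=e^*$ for $e\in E^1$; $e^*f=\delta_{e,f}r(e)$ for $e,f\in E^1$; $v=\sum_{e\in s^{-1}(v)}ee^*$ for every $v\in E^0$ that is not a sink (a sink is a vertex emitting no edges). It is unital if $E^0$ is finite, with $1=\sum_{v\in E^0}v$. It is $\mathbb Z$-graded, with degree $n$ component spanned by the $pq^*$, $p,q$ paths with $l(p)-l(q)=n$. A path is a vertex (length $0$) or a finite sequence of edges $e_1\cdots e_n$ with $r(e_i)=s(e_{i+1})$. A closed path $e_1\cdots e_n$ ($n\geq 1$) with $s(e_1)=r(e_n)$ and $s(e_i)\ne s(e_j)$ for $i\neq j$ is a cycle; an exit for it is an edge $e$ with $s(e)=s(e_i)$ and $e\ne e_i$ for some $i$. Write $v\ge w$ if there is a path from $v$ to $w$. A subset $H\subseteq E^0$ is hereditary if $v\in H$, $v\ge w$ imply $w\in H$; saturated if $s^{-1}(v)\neq\emptyset$ finite and $r(s^{-1}(v))\subseteq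 H$ imply $v\in H$. $\mathcal H_E$ is the set of hereditary saturated subsets. Invariants: - ${\bf K}_0$ is ${\bf K}_0(L_K(E))$ (up to group isomorphism), and $[1]$ is the class $[1_{L_K(E)}]\in {\bf K}_0(L_K(E))$; that these coincide for $E$ and $F$ means that there is a group isomorphism ${\bf K}_0(L_K(E))\to{\bf K}_0(L_K(F))$ carrying $[1_{L_K(E)}]$ to $[1_{L_K(F)}]$. - $\mathrm{Soc}$ is the socle of $L_K(E)$ (sum of all minimal left ideals, $0$ if there are none), and $L/\mathrm{Soc}$ is $L_K(E)/\mathrm{Soc}(L_K(E))$, both up to ring isomorphism. - $\mathrm{ILN}$ is the number of isolated loops of $E$, i.e. of vertices $u$ carrying exactly one loop and such that no other edge starts or ends at $u$. - $\mathrm{HS}=|\mathcal H_E|-2$. - $L/I$ (considered only when $\mathrm{HS}=1$) is the quotient of $L_K(E)$ by its only nontrivial (i.e. different from $0$ and $L_K(E)$) graded ideal $I$, up to ring isomorphism. - $\mathrm{MT3{+}L}$ is the truth value of: $E$ satisfies both Condition (MT3) (for all $v,w\in E^0$ there is $u\in E^0$ with $v\ge u$ and $w\ge u$) and Condition (L) (every cycle in $E$ has an exit). *)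

(* Defs.v *)
From HB Require Import structures.
From mathcomp Require Import all_boot all_order all_algebra generic_quotient.
From mathcomp Require Import boolp classical_sets functions.

Set Implicit Arguments.
Unset Strict Implicit.
Unset Printing Implicit Defensive.

Import GRing.Theory.

Local Open Scope quotient_scope.
Local Open Scope classical_set_scope.
Local Open Scope ring_scope.

(* [pzRingType] is used throughout because quotients such as L / Soc L may be
   the zero ring.  Rings are not assumed to be commutative. *)

Definition ring_iso (A B : pzRingType) : Prop :=
  exists f : {rmorphism A -> B}, bijective f.

(* Isomorphism of the (not necessarily unital) rings carried by I and J. *)
Definition nonunital_iso (A B : pzRingType) (I : set A) (J : set B) : Prop :=
  exists f : A -> B,
    [/\ set_bij I J f,
        forall x y, I x -> I y -> f (x + y) = f x + f y &
        forall x y, I x -> I y -> f (x * y) = f x * f y].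

Definition left_ideal (R : pzRingType) (I : set R) : Prop :=
  [/\ I 0, forall x y, I x -> I y -> I (x + y) & forall r x, I x -> I (r * x)].

Definition minimal_left_ideal (R : pzRingType) (I : set R) : Prop :=
  [/\ left_ideal I, I <> [set 0] &
      forall J, left_ideal J -> J `<=` I -> J = [set 0] \/ J = I].

Definition socle (R : pzRingType) : set R :=
  [set x | exists n (y : 'I_n -> R),
     (forall i, exists2 I : set R, minimal_left_ideal I & I (y i)) /\
     x = \sum_i y i].
Arguments socle R : clear implicits.

(* Two-sided ideals; stability under opposites follows from [idealMl]. *)
Record ideal (R : pzRingType) := Ideal {
  ideal_set :> R -> Prop;
  ideal0 : ideal_set 0;
  idealD : forall x y, ideal_set x -> ideal_set y -> ideal_set (x + y);
  idealMl : forall r x, ideal_set x -> ideal_set (r * x);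
  idealMr : forall r x, ideal_set x -> ideal_set (x * r) }.

Section SocleIdeal.
Variable R : pzRingType.
Implicit Types (I J : set R) (r x y : R).

Lemma left_idealN I x : left_ideal I -> I x -> I (- x).
Proof. by case=> _ _ IM Ix; rewrite -mulN1r; apply: IM. Qed.

Lemma left_ideal_minimal_mulr I r : minimal_left_ideal I ->
  [set x * r | x in I] <> [set 0] ->
  minimal_left_ideal [set x * r | x in I].
Proof.
case=> -[I0 ID IM] _ Imin nz; split=> //.
  split; first by exists 0; rewrite ?mul0r.
    by move=> _ _ [x Ix <-] [y Iy <-]; exists (x + y); [exact: ID|rewrite mulrDl].
  by move=> s _ [x Ix <-]; exists (s * x); [exact: IM|rewrite mulrA].
move=> J [J0 JD JM] JI.
pose J' := [set x | I x /\ J (x * r)].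
have lJ' : left_ideal J'.
  split; first by split; rewrite ?mul0r.
    by move=> x y [Ix Jx] [Iy Jy]; split; [exact: ID|rewrite mulrDl; exact: JD].
  by move=> s x [Ix Jx]; split; [exact: IM|rewrite -mulrA; exact: JM].
have J'I : J' `<=` I by move=> x [].
have [J'0|J'eI] := Imin J' lJ' J'I.
- left; apply/seteqP; split=> [y Jy|_ ->//].
  have [x Ix xr] := JI y Jy.
  have : J' x by split=> //; rewrite xr.
  by rewrite J'0 => /= x0; rewrite -xr x0 mul0r.
- right; apply/seteqP; split=> // _ [x Ix <-].
  by move: Ix; rewrite -J'eI => -[].
Qed.

Lemma socle0 : socle R 0.
Proof. by exists 0%N, (fun=> 0); rewrite big_ord0; split=> // -[]. Qed.

Lemma socleD x y : socle R x -> socle R y -> socle R (x + y).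
Proof.
move=> [n [u [uP ->]]] [m [v [vP ->]]].
exists (n + m)%N,
  (fun k => match fintype.split k with inl i => u i | inr j => v j end); split.
  by move=> k; case: (fintype.split k).
rewrite big_split_ord /=; congr (_ + _); apply: eq_bigr => i _.
  by rewrite (unsplitK (inl i)).
by rewrite (unsplitK (inr i)).
Qed.

Lemma socleMl r x : socle R x -> socle R (r * x).
Proof.
move=> [n [u [uP ->]]]; exists n, (fun i => r * u i).
split; last by rewrite mulr_sumr.
move=> i; have [I mI Iu] := uP i; exists I => //.
by case: mI => -[_ _ IM] _ _; exact: IM.
Qed.

Lemma socleMr r x : socle R x -> socle R (x * r).
Proof.
move=> [n [u [uP ->]]]; rewrite mulr_suml.
suff sP i : socle R (u i * r).
  elim/big_ind: _ => //; [exact: socle0|exact: socleD].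
have [I mI Iu] := uP i.
have [I0|nz] := pselect ([set x * r | x in I] = [set 0]).
  have : [set x * r | x in I] (u i * r) by exists (u i).
  by rewrite I0 => /= ->; exact: socle0.
exists 1%N, (fun=> u i * r); rewrite big_ord_recl big_ord0 addr0; split=> // _.
by exists [set x * r | x in I]; [exact: left_ideal_minimal_mulr|exists (u i)].
Qed.

Definition socle_ideal : ideal R := Ideal socle0 socleD socleMl socleMr.

End SocleIdeal.

Section QuotientRing.
Variables (R : pzRingType) (I : ideal R).
Implicit Types x y z : R.

Lemma idealN x : I x -> I (- x).
Proof. by move=> Ix; rewrite -mulN1r; apply: idealMl. Qed.

Definition ideal_equiv x y : bool := `[< I (x - y) >].

Lemma ideal_equiv_is_equiv : equiv_class_of ideal_equiv.
Proof.
split=> [x|x y|y x z].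
- by apply/asboolP; rewrite subrr; exact: ideal0.
- by apply/asboolP/asboolP => /idealN; rewrite opprB.
- move=> /asboolP xy /asboolP yz; apply/asboolP.
  by rewrite -(subrK y x) -addrA; apply: idealD.
Qed.

Canonical ideal_equiv_equiv := EquivRelPack ideal_equiv_is_equiv.
Canonical ideal_equiv_encModRel := defaultEncModRel ideal_equiv.

Definition quot := {eq_quot ideal_equiv}.

HB.instance Definition _ := Choice.on quot.
HB.instance Definition _ := EqQuotient.on quot.

Lemma quot_eqP x y : reflect (I (x - y)) (x == y %[mod quot]).
Proof. by rewrite piE; apply: asboolP. Qed.

Lemma quot_reprP x : I (repr (\pi_quot x) - x).
Proof. by apply/quot_eqP; rewrite reprK. Qed.

Definition quot_add (a b : quot) : quot := \pi_quot (repr a + repr b).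
Definition quot_opp (a : quot) : quot := \pi_quot (- repr a).
Definition quot_mul (a b : quot) : quot := \pi_quot (repr a * repr b).

Lemma pi_quotD x y : \pi_quot (x + y) = quot_add (\pi_quot x) (\pi_quot y).
Proof.
apply/eqP; rewrite eq_sym; apply/quot_eqP.
by rewrite opprD addrACA; apply: idealD; apply: quot_reprP.
Qed.

Lemma pi_quotN x : \pi_quot (- x) = quot_opp (\pi_quot x).
Proof.
apply/eqP; rewrite eq_sym; apply/quot_eqP.
by rewrite -opprD; apply/idealN/quot_reprP.
Qed.

Lemma pi_quotM x y : \pi_quot (x * y) = quot_mul (\pi_quot x) (\pi_quot y).
Proof.
apply/eqP; rewrite eq_sym; apply/quot_eqP.
set x' := repr _; set y' := repr _.
rewrite -(subrKA (x' * y)) -mulrBr -mulrBl.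
by apply: idealD; [apply: idealMl|apply: idealMr]; apply: quot_reprP.
Qed.

Lemma quot_addA : associative quot_add.
Proof.
move=> a b c; elim/quotW: a => x; elim/quotW: b => y; elim/quotW: c => z.
by rewrite -(pi_quotD x y) -(pi_quotD y z) -!pi_quotD addrA.
Qed.
Lemma quot_addC : commutative quot_add.
Proof.
by move=> a b; elim/quotW: a => x; elim/quotW: b => y; rewrite -!pi_quotD addrC.
Qed.
Lemma quot_add0 : left_id (\pi_quot 0) quot_add.
Proof. by move=> a; elim/quotW: a => x; rewrite -pi_quotD add0r. Qed.
Lemma quot_addN : left_inverse (\pi_quot 0) quot_opp quot_add.
Proof. by move=> a; elim/quotW: a => x; rewrite -pi_quotN -pi_quotD addNr. Qed.

HB.instance Definition _ :=
  GRing.isZmodule.Build quot quot_addA quot_addC quot_add0 quot_addN.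

Lemma quot_mulA : associative quot_mul.
Proof.
move=> a b c; elim/quotW: a => x; elim/quotW: b => y; elim/quotW: c => z.
by rewrite -(pi_quotM x y) -(pi_quotM y z) -!pi_quotM mulrA.
Qed.
Lemma quot_mul1l : left_id (\pi_quot 1) quot_mul.
Proof. by move=> a; elim/quotW: a => x; rewrite -pi_quotM mul1r. Qed.
Lemma quot_mul1r : right_id (\pi_quot 1) quot_mul.
Proof. by move=> a; elim/quotW: a => x; rewrite -pi_quotM mulr1. Qed.
Lemma quot_mulDl : left_distributive quot_mul quot_add.
Proof.
by move=> a b c; elim/quotW: a => x; elim/quotW: b => y; elim/quotW: c => z;
   rewrite -pi_quotD -(pi_quotM x z) -(pi_quotM y z) -pi_quotM -pi_quotD mulrDl.
Qed.
Lemma quot_mulDr : right_distributive quot_mul quot_add.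
Proof.
by move=> a b c; elim/quotW: a => x; elim/quotW: b => y; elim/quotW: c => z;
   rewrite -(pi_quotD y z) -(pi_quotM x y) -(pi_quotM x z)
     -pi_quotM -pi_quotD mulrDr.
Qed.

HB.instance Definition _ := GRing.Zmodule_isPzRing.Build quot
  quot_mulA quot_mul1l quot_mul1r quot_mulDl quot_mulDr.

End QuotientRing.

Section K0.
Variable R : pzRingType.

Definition mod_iso (M N : lmodType R) : Prop :=
  exists f : {linear M -> N}, bijective f.

Definition finitely_generated (M : lmodType R) : Prop :=
  exists n (x : 'I_n -> M),
    forall m, exists a : 'I_n -> R, m = \sum_i a i *: x i.

Definition projective (P : lmodType R) : Prop :=
  forall (M N : lmodType R) (g : {linear M -> N}) (f : {linear P -> N}),
    (forall y, exists x, g x = y) ->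
    exists h : {linear P -> M}, forall p, g (h p) = f p.

Record fgproj := FGProj {
  fgproj_mod :> lmodType R;
  fgproj_fg : finitely_generated fgproj_mod;
  fgproj_proj : projective fgproj_mod }.

Lemma fg_sum (M N : lmodType R) :
  finitely_generated M -> finitely_generated N ->
  finitely_generated (M * N)%type.
Proof.
move=> [n [x xP]] [m [y yP]].
exists (n + m)%N, (fun k =>
  match fintype.split k with inl i => (x i, 0) | inr j => (0, y j) end)
  => -[u v].
have [a ->] := xP u; have [b ->] := yP v.
exists (fun k => match fintype.split k with inl i => a i | inr j => b j end).
rewrite big_split_ord /=.
under [X in _ = X + _]eq_bigr => i _ do rewrite (unsplitK (inl i)).
under [X in _ = _ + X]eq_bigr => j _ do rewrite (unsplitK (inr j)).
apply: injective_projections; rewrite /= !raddf_sum /=.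
  by rewrite [X in _ = _ + X]big1 ?addr0// => i _; rewrite scaler0.
by rewrite [X in _ = X + _]big1 ?add0r// => i _; rewrite scaler0.
Qed.

Lemma projective_sum (P Q : lmodType R) :
  projective P -> projective Q -> projective (P * Q)%type.
Proof.
move=> pP pQ M N g f gs.
have linP : linear (fun p : P => f (p, 0)).
  move=> a x y; rewrite -linearP; congr (f _).
  by apply: injective_projections; rewrite //= scaler0 addr0.
have linQ : linear (fun q : Q => f (0, q)).
  move=> a x y; rewrite -linearP; congr (f _).
  by apply: injective_projections; rewrite //= scaler0 addr0.
pose fP : {linear P -> N} := HB.pack (fun p : P => f (p, 0))
  (GRing.isLinear.Build R P N _ _ linP).
pose fQ : {linear Q -> N} := HB.pack (fun q : Q => f (0, q))
  (GRing.isLinear.Build R Q N _ _ linQ).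
have [hP hPE] := pP M N g fP gs; have [hQ hQE] := pQ M N g fQ gs.
have linh : linear (fun u : P * Q => hP u.1 + hQ u.2).
  by move=> a u v /=; rewrite !linearP scalerDr addrACA.
pose h : {linear (P * Q)%type -> M} :=
  HB.pack (fun u : P * Q => hP u.1 + hQ u.2)
  (GRing.isLinear.Build R (P * Q)%type M _ _ linh).
exists h => -[p q] /=.
rewrite raddfD /= hPE hQE /= -raddfD; congr (f _).
by apply: injective_projections; rewrite /= ?addr0 ?add0r.
Qed.

Definition fgproj_sum (P Q : fgproj) : fgproj :=
  FGProj (fg_sum (@fgproj_fg P) (@fgproj_fg Q))
         (projective_sum (@fgproj_proj P) (@fgproj_proj Q)).

Lemma fg_regular : finitely_generated R^o.
Proof.
exists 1%N, (fun=> 1) => m; exists (fun=> m).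
by rewrite big_ord_recl big_ord0 addr0 /GRing.scale/= mulr1.
Qed.

Lemma projective_regular : projective R^o.
Proof.
move=> M N g f gs; have [x gx] := gs (f 1).
have linh : linear (fun r : R^o => r *: x : M).
  by move=> a u v; rewrite scalerDl scalerA.
pose h : {linear R^o -> M} := HB.pack (fun r : R^o => r *: x : M)
  (GRing.isLinear.Build R R^o M _ _ linh).
exists h => r /=.
by rewrite linearZ /= gx -linearZ /= /GRing.scale/= mulr1.
Qed.

Definition fgproj_regular : fgproj := FGProj fg_regular projective_regular.

Lemma fg_zero : finitely_generated 'rV[R]_0.
Proof.
by exists 0%N, (fun=> 0) => m; exists (fun=> 0); rewrite big_ord0;
  apply/rowP => -[].
Qed.

Lemma projective_zero : projective 'rV[R]_0.
Proof.
move=> M N g f gs.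
have lin0 : linear (fun _ : 'rV[R]_0 => 0 : M).
  by move=> a u v; rewrite scaler0 addr0.
pose h : {linear 'rV[R]_0 -> M} := HB.pack (fun _ : 'rV[R]_0 => 0 : M)
  (GRing.isLinear.Build R 'rV[R]_0 M _ _ lin0).
exists h => r /=.
have -> : r = 0 by apply/rowP => -[].
by rewrite !raddf0.
Qed.

Definition fgproj_zero : fgproj := FGProj fg_zero projective_zero.

(* (P, Q) stands for the formal difference [P] - [Q]; K_0(R) is the type [K0]
   with the equality [K0_eq].  It is kept as a setoid because a quotient would
   have to be a [zmodType] in a universe above that of R-modules. *)
Definition K0 : Type := (fgproj * fgproj)%type.

Definition K0_eq (x y : K0) : Prop := exists T : fgproj,
  mod_iso (fgproj_sum (fgproj_sum x.1 y.2) T)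
          (fgproj_sum (fgproj_sum y.1 x.2) T).

Definition K0_add (x y : K0) : K0 := (fgproj_sum x.1 y.1, fgproj_sum x.2 y.2).

(* the class [1_R], i.e. the class of the regular left module R *)
Definition K0_one : K0 := (fgproj_regular, fgproj_zero).

End K0.

(* Group isomorphisms K_0(R) -> K_0(S) carrying [1_R] to [1_S]. *)
Definition K0_pointed_iso (R S : pzRingType) : Prop :=
  exists phi : K0 R -> K0 S,
    [/\ forall x y, K0_eq x y <-> K0_eq (phi x) (phi y),
        forall z, exists x, K0_eq (phi x) z,
        forall x y, K0_eq (phi (K0_add x y)) (K0_add (phi x) (phi y)) &
        K0_eq (phi (K0_one R)) (K0_one S)].

Record graph := Graph {
  vertex : finType;
  edge : finType;
  src : edge -> vertex;
  rng : edge -> vertex }.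

Section Graph.
Variable E : graph.
Implicit Types (u v w : vertex E) (e f : edge E) (p q : seq (edge E)).

Definition Sing : Prop := forall e f, src e = src f -> rng e = rng f -> e = f.

(* [is_path v p] : the edges p form a path starting at v; the pair of v and
   [::] is the path v of length 0. *)
Fixpoint is_path v p : bool :=
  if p is e :: p' then (src e == v) && is_path (rng e) p' else true.

Definition path_end v p : vertex E := last v (map (@rng E) p).

Definition reaches v w : Prop := exists p, is_path v p /\ path_end v p = w.

Definition is_cycle p : Prop :=
  exists v, [/\ p <> [::], is_path v p, path_end v p = v &
                uniq (map (@src E) p)].

Definition has_exit p : Prop :=
  exists e f, [/\ f \in p, src e = src f & e <> f].

Definition condition_L : Prop := forall p, is_cycle p -> has_exit p.

Definition condition_MT3 : Prop :=
  forall v w, exists u, reaches v u /\ reaches w u.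

Definition MT3L : Prop := condition_MT3 /\ condition_L.

Definition hereditary (H : {set vertex E}) : Prop :=
  forall v w, v \in H -> reaches v w -> w \in H.

Definition saturated (H : {set vertex E}) : Prop :=
  forall v, (exists e, src e = v) -> (forall e, src e = v -> rng e \in H) ->
    v \in H.

(* Not truncated: set0 and setT are hereditary and saturated, and E^0 is
   nonempty in all uses. *)
Definition HS : nat :=
  (#|[set H : {set vertex E} | `[< hereditary H /\ saturated H >]]%SET| - 2)%N.

Definition isolated_loop u : bool :=
  (#|[set e | (src e == u) && (rng e == u)]%SET| == 1%N) &&
  [forall e, (src e == u) || (rng e == u) ==> (src e == u) && (rng e == u)].

Definition ILN : nat := #|[set u | isolated_loop u]%SET|.

End Graph.

(* The graph on the vertices 1, 2, 3 whose edges are listed in s, the number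
   with decimal digits ij standing for one edge from i to j.  The ordinal
   i : 'I_3 is the vertex i + 1. *)
Definition edge_code (p : 'I_3 * 'I_3) : nat := (10 * p.1.+1 + p.2.+1)%N.

Definition graph_of (s : seq nat) : graph :=
  @Graph 'I_3 {p : 'I_3 * 'I_3 | edge_code p \in s}
    (fun e => (val e).1) (fun e => (val e).2).

Section LPA.
Variables (K : fieldType) (E : graph).

(* Expressions in the generators of L_K(E).  There is no constant for 1: the
   algebra presented is a priori not unital. *)
Inductive term : Type :=
  | TVertex of vertex E
  | TEdge of edge E
  | TGhost of edge E
  | TZero
  | TAdd of term & term
  | TOpp of term
  | TScale of K & term
  | TMul of term & term.

Definition TSum (ts : seq term) : term := foldr TAdd TZero ts.

(* The least congruence containing the axioms of (associative) K-algebras and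
   the defining relations of L_K(E). *)
Inductive term_eq : term -> term -> Prop :=
  | teq_refl x : term_eq x x
  | teq_sym x y : term_eq x y -> term_eq y x
  | teq_trans x y z : term_eq x y -> term_eq y z -> term_eq x z
  | teq_add x x' y y' :
      term_eq x x' -> term_eq y y' -> term_eq (TAdd x y) (TAdd x' y')
  | teq_opp x x' : term_eq x x' -> term_eq (TOpp x) (TOpp x')
  | teq_scale a x x' : term_eq x x' -> term_eq (TScale a x) (TScale a x')
  | teq_mul x x' y y' :
      term_eq x x' -> term_eq y y' -> term_eq (TMul x y) (TMul x' y')
  | teq_addA x y z : term_eq (TAdd x (TAdd y z)) (TAdd (TAdd x y) z)
  | teq_addC x y : term_eq (TAdd x y) (TAdd y x)
  | teq_add0 x : term_eq (TAdd TZero x) x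
  | teq_addN x : term_eq (TAdd (TOpp x) x) TZero
  | teq_scaleA a b x : term_eq (TScale a (TScale b x)) (TScale (a * b) x)
  | teq_scale1 x : term_eq (TScale 1 x) x
  | teq_scaleDr a x y :
      term_eq (TScale a (TAdd x y)) (TAdd (TScale a x) (TScale a y))
  | teq_scaleDl a b x :
      term_eq (TScale (a + b) x) (TAdd (TScale a x) (TScale b x))
  | teq_mulA x y z : term_eq (TMul x (TMul y z)) (TMul (TMul x y) z)
  | teq_mulDl x y z :
      term_eq (TMul (TAdd x y) z) (TAdd (TMul x z) (TMul y z))
  | teq_mulDr x y z :
      term_eq (TMul x (TAdd y z)) (TAdd (TMul x y) (TMul x z))
  | teq_scaleAl a x y : term_eq (TScale a (TMul x y)) (TMul (TScale a x) y)
  | teq_scaleAr a x y : term_eq (TScale a (TMul x y)) (TMul x (TScale a y))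
  | teq_vertex v w :
      term_eq (TMul (TVertex v) (TVertex w))
              (if v == w then TVertex v else TZero)
  | teq_src_edge e : term_eq (TMul (TVertex (src e)) (TEdge e)) (TEdge e)
  | teq_edge_rng e : term_eq (TMul (TEdge e) (TVertex (rng e))) (TEdge e)
  | teq_rng_ghost e : term_eq (TMul (TVertex (rng e)) (TGhost e)) (TGhost e)
  | teq_ghost_src e : term_eq (TMul (TGhost e) (TVertex (src e))) (TGhost e)
  | teq_CK1 e f :
      term_eq (TMul (TGhost e) (TEdge f))
              (if e == f then TVertex (rng e) else TZero)
  | teq_CK2 v : (exists e, src e = v) ->
      term_eq (TVertex v)
        (TSum [seq TMul (TEdge e) (TGhost e)
              | e <- enum (edge E) & src e == v]).

HB.instance Definition _ := gen_eqMixin term.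
HB.instance Definition _ := gen_choiceMixin term.

Definition term_eqb (x y : term) : bool := `[< term_eq x y >].

Lemma term_eqb_is_equiv : equiv_class_of term_eqb.
Proof.
split=> [x|x y|y x z].
- by apply/asboolP; exact: teq_refl.
- by apply/asboolP/asboolP; exact: teq_sym.
- by move=> /asboolP xy /asboolP yz; apply/asboolP; exact: teq_trans yz.
Qed.

Canonical term_eqb_equiv := EquivRelPack term_eqb_is_equiv.
Canonical term_eqb_encModRel := defaultEncModRel term_eqb.

Definition LPA := {eq_quot term_eqb}.

HB.instance Definition _ := Choice.on LPA.
HB.instance Definition _ := EqQuotient.on LPA.

Lemma LPAP x y : \pi_LPA x = \pi_LPA y <-> term_eq x y.
Proof. by split=> [/eqmodP/asboolP|xy] //; apply/eqmodP/asboolP. Qed.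

Lemma LPA_reprP x : term_eq (repr (\pi_LPA x)) x.
Proof. by apply/LPAP; rewrite reprK. Qed.

Definition LPA_add (a b : LPA) : LPA := \pi_LPA (TAdd (repr a) (repr b)).
Definition LPA_opp (a : LPA) : LPA := \pi_LPA (TOpp (repr a)).
Definition LPA_scale (k : K) (a : LPA) : LPA := \pi_LPA (TScale k (repr a)).
Definition LPA_mul (a b : LPA) : LPA := \pi_LPA (TMul (repr a) (repr b)).
Definition LPA_one : LPA :=
  \pi_LPA (TSum [seq TVertex v | v <- enum (vertex E)]).

Lemma pi_LPA_add x y : LPA_add (\pi_LPA x) (\pi_LPA y) = \pi_LPA (TAdd x y).
Proof. by apply/LPAP/teq_add; apply: LPA_reprP. Qed.
Lemma pi_LPA_opp x : LPA_opp (\pi_LPA x) = \pi_LPA (TOpp x).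
Proof. by apply/LPAP/teq_opp; apply: LPA_reprP. Qed.
Lemma pi_LPA_scale k x : LPA_scale k (\pi_LPA x) = \pi_LPA (TScale k x).
Proof. by apply/LPAP/teq_scale; apply: LPA_reprP. Qed.
Lemma pi_LPA_mul x y : LPA_mul (\pi_LPA x) (\pi_LPA y) = \pi_LPA (TMul x y).
Proof. by apply/LPAP/teq_mul; apply: LPA_reprP. Qed.

Lemma LPA_addA : associative LPA_add.
Proof.
by move=> a b c; elim/quotW: a => x; elim/quotW: b => y;
  elim/quotW: c => z; rewrite (pi_LPA_add x y) (pi_LPA_add y z) !pi_LPA_add;
  apply/LPAP/teq_addA.
Qed.
Lemma LPA_addC : commutative LPA_add.
Proof.
by move=> a b; elim/quotW: a => x; elim/quotW: b => y; rewrite !pi_LPA_add;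
  apply/LPAP/teq_addC.
Qed.
Lemma LPA_add0 : left_id (\pi_LPA TZero) LPA_add.
Proof.
by move=> a; elim/quotW: a => x; rewrite pi_LPA_add; apply/LPAP/teq_add0.
Qed.
Lemma LPA_addN : left_inverse (\pi_LPA TZero) LPA_opp LPA_add.
Proof.
by move=> a; elim/quotW: a => x; rewrite (pi_LPA_opp x) pi_LPA_add;
  apply/LPAP/teq_addN.
Qed.

HB.instance Definition _ :=
  GRing.isZmodule.Build LPA LPA_addA LPA_addC LPA_add0 LPA_addN.

Lemma LPA_mulA : associative LPA_mul.
Proof.
by move=> a b c; elim/quotW: a => x; elim/quotW: b => y;
  elim/quotW: c => z; rewrite (pi_LPA_mul x y) (pi_LPA_mul y z) !pi_LPA_mul;
  apply/LPAP/teq_mulA.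
Qed.
Lemma LPA_mulDl : left_distributive LPA_mul +%R.
Proof.
change (left_distributive LPA_mul LPA_add).
by move=> a b c; elim/quotW: a => x; elim/quotW: b => y; elim/quotW: c => z;
  rewrite (pi_LPA_add x y) (pi_LPA_mul x z) (pi_LPA_mul y z) pi_LPA_mul
    [RHS]pi_LPA_add;
  apply/LPAP/teq_mulDl.
Qed.
Lemma LPA_mulDr : right_distributive LPA_mul +%R.
Proof.
change (right_distributive LPA_mul LPA_add).
by move=> a b c; elim/quotW: a => x; elim/quotW: b => y; elim/quotW: c => z;
  rewrite (pi_LPA_add y z) (pi_LPA_mul x y) (pi_LPA_mul x z) pi_LPA_mul
    [RHS]pi_LPA_add;
  apply/LPAP/teq_mulDr.
Qed.

Let mul0L x : LPA_mul 0 x = 0.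
Proof. by apply: (addIr (LPA_mul 0 x)); rewrite -LPA_mulDl !add0r. Qed.
Let mulL0 x : LPA_mul x 0 = 0.
Proof. by apply: (addIr (LPA_mul x 0)); rewrite -LPA_mulDr !add0r. Qed.

Lemma LPA_scaleA a b x : LPA_scale a (LPA_scale b x) = LPA_scale (a * b) x.
Proof.
by elim/quotW: x => x; rewrite (pi_LPA_scale b x) !pi_LPA_scale;
  apply/LPAP/teq_scaleA.
Qed.
Lemma LPA_scale1 : left_id 1 LPA_scale.
Proof.
by move=> a; elim/quotW: a => x; rewrite pi_LPA_scale; apply/LPAP/teq_scale1.
Qed.
Lemma LPA_scaleDr : right_distributive LPA_scale +%R.
Proof.
change (right_distributive LPA_scale LPA_add).
by move=> k a b; elim/quotW: a => x; elim/quotW: b => y;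
  rewrite (pi_LPA_add x y) (pi_LPA_scale k x) (pi_LPA_scale k y) pi_LPA_scale
    [RHS]pi_LPA_add;
  apply/LPAP/teq_scaleDr.
Qed.
Lemma LPA_scaleDl x : {morph LPA_scale^~ x : a b / a + b}.
Proof.
by move=> a b; elim/quotW: x => x;
  change (LPA_scale (a + b) (\pi_LPA x) =
    LPA_add (LPA_scale a (\pi_LPA x)) (LPA_scale b (\pi_LPA x)));
  rewrite (pi_LPA_scale a x) (pi_LPA_scale b x) pi_LPA_scale
    [RHS]pi_LPA_add;
  apply/LPAP/teq_scaleDl.
Qed.

HB.instance Definition _ := GRing.Zmodule_isLmodule.Build K LPA
  LPA_scaleA LPA_scale1 LPA_scaleDr LPA_scaleDl.

Lemma LPA_scaleAl a (x y : LPA) : a *: LPA_mul x y = LPA_mul (a *: x) y.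
Proof.
by elim/quotW: x => x; elim/quotW: y => y;
  change (LPA_scale a (LPA_mul (\pi_LPA x) (\pi_LPA y)) =
    LPA_mul (LPA_scale a (\pi_LPA x)) (\pi_LPA y));
  rewrite (pi_LPA_mul x y) (pi_LPA_scale a x) [LHS]pi_LPA_scale [RHS]pi_LPA_mul;
  apply/LPAP/teq_scaleAl.
Qed.
Lemma LPA_scaleAr a (x y : LPA) : a *: LPA_mul x y = LPA_mul x (a *: y).
Proof.
by elim/quotW: x => x; elim/quotW: y => y;
  change (LPA_scale a (LPA_mul (\pi_LPA x) (\pi_LPA y)) =
    LPA_mul (\pi_LPA x) (LPA_scale a (\pi_LPA y)));
  rewrite (pi_LPA_mul x y) (pi_LPA_scale a y) [LHS]pi_LPA_scale [RHS]pi_LPA_mul;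
  apply/LPAP/teq_scaleAr.
Qed.

Definition vert (v : vertex E) : LPA := \pi_LPA (TVertex v).
Definition edg (e : edge E) : LPA := \pi_LPA (TEdge e).
Definition ghost (e : edge E) : LPA := \pi_LPA (TGhost e).

Lemma LPA_oneE : LPA_one = \sum_v vert v.
Proof.
rewrite /LPA_one -big_enum; elim: (enum _) => [|v s IHs] /=; first by rewrite big_nil.
by rewrite big_cons -IHs -pi_LPA_add.
Qed.

Let vert_mul v w : LPA_mul (vert v) (vert w) = if v == w then vert v else 0.
Proof. by rewrite pi_LPA_mul; move/LPAP: (teq_vertex v w) ->; case: eqP. Qed.

Let sum_vertl v x : LPA_mul (vert v) x = x -> LPA_mul LPA_one x = x.
Proof.
move=> vx; have sumL (s : seq (vertex E)) :
    LPA_mul (\sum_(w <- s) vert w) x = \sum_(w <- s) LPA_mul (vert w) x.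
  by elim: s => [|w s IHs]; rewrite ?(big_nil, big_cons) ?mul0L // LPA_mulDl IHs.
rewrite LPA_oneE sumL (bigD1 v) //= vx big1 ?addr0 // => w /negPf wv.
by rewrite -vx LPA_mulA vert_mul wv mul0L.
Qed.

Let sum_vertr v x : LPA_mul x (vert v) = x -> LPA_mul x LPA_one = x.
Proof.
move=> vx; have sumL (s : seq (vertex E)) :
    LPA_mul x (\sum_(w <- s) vert w) = \sum_(w <- s) LPA_mul x (vert w).
  by elim: s => [|w s IHs]; rewrite ?(big_nil, big_cons) ?mulL0 // LPA_mulDr IHs.
rewrite LPA_oneE sumL (bigD1 v) //= vx big1 ?addr0 // => w.
rewrite eq_sym => /negPf wv.
by rewrite -vx -LPA_mulA vert_mul wv mulL0.
Qed.

Lemma LPA_mul1l : left_id LPA_one LPA_mul.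
Proof.
elim/quotW; elim=> [v|e|e||x IHx y IHy|x IHx|a x IHx|x IHx y IHy].
- by apply: (@sum_vertl v); rewrite vert_mul eqxx.
- by apply: (@sum_vertl (src e)); rewrite pi_LPA_mul; apply/LPAP/teq_src_edge.
- by apply: (@sum_vertl (rng e)); rewrite pi_LPA_mul; apply/LPAP/teq_rng_ghost.
- exact: mulL0.
- by rewrite -pi_LPA_add [LHS]LPA_mulDr IHx IHy.
- rewrite -pi_LPA_opp; apply: (addIr (\pi_LPA x : LPA)).
  by rewrite -{2}IHx -LPA_mulDr !addNr mulL0.
- by rewrite -pi_LPA_scale -[LHS]LPA_scaleAr IHx.
- by rewrite -pi_LPA_mul LPA_mulA IHx.
Qed.

Lemma LPA_mul1r : right_id LPA_one LPA_mul.
Proof.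
elim/quotW; elim=> [v|e|e||x IHx y IHy|x IHx|a x IHx|x IHx y IHy].
- by apply: (@sum_vertr v); rewrite vert_mul eqxx.
- by apply: (@sum_vertr (rng e)); rewrite pi_LPA_mul; apply/LPAP/teq_edge_rng.
- by apply: (@sum_vertr (src e)); rewrite pi_LPA_mul; apply/LPAP/teq_ghost_src.
- exact: mul0L.
- by rewrite -pi_LPA_add [LHS]LPA_mulDl IHx IHy.
- rewrite -pi_LPA_opp; apply: (addIr (\pi_LPA x : LPA)).
  by rewrite -{2}IHx -LPA_mulDl !addNr mul0L.
- by rewrite -pi_LPA_scale -[LHS]LPA_scaleAl IHx.
- by rewrite -pi_LPA_mul -LPA_mulA IHy.
Qed.

HB.instance Definition _ := GRing.Zmodule_isPzRing.Build LPA
  LPA_mulA LPA_mul1l LPA_mul1r LPA_mulDl LPA_mulDr.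

Definition path_elt (v : vertex E) (p : seq (edge E)) : LPA :=
  vert v * \prod_(e <- p) edg e.

Definition ghost_elt (w : vertex E) (q : seq (edge E)) : LPA :=
  (\prod_(e <- rev q) ghost e) * vert w.

(* The K-span of the p q^* with l(p) - l(q) = n; no condition r(p) = r(q) is
   needed since p q^* = 0 otherwise. *)
Definition degree_component (n : int) : set LPA :=
  [set x | exists m (k : 'I_m -> K) (p q : 'I_m -> vertex E * seq (edge E)),
     [/\ forall i, is_path (p i).1 (p i).2 /\ is_path (q i).1 (q i).2,
         forall i, (size (p i).2)%:Z - (size (q i).2)%:Z = n &
         x = \sum_i
           k i *: (path_elt (p i).1 (p i).2 * ghost_elt (q i).1 (q i).2)]].

Definition graded_ideal (I : ideal LPA) : Prop :=
  forall x, I x -> exists m (y : 'I_m -> LPA),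
    (forall i, I (y i) /\ exists n, degree_component n (y i)) /\ x = \sum_i y i.

Definition nontrivial_graded_ideal (I : ideal LPA) : Prop :=
  [/\ graded_ideal I, ideal_set I <> [set 0] & ideal_set I <> [set: LPA]].

Definition only_nontrivial_graded_ideal (I : ideal LPA) : Prop :=
  nontrivial_graded_ideal I /\
  forall J : ideal LPA, nontrivial_graded_ideal J ->
    ideal_set J = ideal_set I.

End LPA.

(* Coincidence of (K_0, Soc, L/Soc, [1], ILN, HS, L/I, MT3+L); K_0 and
   [1] are compared together by [K0_pointed_iso]. *)
Definition same_invariants (K : fieldType) (E F : graph) : Prop :=
  let L := LPA K E in let M := LPA K F in
  [/\ K0_pointed_iso L M,
      nonunital_iso (socle L) (socle M) /\
        ring_iso (quot (socle_ideal L)) (quot (socle_ideal M)),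
      ILN E = ILN F /\ HS E = HS F,
      HS E = 1%N -> exists (I : ideal L) (J : ideal M),
        [/\ only_nontrivial_graded_ideal I, only_nontrivial_graded_ideal J &
            ring_iso (quot I) (quot J)] &
      MT3L E <-> MT3L F].

Definition in_L3 (E : graph) : Prop := Sing E /\ #|vertex E| = 3%N.

Definition list3 : seq (seq nat) := [::
  [:: 12; 32]; [:: 21; 23; 31]; [:: 11; 12; 32]; [:: 21; 22; 31; 32];
  [:: 11; 12; 21; 22]; [:: 21; 22; 23; 31; 32]; [:: 21; 22; 31; 32; 33];
  [:: 11; 12; 21; 22; 23]; [:: 21; 22; 23; 31; 32; 33];
  [:: 23]; [:: 21; 23]; [:: 22; 32]; [:: 22; 23]; [:: 11; 32];
  [:: 11; 21; 23]; [:: 21; 22; 23]; [:: 22; 23; 33]; [:: 11; 22; 23];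
  [:: 11; 21; 22; 23]; [:: 11; 12; 32; 33];
  [::]; [:: 33]; [:: 22; 33];
  [:: 21; 23; 31; 32]; [:: 21; 22; 23; 31];
  [:: 12; 13; 21; 22; 32; 33]; [:: 12; 13; 22; 23; 32; 33];
  [:: 11; 12; 13; 21; 22; 23; 32; 33];
  [:: 12; 22; 32]; [:: 12; 13; 22; 32]; [:: 11; 12; 22; 32];
  [:: 12; 13; 22; 32; 33]; [:: 11; 12; 21; 22; 33];
  [:: 12; 13; 22; 31; 32; 33]; [:: 11; 12; 13; 22; 32; 33];
  [:: 11; 12; 21; 22; 23; 33]; [:: 11; 12; 13; 22; 23; 32; 33];
  [:: 11; 12; 13; 22; 31; 32; 33]; [:: 11; 12; 21; 22; 23; 32; 33];
  [:: 11; 22; 32]; [:: 11; 21; 23; 33]; [:: 11; 22; 32; 33];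
  [:: 11; 12; 22; 32; 33]; [:: 11; 21; 22; 23; 33];
  [:: 11; 22; 33];
  [:: 12; 13; 22; 23; 31; 32; 33]; [:: 11; 12; 13; 21; 22; 23; 31; 32; 33];
  [:: 12; 13; 22; 31; 32]; [:: 12; 22; 31; 32; 33];
  [:: 12; 13; 21; 23; 31; 32];
  [:: 12; 13; 21; 22; 23; 31; 32; 33];
  [:: 12; 13; 21; 22; 23; 31; 32]]%N.

(* Main.v *)
(* Moves that preserve the algebra up to isomorphism (permuting the vertices;
   for an edge from u to v with v distinct from u and not a sink, letting u
   emit the edges of v instead of that edge) connect each of the 512 graphs to
   one of 50 representatives, and the invariants separate these.

   The K-span B of the ghost paths q^* behaves like a free algebra: families of
   rows over B can be reduced until their leading terms are independent, and a
   CK2 expansion carries this over to L = L_K(E).  Hence every finitely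
   generated submodule of a free module is a direct sum of modules L v.  For an
   abelian group A and phi : E^0 -> A with phi v equal to the sum of phi over
   the ranges of the edges leaving v, counting ghost paths by length shows that
   the sum of phi over such a decomposition depends on the module only.  So
   these phi are the homomorphisms from K_0(L) to A, and their number, and the
   number of those killing [1], can be computed from the graph.

   A ring isomorphism maps the ideal I(H) generated by a hereditary saturated H
   to an ideal generated by idempotents, hence again to some I(H'), and
   L / I(H) is the algebra of the graph E \ H; so the lattice of the sets H and
   the counts above for the graphs E \ H are invariants.  The socle is I(H0),
   where H0 consists of the vertices from which no infinite path starts: in
   the absence of sinks a minimal left ideal would contain an element b of B
   with a closed path c at its vertex u, and b = z (u - c^* ) b would give
   u = z (u - c^* ), although u - c^* kills a constant function that u does
   not.  One pair of classes is left; it is told apart by the existence of a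
   nonzero idempotent e with e L e commutative. *)

From HB Require Import structures.
From mathcomp Require Import all_boot all_order all_algebra generic_quotient.
From mathcomp Require Import boolp classical_sets functions.
From mathcomp Require Import zify.
Require Import Defs.

Set Implicit Arguments.
Unset Strict Implicit.
Unset Printing Implicit Defensive.

Import GRing.Theory.

Local Open Scope quotient_scope.
Local Open Scope ring_scope.

(** [LPA] is a bare quotient of terms, so equations are cheap and inequations are not: that vertices
    are nonzero and ghost paths linearly independent is read off from the representation [rho]. No
    normal form is set up for the whole algebra; an element is compared with B through [Dep], the
    number of CK2 expansions that bring it there. The group K_0 is never computed either.
    Homomorphisms into one finite group are counted instead, which for three vertices is a search
    through 12^3 functions, and an injection in each direction gives equality of the counts. That
    the 50 algebras differ and that the invariants are complete both come from [root_unique]: K_0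
    with [1], L/Soc and HS determine the numbers in [key], and these determine the representative up
    to one pair. For ILN and MT3+L no algebraic argument is made: isomorphic algebras have the same
    representative, and a finite check over the 512 graphs shows that both data are constant on each
    class. *)

Lemma ring_iso_intro (A B : pzRingType) (f : A -> B) :
  zmod_morphism f -> monoid_morphism f -> bijective f -> ring_iso A B.
Proof.
move=> fB fM bf.
pose g : {rmorphism A -> B} := HB.pack f (GRing.isZmodMorphism.Build A B f fB)
  (GRing.isMonoidMorphism.Build A B f fM).
by exists g.
Qed.

Lemma ring_iso_sym (A B : pzRingType) : ring_iso A B -> ring_iso B A.
Proof.
case=> f [g fK gK]; apply: (@ring_iso_intro _ _ g); last by exists f.
  by move=> x y; apply: (can_inj fK); rewrite gK rmorphB !gK.
split; first by apply: (can_inj fK); rewrite gK rmorph1.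
by move=> x y; apply: (can_inj fK); rewrite gK rmorphM !gK.
Qed.

Lemma ring_iso_refl (A : pzRingType) : ring_iso A A.
Proof. by exists idfun; exists id. Qed.

Lemma ring_iso_trans (A B C : pzRingType) :
  ring_iso A B -> ring_iso B C -> ring_iso A C.
Proof.
move=> [f bf] [g bg]; exists (g \o f : {rmorphism A -> C}).
exact: bij_comp.
Qed.

(** * Presentations and homomorphisms *)

Section Basics.
Variables (K : fieldType) (E : graph).
Local Notation L := (LPA K E).
Local Notation vert := (@vert K E).
Local Notation edg := (@edg K E).
Local Notation ghost := (@ghost K E).
Implicit Types (x y z : L) (v w : vertex E) (e f : edge E) (t u : term K E).

Lemma vertM v w : vert v * vert w = if v == w then vert v else 0.
Proof.
by rewrite [LHS]pi_LPA_mul; move/LPAP: (teq_vertex K v w) ->; case: eqP.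
Qed.

Lemma vertM_id v : vert v * vert v = vert v.
Proof. by rewrite vertM eqxx. Qed.

Lemma vert_edg e : vert (src e) * edg e = edg e.
Proof. by rewrite [LHS]pi_LPA_mul; apply/LPAP/teq_src_edge. Qed.

Lemma edg_vert e : edg e * vert (rng e) = edg e.
Proof. by rewrite [LHS]pi_LPA_mul; apply/LPAP/teq_edge_rng. Qed.

Lemma vert_ghost e : vert (rng e) * ghost e = ghost e.
Proof. by rewrite [LHS]pi_LPA_mul; apply/LPAP/teq_rng_ghost. Qed.

Lemma ghost_vert e : ghost e * vert (src e) = ghost e.
Proof. by rewrite [LHS]pi_LPA_mul; apply/LPAP/teq_ghost_src. Qed.

Lemma ghost_edg e f : ghost e * edg f = if e == f then vert (rng e) else 0.
Proof.
by rewrite [LHS]pi_LPA_mul; move/LPAP: (teq_CK1 K e f) ->; case: eqP.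
Qed.

Lemma ghost_edg_id e : ghost e * edg e = vert (rng e).
Proof. by rewrite ghost_edg eqxx. Qed.

Lemma pi_TSum (s : seq (term K E)) :
  \pi_L (TSum s) = \sum_(t <- s) (\pi_L t : L) :> L.
Proof.
elim: s => [|t s IH] /=; first by rewrite big_nil.
by rewrite big_cons -IH -[LHS]pi_LPA_add.
Qed.

Lemma CK2 v : (exists e, src e = v) ->
  vert v = \sum_(e | src e == v) edg e * ghost e.
Proof.
move=> ve; have /LPAP := teq_CK2 K ve; rewrite /vert => ->.
rewrite pi_TSum big_map big_filter big_enum_cond /=.
by apply: eq_bigr => e _; rewrite [RHS]pi_LPA_mul.
Qed.

Lemma LPA1 : 1 = \sum_v vert v.
Proof. exact: LPA_oneE. Qed.

Lemma scaleLl (a : K) x y : a *: (x * y) = (a *: x) * y.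
Proof. exact: LPA_scaleAl. Qed.

Lemma scaleLr (a : K) x y : a *: (x * y) = x * (a *: y).
Proof. exact: LPA_scaleAr. Qed.

Lemma LPA_ind (P : L -> Prop) :
  (forall v, P (vert v)) -> (forall e, P (edg e)) -> (forall e, P (ghost e)) ->
  P 0 -> (forall x y, P x -> P y -> P (x + y)) -> (forall x, P x -> P (- x)) ->
  (forall (a : K) x, P x -> P (a *: x)) ->
  (forall x y, P x -> P y -> P (x * y)) -> forall x, P x.
Proof.
move=> Pv Pe Pg P0 PD PN PZ PM x; elim/quotW: x.
elim=> //= [t Pt u Pu|t Pt|a t Pt|t Pt u Pu].
- by rewrite -pi_LPA_add; apply: PD.
- by rewrite -pi_LPA_opp; apply: PN.
- by rewrite -pi_LPA_scale; apply: PZ.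
- by rewrite -pi_LPA_mul; apply: PM.
Qed.

Lemma vert_edg_neq v e : v != src e -> vert v * edg e = 0.
Proof. by move=> /negPf ve; rewrite -vert_edg mulrA vertM ve mul0r. Qed.

Lemma vert_ghost_neq v e : v != rng e -> vert v * ghost e = 0.
Proof. by move=> /negPf ve; rewrite -vert_ghost mulrA vertM ve mul0r. Qed.

Lemma edg_vert_neq v e : rng e != v -> edg e * vert v = 0.
Proof. by move=> /negPf ve; rewrite -edg_vert -mulrA vertM ve mulr0. Qed.

Lemma ghost_vert_neq v e : src e != v -> ghost e * vert v = 0.
Proof. by move=> /negPf ve; rewrite -ghost_vert -mulrA vertM ve mulr0. Qed.

Definition sink v : bool := [forall e, src e != v].

Lemma sinkPn v : ~~ sink v <-> exists e, src e = v.
Proof.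
split=> [/forallPn[e /negPn/eqP ev]|[e ev]]; first by exists e.
by apply/forallPn; exists e; rewrite ev eqxx.
Qed.

Lemma vert_CK2 v : vert v =
  \sum_(e | src e == v) edg e * ghost e + (if sink v then vert v else 0).
Proof.
case: ifPn => [sv|/sinkPn ve]; last by rewrite addr0 CK2.
rewrite big1 ?add0r // => e ev; move/forallP/(_ e): sv; by rewrite ev.
Qed.

(** CK2 applied to 1. An element is thus recovered from its products with the ghost edges and with
    the sinks, and an induction may pass from x to these. *)
Lemma LPA1_CK2 x : x =
  \sum_e edg e * (ghost e * x) + \sum_(v | sink v) vert v * x.
Proof.
rewrite -{1}[x]mul1r LPA1 mulr_suml (eq_bigr _ (fun v _ =>
  congr1 (fun z => z * x) (vert_CK2 v))).
under eq_bigr do rewrite mulrDl.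
rewrite big_split /=; congr (_ + _).
  rewrite [RHS](partition_big (fun e => src e) xpredT) //=.
  apply: eq_bigr => v _; rewrite mulr_suml; apply: eq_bigr => e _.
  by rewrite mulrA.
by rewrite [RHS]big_mkcond /=; apply: eq_bigr => v _; case: ifP; rewrite // mul0r.
Qed.

End Basics.

Section ZeroIdeal.
Variable R : pzRingType.
Lemma zero_idealP :
  [/\ (0 : R) = 0, forall x y : R, x = 0 -> y = 0 -> x + y = 0,
      forall r x : R, x = 0 -> r * x = 0 & forall r x : R, x = 0 -> x * r = 0].
Proof.
split=> // [x y -> ->|r x ->|r x ->]; by rewrite ?addr0 ?mulr0 ?mul0r.
Qed.
Definition zero_ideal : ideal R := let: And4 a b c d := zero_idealP in
  Ideal (ideal_set := fun x : R => x = 0) a b c d.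
Lemma zero_idealE x : zero_ideal x <-> x = 0.
Proof. by rewrite /zero_ideal; case: zero_idealP. Qed.
End ZeroIdeal.

Section IdealLemmas.
Variables (R : pzRingType) (J : ideal R).
Implicit Types x y z : R.

Lemma idealB x y : J x -> J y -> J (x - y).
Proof. by move=> Jx Jy; apply: idealD => //; apply: idealN. Qed.

Lemma ideal_sum (I : Type) (r : seq I) (P : pred I) (F : I -> R) :
  (forall i, P i -> J (F i)) -> J (\sum_(i <- r | P i) F i).
Proof.
move=> JF; elim/big_ind: _ => //; [exact: ideal0|exact: idealD].
Qed.

Lemma ideal_subC x y : J (x - y) -> J (y - x).
Proof. by move=> /idealN; rewrite opprB. Qed.

Lemma ideal_trans x y z : J (x - y) -> J (y - z) -> J (x - z).
Proof. by move=> a b; rewrite -(subrKA y); apply: idealD. Qed.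

Lemma ideal_subD x y x' y' : J (x - x') -> J (y - y') -> J (x + y - (x' + y')).
Proof. by move=> a b; rewrite opprD addrACA; apply: idealD. Qed.

Lemma ideal_subM x y x' y' : J (x - x') -> J (y - y') -> J (x * y - x' * y').
Proof.
move=> a b; apply: (@ideal_trans _ (x' * y)).
  by rewrite -mulrBl; apply: idealMr.
by rewrite -mulrBr; apply: idealMl.
Qed.

Lemma ideal_sub0 x y : x = y -> J (x - y).
Proof. by move->; rewrite subrr; exact: ideal0. Qed.
End IdealLemmas.

Section Eval.
Variables (K : fieldType) (E F : graph) (J : ideal (LPA K F)).
Local Notation M := (LPA K F).
Variables (av : vertex E -> M) (ae ag : edge E -> M).

Fixpoint ev (t : term K E) : M :=
  match t with
  | TVertex v => av v
  | TEdge e => ae e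
  | TGhost e => ag e
  | TZero => 0
  | TAdd x y => ev x + ev y
  | TOpp x => - ev x
  | TScale a x => a *: ev x
  | TMul x y => ev x * ev y
  end.

Lemma idealZ (a : K) (x : M) : J x -> J (a *: x).
Proof. by move=> Jx; rewrite -[x]mul1r scaleLl; apply: idealMl. Qed.

(** The defining relations up to J. With J = 0 they give homomorphisms; with J = I(H) they give a
    section of the quotient map, for which CK2 holds only modulo J. *)
Definition rel_mod : Prop :=
  [/\ forall v w, J (av v * av w - (if v == w then av v else 0)),
      forall e, J (av (src e) * ae e - ae e) /\ J (ae e * av (rng e) - ae e),
      forall e, J (av (rng e) * ag e - ag e) /\ J (ag e * av (src e) - ag e),
      forall e f, J (ag e * ae f - (if e == f then av (rng e) else 0)) &
      forall v, (exists e, src e = v) ->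
        J (av v - \sum_(e | src e == v) ae e * ag e)].

Lemma ev_TSum s : ev (TSum s) = \sum_(t <- s) ev t.
Proof. by elim: s => [|t s IH] /=; rewrite ?big_nil // big_cons IH. Qed.

Lemma ev_eq (t u : term K E) : rel_mod -> term_eq t u -> J (ev t - ev u).
Proof.
case=> Rv Re Rg R1 R2; elim=> /= {t u}.
- by move=> x; apply: ideal_sub0.
- by move=> x y _; apply: ideal_subC.
- by move=> x y z _ a _; apply: ideal_trans.
- by move=> x x' y y' _ a _; apply: ideal_subD.
- by move=> x x' _ a; rewrite -opprD; apply: idealN.
- by move=> a x x' _ b; rewrite -scalerBr; apply: idealZ.
- by move=> x x' y y' _ a _; apply: ideal_subM.
- by move=> x y z; apply: ideal_sub0; rewrite addrA.
- by move=> x y; apply: ideal_sub0; rewrite addrC.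
- by move=> x; apply: ideal_sub0; rewrite add0r.
- by move=> x; apply: ideal_sub0; rewrite addNr.
- by move=> a b x; apply: ideal_sub0; rewrite scalerA.
- by move=> x; apply: ideal_sub0; rewrite scale1r.
- by move=> a x y; apply: ideal_sub0; rewrite scalerDr.
- by move=> a b x; apply: ideal_sub0; rewrite scalerDl.
- by move=> x y z; apply: ideal_sub0; rewrite mulrA.
- by move=> x y z; apply: ideal_sub0; rewrite mulrDl.
- by move=> x y z; apply: ideal_sub0; rewrite mulrDr.
- by move=> a x y; apply: ideal_sub0; rewrite scaleLl.
- by move=> a x y; apply: ideal_sub0; rewrite scaleLr.
- by move=> v w; have := Rv v w; case: ifP.
- by move=> e; case: (Re e).
- by move=> e; case: (Re e).
- by move=> e; case: (Rg e).
- by move=> e; case: (Rg e).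
- by move=> e f; have := R1 e f; case: ifP.
- move=> v /R2; rewrite ev_TSum big_map big_filter big_enum_cond /=.
  by [].
Qed.

(** Evaluation at a chosen representative. By [ev_eq] another choice changes the value by an element
    of J, so this is a homomorphism modulo J only. *)
Definition lift (x : LPA K E) : M := ev (repr x).

Hypothesis R : rel_mod.

Lemma lift_pi t : J (lift (\pi_(LPA K E) t) - ev t).
Proof. by apply: ev_eq => //; apply: LPA_reprP. Qed.

Lemma lift_mod_vert v : J (lift (vert K v) - av v).
Proof. exact: lift_pi. Qed.
Lemma lift_mod_edg e : J (lift (edg K e) - ae e).
Proof. exact: lift_pi. Qed.
Lemma lift_mod_ghost e : J (lift (ghost K e) - ag e).
Proof. exact: lift_pi. Qed.
Lemma lift_mod0 : J (lift 0).
Proof. by have := lift_pi (TZero K E); rewrite subr0. Qed.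
Lemma lift_modD x y : J (lift (x + y) - (lift x + lift y)).
Proof.
elim/quotW: x => x; elim/quotW: y => y.
rewrite [X in lift X]pi_LPA_add; apply: ideal_trans (lift_pi _) _ => /=.
by apply/ideal_subC/ideal_subD; apply: lift_pi.
Qed.
Lemma lift_modN x : J (lift (- x) + lift x).
Proof.
elim/quotW: x => x; rewrite [X in lift X + _]pi_LPA_opp.
rewrite -[X in J (_ + X)]opprK; apply: ideal_trans (lift_pi _) _ => /=.
by rewrite -opprD; apply/idealN/ideal_subC/lift_pi.
Qed.
Lemma lift_modZ a x : J (lift (a *: x) - a *: lift x).
Proof.
elim/quotW: x => x; rewrite [X in lift X]pi_LPA_scale.
apply: ideal_trans (lift_pi _) _ => /=.
by rewrite -scalerBr; apply/idealZ/ideal_subC/lift_pi.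
Qed.
Lemma lift_modM x y : J (lift (x * y) - (lift x * lift y)).
Proof.
elim/quotW: x => x; elim/quotW: y => y.
rewrite [X in lift X]pi_LPA_mul; apply: ideal_trans (lift_pi _) _ => /=.
by apply/ideal_subC/ideal_subM; apply: lift_pi.
Qed.
End Eval.

Section Hom.
Variables (K : fieldType) (E F : graph).
Local Notation M := (LPA K F).
Variables (av : vertex E -> M) (ae ag : edge E -> M).

Definition rel_ok : Prop :=
  [/\ forall v w, av v * av w = if v == w then av v else 0,
      forall e, av (src e) * ae e = ae e /\ ae e * av (rng e) = ae e,
      forall e, av (rng e) * ag e = ag e /\ ag e * av (src e) = ag e,
      forall e f, ag e * ae f = if e == f then av (rng e) else 0 &
      forall v, (exists e, src e = v) ->
        av v = \sum_(e | src e == v) ae e * ag e].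

Hypothesis R : rel_ok.

Lemma rel_ok_mod : rel_mod (zero_ideal M) av ae ag.
Proof.
case: R => Rv Re Rg R1 R2; split=> [v w|e|e|e f|v ve]; rewrite ?zero_idealE.
- by rewrite Rv subrr.
- by case: (Re e) => -> ->; rewrite subrr.
- by case: (Rg e) => -> ->; rewrite subrr.
- by rewrite R1 subrr.
- by rewrite R2 // subrr.
Qed.

Local Notation h := (lift av ae ag).
Let Z x y : zero_ideal M (x - y) -> x = y.
Proof. by move/zero_idealE/subr0_eq. Qed.

Lemma lift_vert v : h (vert K v) = av v.
Proof. exact/Z/lift_mod_vert/rel_ok_mod. Qed.
Lemma lift_edg e : h (edg K e) = ae e.
Proof. exact/Z/lift_mod_edg/rel_ok_mod. Qed.
Lemma lift_ghost e : h (ghost K e) = ag e.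
Proof. exact/Z/lift_mod_ghost/rel_ok_mod. Qed.
Lemma liftD x y : h (x + y) = h x + h y.
Proof. exact/Z/lift_modD/rel_ok_mod. Qed.
Lemma lift0 : h 0 = 0.
Proof. exact/zero_idealE/lift_mod0/rel_ok_mod. Qed.
Lemma liftN x : h (- x) = - h x.
Proof.
by apply/Z; rewrite opprK; apply/lift_modN/rel_ok_mod.
Qed.
Lemma liftZ a x : h (a *: x) = a *: h x.
Proof. exact/Z/lift_modZ/rel_ok_mod. Qed.
Lemma liftM x y : h (x * y) = h x * h y.
Proof. exact/Z/lift_modM/rel_ok_mod. Qed.
Lemma lift_sum (I : Type) (r : seq I) (P : pred I) G :
  h (\sum_(i <- r | P i) G i) = \sum_(i <- r | P i) h (G i).
Proof. exact: (big_morph h liftD lift0). Qed.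
Lemma lift1 : \sum_v av v = 1 -> h 1 = 1.
Proof. by move=> <-; rewrite LPA1 lift_sum; apply: eq_bigr => v _; rewrite lift_vert. Qed.
Lemma lift_zmod : zmod_morphism h.
Proof. by move=> x y; rewrite liftD liftN. Qed.
End Hom.

Lemma lift_inverse (K : fieldType) (E F : graph)
  (av : vertex E -> LPA K F) (ae ag : edge E -> LPA K F)
  (bv : vertex F -> LPA K E) (be bg : edge F -> LPA K E) :
  rel_ok av ae ag -> rel_ok bv be bg ->
  (forall v, lift bv be bg (av v) = vert K v) ->
  (forall e, lift bv be bg (ae e) = edg K e) ->
  (forall e, lift bv be bg (ag e) = ghost K e) ->
  cancel (lift av ae ag) (lift bv be bg).
Proof.
move=> Ra Rb Hv He Hg; elim/LPA_ind => [v|e|e||x y hx hy|x hx|a x hx|x y hx hy].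
- by rewrite lift_vert.
- by rewrite lift_edg.
- by rewrite lift_ghost.
- by rewrite !lift0.
- by rewrite !liftD // hx hy.
- by rewrite !liftN // hx.
- by rewrite !liftZ // hx.
- by rewrite !liftM // hx hy.
Qed.

Lemma LPA_iso (K : fieldType) (E F : graph)
  (av : vertex E -> LPA K F) (ae ag : edge E -> LPA K F)
  (bv : vertex F -> LPA K E) (be bg : edge F -> LPA K E) :
  rel_ok av ae ag -> rel_ok bv be bg ->
  (forall v, lift bv be bg (av v) = vert K v) ->
  (forall e, lift bv be bg (ae e) = edg K e) ->
  (forall e, lift bv be bg (ag e) = ghost K e) ->
  (forall v, lift av ae ag (bv v) = vert K v) ->
  (forall e, lift av ae ag (be e) = edg K e) ->
  (forall e, lift av ae ag (bg e) = ghost K e) ->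
  \sum_v av v = 1 ->
  ring_iso (LPA K E) (LPA K F).
Proof.
move=> Ra Rb H1 H2 H3 H4 H5 H6 S.
apply: (@ring_iso_intro _ _ (lift av ae ag)).
- exact: lift_zmod.
- by split; [exact: lift1|exact: liftM].
- by exists (lift bv be bg); apply: lift_inverse.
Qed.

(** * Isomorphisms from graph moves *)

Lemma big_sig (R : nmodType) (T : finType) (P Q : pred T) (F : T -> R) :
  \sum_(e : {p | P p} | Q (val e)) F (val e) = \sum_(p | P p && Q p) F p.
Proof.
rewrite [RHS](reindex_omap (val : {p | P p} -> T) insub) /=; last first.
  by move=> p /andP[Pp _]; rewrite insubT.
apply: eq_bigl => e; rewrite valK eqxx andbT.
by rewrite (valP e).
Qed.

Definition has_edge (s : seq nat) (p : 'I_3 * 'I_3) : bool := edge_code p \in s.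

Section GraphOf.
Variables (K : fieldType) (s : seq nat).
Local Notation G := (graph_of s).
Local Notation L := (LPA K G).
Local Notation has := (has_edge s).

Definition vt (i : 'I_3) : L := @vert K G i.
(** Total in the pair, with value 0 at a missing edge: formulas for the images of generators then
    need no membership proofs. *)
Definition ed (p : 'I_3 * 'I_3) : L :=
  if insub p is Some e then @edg K G e else 0.
Definition gh (p : 'I_3 * 'I_3) : L :=
  if insub p is Some e then @ghost K G e else 0.

Lemma edE (e : edge G) : @edg K G e = ed (val e).
Proof. by rewrite /ed valK. Qed.
Lemma ghE (e : edge G) : @ghost K G e = gh (val e).
Proof. by rewrite /gh valK. Qed.

Lemma vtM i j : vt i * vt j = if i == j then vt i else 0.
Proof. exact: vertM. Qed.
Lemma vt_ed i j : vt i * ed (i, j) = ed (i, j).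
Proof.
rewrite /ed; case: insubP => [e _ de|]; last by rewrite mulr0.
by have := @vert_edg K G e; rewrite /= de.
Qed.
Lemma ed_vt i j : ed (i, j) * vt j = ed (i, j).
Proof.
rewrite /ed; case: insubP => [e _ de|]; last by rewrite mul0r.
by have := @edg_vert K G e; rewrite /= de.
Qed.
Lemma vt_gh i j : vt j * gh (i, j) = gh (i, j).
Proof.
rewrite /gh; case: insubP => [e _ de|]; last by rewrite mulr0.
by have := @vert_ghost K G e; rewrite /= de.
Qed.
Lemma gh_vt i j : gh (i, j) * vt i = gh (i, j).
Proof.
rewrite /gh; case: insubP => [e _ de|]; last by rewrite mul0r.
by have := @ghost_vert K G e; rewrite /= de.
Qed.
Lemma gh_ed p q : has p -> gh p * ed q = if p == q then vt p.2 else 0.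
Proof.
rewrite /gh /ed => hp; rewrite insubT /=.
case: insubP => [f _ df|hq]; last first.
  rewrite mulr0; case: eqP => // pq.
  by rewrite -pq (hp : edge_code p \in s) in hq.
by rewrite ghost_edg -(inj_eq val_inj) df.
Qed.
Lemma vt_CK2 i j : has (i, j) ->
  vt i = \sum_(k | has (i, k)) ed (i, k) * gh (i, k).
Proof.
move=> hij; rewrite /vt (@CK2 K G i); last first.
  by exists (Sub (i, j) hij : edge G).
under eq_bigr do rewrite edE ghE.
rewrite (big_sig (fun p => edge_code p \in s) (fun p => p.1 == i)
  (fun p => ed p * gh p)).
rewrite (reindex_omap (pair i) (fun p => if p.1 == i then Some p.2 else None)) /=.
  by apply: eq_bigl => k; rewrite eqxx eqxx !andbT.
by move=> [a b] /andP[_ /= /eqP ->]; rewrite eqxx.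
Qed.
End GraphOf.

Section GraphOfHom.
Variables (K : fieldType) (s s' : seq nat).
Local Notation has := (has_edge s).
Local Notation M := (LPA K (graph_of s')).
Variables (av : 'I_3 -> M) (ae ag : 'I_3 * 'I_3 -> M).
Hypothesis Hv : forall i j, av i * av j = if i == j then av i else 0.
Hypothesis Hse : forall i j, has (i, j) -> av i * ae (i, j) = ae (i, j).
Hypothesis Her : forall i j, has (i, j) -> ae (i, j) * av j = ae (i, j).
Hypothesis Hrg : forall i j, has (i, j) -> av j * ag (i, j) = ag (i, j).
Hypothesis Hgs : forall i j, has (i, j) -> ag (i, j) * av i = ag (i, j).
Hypothesis H1 : forall p q, has p -> has q ->
  ag p * ae q = if p == q then av p.2 else 0.
Hypothesis H2 : forall i j, has (i, j) ->
  av i = \sum_(k | has (i, k)) ae (i, k) * ag (i, k).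

Lemma rel_ok_graph_of :
  @rel_ok K (graph_of s) (graph_of s') av (ae \o val) (ag \o val).
Proof.
split=> [||||] //=.
- by move=> [[i j] hij] /=; rewrite Hse ?Her.
- by move=> [[i j] hij] /=; rewrite Hrg ?Hgs.
- move=> e f; rewrite H1 ?(valP e) ?(valP f) //.
  exact: (valP e). exact: (valP f).
move=> v [[[i j] hij] /= iv]; rewrite -iv (H2 hij).
rewrite (big_sig (fun p => edge_code p \in s) (fun p => p.1 == i)
  (fun p => ae p * ag p)).
rewrite [RHS](reindex_omap (pair i)
  (fun p => if p.1 == i then Some p.2 else None)) /=.
  by apply: eq_bigl => k; rewrite eqxx eqxx !andbT.
by move=> [a b] /andP[_ /= /eqP ->]; rewrite eqxx.
Qed.
End GraphOfHom.

Section PermIso.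
Variables (K : fieldType) (s s' : seq nat) (p : 'I_3 -> 'I_3).
Hypothesis p_inj : injective p.
Hypothesis hp : forall i j, has_edge s' (p i, p j) = has_edge s (i, j).

Lemma rel_ok_perm : @rel_ok K (graph_of s) (graph_of s') (fun i => vt K s' (p i))
  ((fun q => ed K s' (p q.1, p q.2)) \o val)
  ((fun q => gh K s' (p q.1, p q.2)) \o val).
Proof.
apply: (@rel_ok_graph_of K s s' (fun i => vt K s' (p i))
  (fun q => ed K s' (p q.1, p q.2)) (fun q => gh K s' (p q.1, p q.2))) => /=.
- by move=> i j; rewrite vtM (inj_eq p_inj).
- by move=> *; rewrite vt_ed.
- by move=> *; rewrite ed_vt.
- by move=> *; rewrite vt_gh.
- by move=> *; rewrite gh_vt.
- move=> [a b] [c d] h _ /=; rewrite gh_ed ?hp //=.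
  by rewrite /eq_op /= !(inj_eq p_inj).
- move=> i j h; rewrite (@vt_CK2 _ _ _ (p j)) ?hp //.
  rewrite (reindex_inj p_inj) /=.
  by apply: eq_bigl => k; rewrite hp.
Qed.
End PermIso.

Lemma graph_of_perm (K : fieldType) s s' (p : 'I_3 -> 'I_3) : injective p ->
  (forall i j, has_edge s' (p i, p j) = has_edge s (i, j)) ->
  ring_iso (LPA K (graph_of s)) (LPA K (graph_of s')).
Proof.
move=> p_inj hp; have [q pq qp] := injF_bij p_inj.
have q_inj : injective q by apply: can_inj qp.
have hq i j : has_edge s (q i, q j) = has_edge s' (i, j) by rewrite -hp !qp.
have Rp := @rel_ok_perm K s s' p p_inj hp.
have Rq := @rel_ok_perm K s' s q q_inj hq.
have Lv R0 (a : 'I_3) i : R0 = a -> i = a -> @vert K (graph_of s) i = vt K s a by move=> _ ->.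
have L2 e : lift (K:=K) (E:=graph_of s') (F:=graph_of s) (fun i => vt K s (q i))
  ((fun q0 => ed K s (q q0.1, q q0.2)) \o val)
  ((fun q0 => gh K s (q q0.1, q q0.2)) \o val) (ed K s' e) =
  ed K s (q e.1, q e.2).
  rewrite /ed; case: insubP => [f _ de|h]; first by rewrite lift_edg //= de.
  rewrite lift0 //; case: insubP => // f hf; move: h hf.
  by move: (hq e.1 e.2); rewrite /has_edge -surjective_pairing => -> /negPf ->.
have L3 e : lift (K:=K) (E:=graph_of s') (F:=graph_of s) (fun i => vt K s (q i))
  ((fun q0 => ed K s (q q0.1, q q0.2)) \o val)
  ((fun q0 => gh K s (q q0.1, q q0.2)) \o val) (gh K s' e) =
  gh K s (q e.1, q e.2).
  rewrite /gh; case: insubP => [f _ de|h]; first by rewrite lift_ghost //= de.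
  rewrite lift0 //; case: insubP => // f hf; move: h hf.
  by move: (hq e.1 e.2); rewrite /has_edge -surjective_pairing => -> /negPf ->.
have L2' e : lift (K:=K) (E:=graph_of s) (F:=graph_of s') (fun i => vt K s' (p i))
  ((fun q0 => ed K s' (p q0.1, p q0.2)) \o val)
  ((fun q0 => gh K s' (p q0.1, p q0.2)) \o val) (ed K s e) =
  ed K s' (p e.1, p e.2).
  rewrite /ed; case: insubP => [f _ de|h]; first by rewrite lift_edg //= de.
  rewrite lift0 //; case: insubP => // f hf; move: h hf.
  by move: (hp e.1 e.2); rewrite /has_edge -surjective_pairing => -> /negPf ->.
have L3' e : lift (K:=K) (E:=graph_of s) (F:=graph_of s') (fun i => vt K s' (p i))
  ((fun q0 => ed K s' (p q0.1, p q0.2)) \o val)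
  ((fun q0 => gh K s' (p q0.1, p q0.2)) \o val) (gh K s e) =
  gh K s' (p e.1, p e.2).
  rewrite /gh; case: insubP => [f _ de|h]; first by rewrite lift_ghost //= de.
  rewrite lift0 //; case: insubP => // f hf; move: h hf.
  by move: (hp e.1 e.2); rewrite /has_edge -surjective_pairing => -> /negPf ->.
apply: (LPA_iso Rp Rq) => [v|e|e|v|e|e|] /=.
- by rewrite (lift_vert Rq) pq.
- by rewrite L2 /= !pq -surjective_pairing edE.
- by rewrite L3 /= !pq -surjective_pairing ghE.
- by rewrite (lift_vert Rp) qp.
- by rewrite L2' /= !qp -surjective_pairing edE.
- by rewrite L3' /= !qp -surjective_pairing ghE.
by rewrite LPA1 [RHS](reindex_inj p_inj).
Qed.

Section Shift.
Variables (K : fieldType) (s s' : seq nat) (u v : 'I_3).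
Local Notation has := (has_edge s).
Local Notation has' := (has_edge s').
Hypothesis uv : u != v.
Hypothesis huv : has (u, v).
Hypothesis hv : exists y, has (v, y).
(** If both u and v had an edge to w, the move would give u two parallel edges to w. *)
Hypothesis disj : forall w, has (u, w) -> w != v -> has (v, w) = false.
Hypothesis hs' : forall x y,
  has' (x, y) = if x == u then (has (u, y) && (y != v)) || has (v, y)
                else has (x, y).

(* Edges of s at u through v compose: e f for the new edge u -> z, with inverse
   e = \sum_f (e f) f^*. *)
Let av := vt K s.
Let ae (p : 'I_3 * 'I_3) := if (p.1 == u) && has (v, p.2)
  then ed K s (u, v) * ed K s (v, p.2) else ed K s p.
Let ag (p : 'I_3 * 'I_3) := if (p.1 == u) && has (v, p.2)
  then gh K s (v, p.2) * gh K s (u, v) else gh K s p.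
Let bv := vt K s'.
Let be (p : 'I_3 * 'I_3) := if p == (u, v)
  then \sum_(z | has (v, z)) ed K s' (u, z) * gh K s' (v, z) else ed K s' p.
Let bg (p : 'I_3 * 'I_3) := if p == (u, v)
  then \sum_(z | has (v, z)) ed K s' (v, z) * gh K s' (u, z) else gh K s' p.

Lemma shift_plain x y : has' (x, y) -> (x == u) && has (v, y) = false ->
  has (x, y) /\ ((x, y) == (u, v)) = false.
Proof.
rewrite hs'; case: (eqVneq x u) => [->|xu] /=.
  move=> /orP[/andP[h yv] _|-> //]; split => //.
  by rewrite xpair_eqE eqxx (negPf yv).
by move=> h _; rewrite xpair_eqE (negPf xu).
Qed.

Lemma rel_ok_shift :
  @rel_ok K (graph_of s') (graph_of s) av (ae \o val) (ag \o val).
Proof.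
apply: (@rel_ok_graph_of K s' s av ae ag); rewrite /av /ae /ag.
- exact: vtM.
- move=> i j _ /=; case: ifP => [/andP[/eqP -> _]|_]; last exact: vt_ed.
  by rewrite mulrA vt_ed.
- move=> i j _ /=; case: ifP => [_|_]; last exact: ed_vt.
  by rewrite -mulrA ed_vt.
- move=> i j _ /=; case: ifP => [_|_]; last exact: vt_gh.
  by rewrite mulrA vt_gh.
- move=> i j _ /=; case: ifP => [/andP[/eqP -> _]|_]; last exact: gh_vt.
  by rewrite -mulrA gh_vt.
- move=> [x y] [x' y'] hp hq /=.
  case: ifP => c; case: ifP => c'.
  + case/andP: c => /eqP -> hy; case/andP: c' => /eqP -> hy'.
    rewrite -mulrA (mulrA (gh K s (u, v))) gh_ed // eqxx vt_ed gh_ed //.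
    by rewrite !xpair_eqE !eqxx.
  + case/andP: c => /eqP -> hy; have [h1 h2] := shift_plain hq c'.
    rewrite -mulrA gh_ed // eq_sym h2 mulr0.
    case: eqP => // -[ex ey]; move: c'; by rewrite -ex -ey eqxx hy.
  + case/andP: c' => /eqP -> hy'; have [h1 h2] := shift_plain hp c.
    rewrite mulrA gh_ed // h2 mul0r.
    case: eqP => // -[ex ey]; move: c; by rewrite ex ey eqxx hy'.
  + have [h1 h2] := shift_plain hp c.
    by rewrite gh_ed.
- move=> i j; rewrite hs' => hij.
  case: (eqVneq i u) hij => [-> _|iu hij] /=; last first.
    rewrite (vt_CK2 K hij); apply: eq_big => [k|k _] //.
    by rewrite hs' (negPf iu).
  rewrite (vt_CK2 K huv) (bigD1 v) //= [RHS](bigID (fun k => has (v, k))) /=.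
  congr (_ + _).
    case: hv => y hvy.
    (* The summand of the edge e from u to v: in e v e^* the vertex v is replaced by its CK2 sum of
       the f f^*, which leaves the terms (e f)(e f)^* of the new edges. *)
    transitivity (ed K s (u, v) * vt K s v * gh K s (u, v)).
      by rewrite ed_vt.
    rewrite (vt_CK2 K hvy) mulr_sumr mulr_suml.
    apply: eq_big => [k|k hk]; first by rewrite hs' eqxx orbC andb_orl andbb; case: (has (v, k)); rewrite ?andbF.
    by rewrite hk !mulrA.
  apply: eq_big => [k|k /andP[hk kv]].
    rewrite hs' eqxx; case hk : (has (u, k)) => /=; last by case: (has (v, k)).
    case: (eqVneq k v) => [->|kv] /=; first by case: (has (v, v)).
    by rewrite disj.
  by rewrite disj.
Qed.

Lemma has'v z : has' (v, z) = has (v, z).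
Proof. by rewrite hs' eq_sym (negPf uv). Qed.

Lemma has'u z : has (v, z) -> has' (u, z).
Proof. by move=> h; rewrite hs' eqxx h orbT. Qed.

Lemma has'o x y : has (x, y) -> ((x, y) == (u, v)) = false -> has' (x, y).
Proof.
rewrite hs'; case: (eqVneq x u) => [->|_] // h.
by rewrite xpair_eqE eqxx /= => ->; rewrite h.
Qed.

Lemma rel_ok_unshift :
  @rel_ok K (graph_of s) (graph_of s') bv (be \o val) (bg \o val).
Proof.
apply: (@rel_ok_graph_of K s s' bv be bg); rewrite /bv /be /bg.
- exact: vtM.
- move=> i j _; case: eqP => [[-> _]|_]; last exact: vt_ed.
  by rewrite mulr_sumr; apply: eq_bigr => k _; rewrite mulrA vt_ed.
- move=> i j _; case: eqP => [[_ ->]|_]; last exact: ed_vt.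
  by rewrite mulr_suml; apply: eq_bigr => k _; rewrite -mulrA gh_vt.
- move=> i j _; case: eqP => [[_ ->]|_]; last exact: vt_gh.
  by rewrite mulr_sumr; apply: eq_bigr => k _; rewrite mulrA vt_ed.
- move=> i j _; case: eqP => [[-> _]|_]; last exact: gh_vt.
  by rewrite mulr_suml; apply: eq_bigr => k _; rewrite -mulrA gh_vt.
- move=> [x y] [x' y'] hp hq; case: ifP => c; case: ifP => c'.
  + move/eqP: c => [-> ->]; move/eqP: c' => [-> ->]; rewrite eqxx /=.
    case: hv => z0 hz0; rewrite -has'v in hz0.
    rewrite (vt_CK2 K hz0) mulr_suml; apply: eq_big => [k|k hk].
      by rewrite has'v.
    rewrite -mulrA mulr_sumr (bigD1 k) //= big1 ?addr0.
      by rewrite (mulrA (gh K s' _)) gh_ed ?has'u // eqxx vt_gh.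
    move=> l /andP[hl lk]; rewrite (mulrA (gh K s' _)) gh_ed ?has'u //.
    by rewrite xpair_eqE eqxx /= eq_sym (negPf lk) mul0r.
  + have cc : ((x, y) == (x', y')) = false by rewrite (eqP c) eq_sym.
    rewrite cc mulr_suml big1 // => k hk.
    rewrite -mulrA gh_ed ?has'u //; case: eqP => [[e1 e2]|]; last by rewrite mulr0.
    have kv : k != v by apply: contraFneq c' => kv; rewrite -e1 -e2 kv.
    by move: hk; rewrite (disj _ kv) // e1 e2.
  + have cc : ((x, y) == (x', y')) = false by rewrite (eqP c').
    rewrite cc mulr_sumr big1 // => k hk.
    rewrite mulrA gh_ed ?has'o //; case: eqP => [[e1 e2]|]; last by rewrite mul0r.
    have kv : k != v by apply: contraFneq c => kv; rewrite e1 e2 kv.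
    by move: hk; rewrite (disj _ kv) // -e1 -e2.
  + by rewrite gh_ed ?has'o.
- move=> i j hij; case: (eqVneq i u) hij => [-> _|iu hij]; last first.
    have hij' : has' (i, j) by rewrite hs' (negPf iu).
    rewrite (vt_CK2 K hij'); apply: eq_big => [k|k _].
      by rewrite hs' (negPf iu).
    by rewrite xpair_eqE (negPf iu).
  case: hv => y hvy; rewrite (vt_CK2 K (has'u hvy)).
  rewrite [RHS](bigD1 v) //= eqxx (bigID (fun k => has (v, k))) /=.
  congr (_ + _).
    (* Here e is the sum of the g f^*, where g is the new edge that stands for e f. In e e^* the
       mixed products vanish by CK1, and the g g^* remain. *)
    transitivity (\sum_(z | has (v, z)) ed K s' (u, z) * gh K s' (u, z)).
      apply: eq_bigl => k; rewrite hs' eqxx.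
      by case: (has (v, k)); rewrite ?andbF ?orbT.
    rewrite mulr_suml; apply: eq_bigr => k hk.
    rewrite -mulrA mulr_sumr (bigD1 k) //= big1 ?addr0.
      by rewrite (mulrA (gh K s' _)) gh_ed ?has'v // eqxx vt_gh.
    move=> l /andP[hl lk]; rewrite (mulrA (gh K s' _)) gh_ed ?has'v //.
    by rewrite xpair_eqE eqxx /= eq_sym (negPf lk) mul0r.
  apply: eq_big => [k|k].
    rewrite hs' eqxx; case hk : (has (u, k)) => /=; last by case: (has (v, k)).
    case: (eqVneq k v) => [->|kv] /=; first by case: (has (v, v)).
    by rewrite disj.
  rewrite hs' eqxx => /andP[/orP[/andP[_ kv]|->]] //.
  by rewrite xpair_eqE eqxx (negPf kv).
Qed.

Lemma graph_of_shift : ring_iso (LPA K (graph_of s)) (LPA K (graph_of s')).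
Proof.
apply: ring_iso_sym.
have Ra := rel_ok_shift; have Rb := rel_ok_unshift.
pose ha := @lift K (graph_of s') (graph_of s) av (ae \o val) (ag \o val).
pose hb := @lift K (graph_of s) (graph_of s') bv (be \o val) (bg \o val).
have hbe p : has p -> hb (ed K s p) = be p.
  by move=> hp; rewrite /ed insubT /hb lift_edg.
have hbg p : has p -> hb (gh K s p) = bg p.
  by move=> hp; rewrite /gh insubT /hb lift_ghost.
have hae p : has' p -> ha (ed K s' p) = ae p.
  by move=> hp; rewrite /ed insubT /ha lift_edg.
have hag p : has' p -> ha (gh K s' p) = ag p.
  by move=> hp; rewrite /gh insubT /ha lift_ghost.
have vu z : ((v, z) == (u, v)) = false.
  by rewrite xpair_eqE eq_sym (negPf uv).
apply: (LPA_iso Ra Rb) => [w|[[x y] hp]|[[x y] hp]|w|[[x y] hp]|[[x y] hp]|].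
- by rewrite (lift_vert Rb).
- rewrite edE /= -/hb /ae /=; case: ifP => [/andP[/eqP -> hy]|c]; last first.
    have [h1 h2] := shift_plain hp c.
    by rewrite hbe // /be h2.
  rewrite /hb liftM // -/hb !hbe // /be eqxx vu.
  rewrite mulr_suml (bigD1 y) //= big1 ?addr0.
    by rewrite -mulrA gh_ed ?has'v // eqxx ed_vt.
  move=> k /andP[hk ky]; rewrite -mulrA gh_ed ?has'v //.
  by rewrite xpair_eqE eqxx /= (negPf ky) mulr0.
- rewrite ghE /= -/hb /ag /=; case: ifP => [/andP[/eqP -> hy]|c]; last first.
    have [h1 h2] := shift_plain hp c.
    by rewrite hbg // /bg h2.
  rewrite /hb liftM // -/hb !hbg // /bg eqxx vu.
  rewrite mulr_sumr (bigD1 y) //= big1 ?addr0.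
    by rewrite mulrA gh_ed ?has'v // eqxx vt_gh.
  move=> k /andP[hk ky]; rewrite mulrA gh_ed ?has'v //.
  by rewrite xpair_eqE eqxx /= eq_sym (negPf ky) mul0r.
- by rewrite (lift_vert Ra).
- rewrite edE /= -/ha /be /=; case: ifP => [/eqP[-> ->]|c]; last first.
    rewrite hae ?has'o // /ae /=; case: ifP => // /andP[/eqP xu hvy].
    by move: c hvy; rewrite xu xpair_eqE eqxx /= => yv; rewrite disj ?yv -?xu.
  rewrite /ha lift_sum // -/ha; case: hv => z0 hz0.
  transitivity (ed K s (u, v) * vt K s v); last by rewrite ed_vt.
  rewrite (vt_CK2 K hz0) mulr_sumr; apply: eq_bigr => k hk.
  rewrite /ha liftM // -/ha hae ?has'u // hag ?has'v // /ae /ag /= eqxx hk /=.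
  by rewrite eq_sym (negPf uv) mulrA.
- rewrite ghE /= -/ha /bg /=; case: ifP => [/eqP[-> ->]|c]; last first.
    rewrite hag ?has'o // /ag /=; case: ifP => // /andP[/eqP xu hvy].
    by move: c hvy; rewrite xu xpair_eqE eqxx /= => yv; rewrite disj ?yv -?xu.
  rewrite /ha lift_sum // -/ha; case: hv => z0 hz0.
  transitivity (vt K s v * gh K s (u, v)); last by rewrite vt_gh.
  rewrite (vt_CK2 K hz0) mulr_suml; apply: eq_bigr => k hk.
  rewrite /ha liftM // -/ha hag ?has'u // hae ?has'v // /ae /ag /= eqxx hk /=.
  by rewrite eq_sym (negPf uv) mulrA.
by rewrite LPA1.
Qed.
End Shift.

Section GraphIso.
Variables (K : fieldType) (E F : graph).
Variables (fv : vertex E -> vertex F) (fe : edge E -> edge F).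
Variables (gv : vertex F -> vertex E) (ge : edge F -> edge E).
Hypothesis fvK : cancel fv gv.
Hypothesis gvK : cancel gv fv.
Hypothesis feK : cancel fe ge.
Hypothesis geK : cancel ge fe.
Hypothesis src_fe : forall e, src (fe e) = fv (src e).
Hypothesis rng_fe : forall e, rng (fe e) = fv (rng e).

Lemma rel_ok_graph_iso : @rel_ok K E F (fun v => vert K (fv v))
  (fun e => edg K (fe e)) (fun e => ghost K (fe e)).
Proof.
split=> [v w|e|e|e f|v ve].
- by rewrite vertM (can_eq fvK).
- by rewrite -src_fe -rng_fe vert_edg edg_vert.
- by rewrite -src_fe -rng_fe vert_ghost ghost_vert.
- by rewrite ghost_edg (can_eq feK) rng_fe.
rewrite CK2; last by case: ve => e <-; exists (fe e); rewrite src_fe.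
rewrite (reindex fe) /=; last by exists ge => ? _; rewrite ?feK ?geK.
apply: eq_bigl => e.
by rewrite src_fe (can_eq fvK).
Qed.
End GraphIso.

Lemma graph_iso_LPA (K : fieldType) (E F : graph)
  (fv : vertex E -> vertex F) (fe : edge E -> edge F) :
  bijective fv -> bijective fe ->
  (forall e, src (fe e) = fv (src e)) -> (forall e, rng (fe e) = fv (rng e)) ->
  ring_iso (LPA K E) (LPA K F).
Proof.
move=> [gv fvK gvK] [ge feK geK] hs hr.
have Ra := rel_ok_graph_iso K fvK feK geK hs hr.
have hs' e : src (ge e) = gv (src e) by rewrite -{2}(geK e) hs fvK.
have hr' e : rng (ge e) = gv (rng e) by rewrite -{2}(geK e) hr fvK.
have Rb := rel_ok_graph_iso K gvK geK feK hs' hr'.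
apply: (LPA_iso Ra Rb) => [v|e|e|v|e|e|].
- by rewrite lift_vert // fvK.
- by rewrite lift_edg // feK.
- by rewrite lift_ghost // feK.
- by rewrite lift_vert // gvK.
- by rewrite lift_edg // geK.
- by rewrite lift_ghost // geK.
by rewrite LPA1 [RHS](reindex fv) //; exists gv => ? _; rewrite ?fvK ?gvK.
Qed.

(** * Reduction to fifty graphs *)

Definition o3 : seq 'I_3 :=
  [:: @Ordinal 3 0 isT; @Ordinal 3 1 isT; @Ordinal 3 2 isT].

Lemma in_o3 i : i \in o3.
Proof. by case: i => [[|[|[|]]]]. Qed.

Definition codes : seq nat := [:: 11; 12; 13; 21; 22; 23; 31; 32; 33]%N.

Fixpoint bits (n m : nat) : bitseq :=
  if n is n'.+1 then odd m :: bits n' m./2 else [::].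
Definition mk (m : nat) : seq nat := mask (bits 9 m) codes.

Lemma bits_surj (b : bitseq) : exists2 m, (m < 2 ^ size b)%N & bits (size b) m = b.
Proof.
elim: b => [|c b [m mb IH]] /=; first by exists 0%N.
exists (c + m.*2)%N; last by rewrite oddD odd_double addbF oddb half_bit_double IH.
rewrite expnS mul2n; case: c; last by rewrite ltn_double.
by rewrite add1n -doubleS leq_double.
Qed.

Lemma edge_code_in p : edge_code p \in codes.
Proof. by case: p => [[[|[|[|]]]] // ?] [[|[|[|]]]]. Qed.

Lemma edge_code_inj : injective edge_code.
Proof.
move=> [[a ha] [b hb]] [[c hc] [d hd]] h.
have [e1 e2] : a = c /\ b = d.
  by move: a b c d ha hb hc hd h; do 4 (case=> [|[|[|?]]] //).
by congr pair; apply: val_inj.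
Qed.

Lemma mk_surj (P : pred ('I_3 * 'I_3)) :
  exists2 m, (m < 512)%N & has_edge (mk m) =1 P.
Proof.
pose Q c := [exists p, (edge_code p == c) && P p].
have [m m512 bm] := @bits_surj [seq Q c | c <- codes].
rewrite size_map in m512 bm.
exists m => // p; rewrite /has_edge /mk bm -filter_mask mem_filter edge_code_in andbT.
apply/existsP/idP => [[q /andP[/eqP/edge_code_inj -> //]]|Pp].
by exists p; rewrite eqxx.
Qed.

Definition perm_link (s s' : seq nat) : bool :=
  has (fun a => has (fun b => has (fun c => uniq [:: a; b; c] &&
    all (fun i : 'I_3 => all (fun j : 'I_3 =>
      has_edge s' (nth a [:: a; b; c] i, nth a [:: a; b; c] j) ==
      has_edge s (i, j)) o3) o3) o3) o3) o3.

Definition shift_link (s s' : seq nat) : bool :=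
  has (fun u => has (fun v => [&& u != v, has_edge s (u, v),
    has (fun y => has_edge s (v, y)) o3,
    all (fun w => [|| ~~ has_edge s (u, w), w == v | ~~ has_edge s (v, w)]) o3 &
    all (fun x => all (fun y => has_edge s' (x, y) ==
      if x == u then (has_edge s (u, y) && (y != v)) || has_edge s (v, y)
      else has_edge s (x, y)) o3) o3]) o3) o3.

Lemma perm_linkP K s s' : perm_link s s' ->
  ring_iso (LPA K (graph_of s)) (LPA K (graph_of s')).
Proof.
case/hasP=> a _ /hasP[b _ /hasP[c _ /andP[un /allP H]]].
apply: (@graph_of_perm K s s' (fun i => nth a [:: a; b; c] i)).
  move=> i j /eqP; rewrite nth_uniq // => /eqP; exact: val_inj.
by move=> i j; have /allP/(_ _ (in_o3 j))/eqP := H _ (in_o3 i).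
Qed.

Lemma shift_linkP K s s' : shift_link s s' ->
  ring_iso (LPA K (graph_of s)) (LPA K (graph_of s')).
Proof.
case/hasP=> u _ /hasP[v _ /and5P[uv huv /hasP[y _ hy] /allP H1 /allP H2]].
apply: (@graph_of_shift K s s' u v) => //.
- by exists y.
- by move=> w uw wv; have := H1 _ (in_o3 w); rewrite uw (negPf wv) => /negPf.
- by move=> x z; have /allP/(_ _ (in_o3 z))/eqP := H2 _ (in_o3 x).
Qed.

Definition link s s' := [|| perm_link s s', shift_link s s' | shift_link s' s].

Lemma linkP K s s' : link s s' ->
  ring_iso (LPA K (graph_of s)) (LPA K (graph_of s')).
Proof.
case/or3P; [exact: perm_linkP|exact: shift_linkP|].
by move=> /(shift_linkP K)/ring_iso_sym.
Qed.

(* The graph number m has the edges of [codes] selected by the binary digits of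
   m; entry m of the table is the number of a graph one move closer to the
   representative of its class. *)
Definition parent_table : seq nat := [::
  0; 256; 32; 48; 32; 48; 40; 56; 32; 144; 160; 27; 66; 45; 224; 480; 256;
  272; 144; 304; 129; 49; 41; 57; 48; 304; 27; 27; 133; 408; 43; 59; 32; 129;
  66; 37; 130; 131; 104; 120; 40; 41; 224; 59; 104; 216; 232; 248; 48; 49;
  54; 408; 131; 387; 216; 472; 56; 57; 480; 59; 120; 472; 248; 504; 32; 144;
  130; 195; 65; 325; 224; 480; 130; 146; 162; 91; 162; 333; 118; 463; 129;
  145; 146; 211; 161; 267; 406; 471; 131; 147; 91; 94; 163; 421; 414; 94; 66;
  73; 162; 227; 162; 357; 78; 487; 104; 150; 114; 242; 166; 365; 206; 486;
  133; 149; 118; 243; 163; 419; 94; 115; 120; 466; 127; 498; 458; 423; 462;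
  511; 32; 129; 130; 131; 130; 131; 104; 120; 66; 73; 146; 155; 138; 173; 78;
  191; 144; 145; 146; 147; 146; 147; 150; 466; 216; 404; 155; 171; 220; 412;
  242; 498; 144; 145; 146; 147; 162; 163; 150; 295; 224; 361; 173; 363; 156;
  171; 366; 462; 11; 267; 434; 435; 436; 437; 438; 439; 504; 468; 506; 171;
  508; 476; 510; 511; 40; 41; 104; 216; 224; 453; 232; 248; 104; 150; 166;
  219; 228; 237; 246; 486; 41; 297; 150; 406; 211; 299; 214; 470; 216; 406;
  219; 220; 412; 414; 246; 502; 216; 86; 228; 355; 220; 221; 206; 462; 232;
  214; 237; 246; 235; 493; 238; 254; 43; 299; 498; 414; 243; 501; 502; 478;
  248; 470; 486; 502; 462; 478; 254; 510; 256; 272; 129; 49; 144; 304; 41;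
  57; 129; 145; 161; 283; 292; 301; 310; 468; 272; 273; 145; 401; 145; 401;
  297; 313; 49; 401; 283; 283; 308; 405; 299; 315; 144; 145; 162; 163; 146;
  147; 150; 466; 41; 297; 301; 315; 150; 406; 214; 470; 304; 401; 404; 311;
  147; 403; 406; 407; 57; 313; 468; 315; 466; 407; 470; 471; 48; 304; 386;
  451; 325; 27; 327; 59; 131; 147; 163; 421; 333; 397; 374; 334; 49; 401;
  402; 467; 267; 283; 299; 315; 387; 403; 419; 435; 419; 435; 427; 443; 224;
  361; 362; 363; 357; 355; 359; 367; 216; 406; 426; 414; 356; 357; 367; 502;
  408; 405; 374; 379; 421; 435; 414; 374; 472; 407; 370; 363; 423; 439; 478;
  382; 48; 49; 131; 387; 390; 408; 216; 472; 133; 329; 163; 419; 398; 429;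
  397; 397; 304; 401; 147; 403; 406; 407; 406; 407; 472; 473; 421; 435; 414;
  415; 414; 414; 11; 267; 434; 435; 436; 423; 420; 439; 43; 299; 429; 443;
  242; 414; 246; 478; 27; 283; 426; 439; 412; 439; 436; 439; 59; 315; 426;
  443; 498; 429; 502; 431; 56; 57; 120; 472; 480; 59; 248; 504; 120; 466;
  466; 423; 463; 493; 502; 511; 57; 313; 466; 407; 471; 315; 470; 471; 472;
  407; 423; 439; 412; 221; 414; 478; 504; 468; 506; 355; 487; 229; 510; 511;
  248; 470; 493; 478; 486; 502; 254; 510; 59; 315; 502; 243; 244; 443; 502;
  247; 504; 471; 511; 491; 511; 253; 510; 511]%N.

(** The masks of the graphs in [list3], in the same order, without 438 and 447: the table leads from
    both to 414, which is also in the list. *)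
Definition root_masks : seq nat := [::
  130; 104; 131; 216; 27; 248; 472; 59; 504; 32; 40; 144; 48; 129; 41; 56;
  304; 49; 57; 387; 0; 256; 272; 232; 120; 414; 146; 150; 147; 406; 283; 470;
  407; 315; 439; 471; 443; 145; 297; 401; 403; 313; 273; 502; 511; 214; 466;
  238; 510; 254]%N.

Definition parent (m : nat) : nat := nth 0%N parent_table m.
(** Five steps lead every mask to a representative, as [root_in] checks. *)
Definition root (m : nat) : nat := iter 5 parent m.

Lemma parent_link : all (fun m => link (mk m) (mk (parent m))) (iota 0 512).
Proof. by vm_compute. Qed.

Lemma parent_lt : all (fun m => parent m < 512)%N (iota 0 512).
Proof. by vm_compute. Qed.

Lemma root_in : all (fun m => root m \in root_masks) (iota 0 512).
Proof. by vm_compute. Qed.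

Lemma parent_iso K m : (m < 512)%N ->
  (parent m < 512)%N /\
  ring_iso (LPA K (graph_of (mk m))) (LPA K (graph_of (mk (parent m)))).
Proof.
move=> m512; have mi : m \in iota 0 512 by rewrite mem_iota.
by split; [exact: (allP parent_lt)|exact/linkP/(allP parent_link)].
Qed.

Lemma iter_parent_iso K n m : (m < 512)%N ->
  (iter n parent m < 512)%N /\
  ring_iso (LPA K (graph_of (mk m))) (LPA K (graph_of (mk (iter n parent m)))).
Proof.
move=> m512; elim: n => [|n [h IH]] /=; first by split=> //; exact: ring_iso_refl.
have [h1 h2] := parent_iso K h; split=> //; exact: ring_iso_trans IH h2.
Qed.

Lemma root_iso K m : (m < 512)%N ->
  ring_iso (LPA K (graph_of (mk m))) (LPA K (graph_of (mk (root m)))).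
Proof. by case/(iter_parent_iso K 5). Qed.

Lemma in_L3_graph_of s : in_L3 (graph_of s).
Proof.
split; last by rewrite /= card_ord.
move=> e f /= h1 h2; apply: val_inj.
by rewrite (surjective_pairing (val e)) h1 h2 -surjective_pairing.
Qed.

Lemma in_L3_mask (E : graph) : in_L3 E -> exists m (f : 'I_3 -> vertex E),
  [/\ (m < 512)%N, bijective f &
    forall i j, has_edge (mk m) (i, j) =
      [exists e : edge E, (src e == f i) && (rng e == f j)]].
Proof.
case=> _ E3; pose f (i : 'I_3) : vertex E := enum_val (cast_ord (esym E3) i).
pose P (p : 'I_3 * 'I_3) :=
  [exists e : edge E, (src e == f p.1) && (rng e == f p.2)].
have [m m512 hm] := mk_surj P; exists m, f; split; [by [] | | by move=> i j; rewrite hm].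
exists (fun v => cast_ord E3 (enum_rank v)) => i.
  by rewrite /f enum_valK cast_ordKV.
by rewrite /f cast_ordK enum_rankK.
Qed.

Lemma mask_iso K (E : graph) m (f : 'I_3 -> vertex E) : Sing E -> bijective f ->
  (forall i j, has_edge (mk m) (i, j) =
      [exists e : edge E, (src e == f i) && (rng e == f j)]) ->
  ring_iso (LPA K E) (LPA K (graph_of (mk m))).
Proof.
move=> SE [g fK gK] H; apply: ring_iso_sym.
have ex (p : edge (graph_of (mk m))) :
    exists e : edge E, src e = f (val p).1 /\ rng e = f (val p).2.
  case: p => [[i j] hp] /=; move: (hp); rewrite -[_ \in _]/(has_edge (mk m) (i, j)).
  by rewrite H => /existsP[e /andP[/eqP <- /eqP <-]]; exists e.
pose fe p := projT1 (cid (ex p)).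
have feP p : src (fe p) = f (val p).1 /\ rng (fe p) = f (val p).2.
  exact: (projT2 (cid (ex p))).
have ge (e : edge E) : has_edge (mk m) (g (src e), g (rng e)).
  by rewrite H; apply/existsP; exists e; rewrite !gK !eqxx.
apply: (@graph_iso_LPA K (graph_of (mk m)) E f fe).
- by exists g.
- exists (fun e => Sub (g (src e), g (rng e)) (ge e)) => [p|e].
    apply: val_inj => /=; have [-> ->] := feP p.
    by rewrite !fK -surjective_pairing.
  have [h1 h2] := feP (Sub (g (src e), g (rng e)) (ge e)).
  (* Without parallel edges an edge is determined by its two ends. *)
  by apply: SE; [rewrite h1 /= gK|rewrite h2 /= gK].
- by move=> p; have [-> _] := feP p.
- by move=> p; have [_ ->] := feP p.
Qed.

(** * A representation, and the span of the ghost paths *)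

Section Rep.
Variables (K : fieldType) (E : graph).
Local Notation L := (LPA K E).
Implicit Types (v w : vertex E) (e : edge E) (x y : L).

Definition outs v := [pred e : edge E | src e == v].
Definition outdeg v : nat := #|outs v|.
Definition eidx e : nat := index e (enum (outs (src e))).

Lemma eidx_lt e : (eidx e < outdeg (src e))%N.
Proof. by rewrite /outdeg cardE index_mem mem_enum inE. Qed.

Lemma eidx_inj e e' : src e = src e' -> eidx e = eidx e' -> e = e'.
Proof.
move=> s; rewrite /eidx -s => h.
have m1 : e \in enum (outs (src e)) by rewrite mem_enum inE.
have m2 : e' \in enum (outs (src e)) by rewrite mem_enum inE s.
by rewrite -(nth_index e m1) h nth_index.
Qed.

Lemma eidx_surj v (j : nat) : (j < outdeg v)%N -> exists2 e, src e = v & eidx e = j.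
Proof.
rewrite /outdeg cardE => jl.
have [e0 _] : exists e0 : edge E, true.
  by case: (enum (outs v)) jl => // e0; exists e0.
have : nth e0 (enum (outs v)) j \in enum (outs v) by exact: mem_nth.
rewrite mem_enum inE => /eqP s; exists (nth e0 (enum (outs v)) j) => //.
by rewrite /eidx s index_uniq ?enum_uniq.
Qed.

(* Think of v, n as the point n of the boundary at v: the edge e is a bijection
   from the boundary at rng e onto the residue class of n modulo the
   out-degree of src e that e labels.  The integer coordinate records degrees. *)
Definition fspace := vertex E -> nat -> int -> K.
Implicit Types f g : fspace.

Fixpoint rho (t : term K E) f : fspace :=
  match t with
  | TVertex v => fun w n d => if w == v then f w n d else 0
  | TEdge e => fun w n d => if (w == src e) && (n %% outdeg w == eidx e)%N
      then f (rng e) (n %/ outdeg w)%N (d - 1) else 0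
  | TGhost e => fun w n d => if w == rng e
      then f (src e) (n * outdeg (src e) + eidx e)%N (d + 1) else 0
  | TZero => fun _ _ _ => 0
  | TAdd t u => fun w n d => rho t f w n d + rho u f w n d
  | TOpp t => fun w n d => - rho t f w n d
  | TScale a t => fun w n d => a * rho t f w n d
  | TMul t u => rho t (rho u f)
  end.

Lemma rhoD t f g w n d :
  rho t (fun w n d => f w n d + g w n d) w n d = rho t f w n d + rho t g w n d.
Proof.
elim: t f g w n d => //= [v|e|e||t Ht u Hu|t Ht|a t Ht|t Ht u Hu] f g w n d.
- by case: ifP; rewrite ?addr0.
- by case: ifP; rewrite ?addr0.
- by case: ifP; rewrite ?addr0.
- by rewrite addr0.
- by rewrite Ht Hu addrACA.
- by rewrite Ht opprD.
- by rewrite Ht mulrDr.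
rewrite -Ht; congr (rho t _ w n d).
by apply/funext=> w'; apply/funext=> n'; apply/funext=> d'; rewrite Hu.
Qed.

Lemma rhoZ t a f w n d :
  rho t (fun w n d => a * f w n d) w n d = a * rho t f w n d.
Proof.
elim: t f w n d => //= [v|e|e||t Ht u Hu|t Ht|b t Ht|t Ht u Hu] f w n d.
- by case: ifP; rewrite ?mulr0.
- by case: ifP; rewrite ?mulr0.
- by case: ifP; rewrite ?mulr0.
- by rewrite mulr0.
- by rewrite Ht Hu mulrDr.
- by rewrite Ht mulrN.
- by rewrite Ht mulrCA.
rewrite -Ht; congr (rho t _ w n d).
by apply/funext=> w'; apply/funext=> n'; apply/funext=> d'; rewrite Hu.
Qed.

Lemma rho0 t w n d : rho t (fun _ _ _ => 0) w n d = 0.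
Proof.
rewrite -[RHS](mul0r (rho t (fun _ _ _ => 0) w n d)) -rhoZ.
by congr (rho t _ w n d); apply/funext=> ?; apply/funext=> ?; apply/funext=> ?; rewrite mul0r.
Qed.

Lemma rho_TSum s f w n d : rho (TSum s) f w n d = \sum_(t <- s) rho t f w n d.
Proof. by elim: s => [|t s IH] /=; rewrite ?big_nil // big_cons IH. Qed.

(** For the d edges leaving a vertex the maps n -> n * d + [eidx e] are injective, and their images
    partition the natural numbers: this is CK1 and CK2. *)
Lemma rho_eq t u f : term_eq t u -> rho t f = rho u f.
Proof.
move=> tu; apply/funext=> w; apply/funext=> n; apply/funext=> d.
have mn0 e : (outdeg (src e) > 0)%N by apply: leq_ltn_trans (eidx_lt e).
elim: tu f w n d => /= {t u}.
- by [].
- by move=> x y _ IH f w n d; rewrite IH.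
- by move=> x y z _ h1 _ h2 f w n d; rewrite h1 h2.
- by move=> x x' y y' _ h1 _ h2 f w n d; rewrite h1 h2.
- by move=> x x' _ h f w n d; rewrite h.
- by move=> a x x' _ h f w n d; rewrite h.
- move=> x x' y y' _ h1 _ h2 f w n d; rewrite h1.
  congr (rho x' _ w n d).
  by apply/funext=> w'; apply/funext=> n'; apply/funext=> d'; rewrite h2.
- by move=> *; rewrite addrA.
- by move=> *; rewrite addrC.
- by move=> *; rewrite add0r.
- by move=> *; rewrite addNr.
- by move=> *; rewrite mulrA.
- by move=> *; rewrite mul1r.
- by move=> *; rewrite mulrDr.
- by move=> *; rewrite mulrDl.
- by [].
- by [].
- by move=> *; rewrite rhoD.
- by [].
- by move=> *; rewrite rhoZ.
- by move=> v w f u n d; case: (eqVneq v w) => [->|vw] /=; case: eqVneq => // ->; rewrite (negPf vw).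
- by move=> e f w n d; case: (w =P src e) => //= _; case: ifP.
- by move=> e f w n d; case: ifP => //; rewrite eqxx.
- by move=> e f w n d; case: (w == rng e).
- by move=> e f w n d; case: ifP => //; rewrite eqxx.
- move=> e e' f w n d; case: (eqVneq e e') => [<-|ne] /=; case: ifP => // /eqP we.
    rewrite we eqxx modnMDl modn_small ?eidx_lt // eqxx /=.
    by rewrite divnMDl // divn_small ?eidx_lt // addn0 addrK.
  case: ifP => // /andP[/eqP s]; rewrite s modnMDl modn_small -?s ?eidx_lt //.
  by move=> /eqP /(eidx_inj s) h; rewrite h eqxx in ne.
move=> v [e0 e0v] f w n d; rewrite rho_TSum big_map big_filter big_enum_cond /=.
have dv : (0 < outdeg v)%N by rewrite -e0v.
case: (eqVneq w v) => [->|wv]; last first.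
  by rewrite big1 // => e /eqP ->; rewrite (negPf wv).
have [e se ie] : exists2 e, src e = v & eidx e = (n %% outdeg v)%N.
  by apply: eidx_surj; rewrite ltn_mod.
rewrite (bigD1 e) ?se //= eqxx -ie eqxx big1 ?addr0 => [|e' /andP[/eqP se' ne]].
  by rewrite eqxx ie -divn_eq subrK.
rewrite se' eqxx /=; case: eqP => // h; case/eqP: ne.
by apply: eidx_inj; rewrite ?se ?se' //.
Qed.

Definition act x f : fspace := rho (repr x) f.

Lemma act_pi t f : act (\pi_L t) f = rho t f.
Proof. exact/rho_eq/LPA_reprP. Qed.

Lemma act_vert v f w n d : act (vert K v) f w n d = if w == v then f w n d else 0.
Proof. by rewrite act_pi. Qed.
Lemma act_edg e f w n d : act (edg K e) f w n d =
  if (w == src e) && (n %% outdeg w == eidx e)%N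
  then f (rng e) (n %/ outdeg w)%N (d - 1) else 0.
Proof. by rewrite act_pi. Qed.
Lemma act_ghost e f w n d : act (ghost K e) f w n d =
  if w == rng e then f (src e) (n * outdeg (src e) + eidx e)%N (d + 1) else 0.
Proof. by rewrite act_pi. Qed.
Lemma act0 f w n d : act 0 f w n d = 0.
Proof. by rewrite [0](_ : _ = \pi_L (TZero K E)) // act_pi. Qed.
Lemma actD x y f w n d : act (x + y) f w n d = act x f w n d + act y f w n d.
Proof.
elim/quotW: x => t; elim/quotW: y => u.
by rewrite [X in act X](pi_LPA_add t u) !act_pi.
Qed.
Lemma actZ a x f w n d : act (a *: x) f w n d = a * act x f w n d.
Proof. by elim/quotW: x => t; rewrite [X in act X](pi_LPA_scale a t) !act_pi. Qed.
Lemma actM x y f : act (x * y) f = act x (act y f).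
Proof.
elim/quotW: x => t; elim/quotW: y => u.
by rewrite [X in act X](pi_LPA_mul t u) !act_pi.
Qed.
Lemma act_sum (I : Type) (r : seq I) (P : pred I) (F : I -> L) f w n d :
  act (\sum_(i <- r | P i) F i) f w n d = \sum_(i <- r | P i) act (F i) f w n d.
Proof.
by apply: (big_morph (fun x => act x f w n d)) => [x y|]; rewrite ?actD ?act0.
Qed.

Lemma vert_neq0 v : vert K v != 0.
Proof.
apply/eqP => /(congr1 (fun x => act x (fun _ _ _ => 1) v 0%N 0)).
by rewrite act_vert eqxx act0 => /eqP; rewrite oner_eq0.
Qed.

(* gp v q is the ghost path q^* of the path q starting at v. *)
Fixpoint gp v (q : seq (edge E)) : L :=
  if q is e :: q' then gp (rng e) q' * ghost K e else vert K v.

(** A mixed radix number whose lowest digit is the first edge of q and whose part beyond the digits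
    of q is n. Distinct paths of one length from v thus differ already at n = 0. *)
Fixpoint sidx (q : seq (edge E)) (n : nat) : nat :=
  if q is e :: q' then (sidx q' n * outdeg (src e) + eidx e)%N else n.

Lemma act_gp v q f w n d : is_path v q -> act (gp v q) f w n d =
  if w == path_end v q then f v (sidx q n) (d + (size q)%:Z) else 0.
Proof.
elim: q v f d => [|e q IH] v f d /=.
  by move=> _; rewrite act_vert (addr0 d) /path_end /=; case: eqP => [->|].
case/andP => /eqP s pq; rewrite actM IH // act_ghost eqxx s.
by rewrite -addrA -PoszD addn1.
Qed.

Lemma sidx_inj v q q' : is_path v q -> is_path v q' -> size q = size q' ->
  sidx q 0 = sidx q' 0 -> q = q'.
Proof.
elim: q q' v => [|e q IH] [|e' q'] v //= /andP[/eqP s pq] /andP[/eqP s' pq'] [sq].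
rewrite s s' => h.
have ee : eidx e = eidx e'.
  have := congr1 (modn^~ (outdeg v)) h.
  by rewrite !modnMDl !modn_small // -?s -?s' ?eidx_lt // s -s' eidx_lt.
have ee' : e = e' by apply: eidx_inj; rewrite // s s'.
rewrite -ee' in pq' h *; congr (_ :: _); apply: (IH _ (rng e)) => //.
move/addIn: h => /eqP; rewrite eqn_mul2r => /orP[|/eqP //].
by rewrite -s => /eqP h0; have := eidx_lt e; rewrite h0.
Qed.

Definition delta v m (k : nat) : fspace :=
  fun w n d => ((w == v) && (n == m) && (d == k%:Z))%:R.

(** On B this is the coefficient of the ghost path of q: the point mass sits where that ghost path
    reads the value at 0. Its place in the first two coordinates tells apart paths of equal length,
    its degree tells apart lengths. *)
Definition coef v q x : K := act x (delta v (sidx q 0) (size q)) (path_end v q) 0%N 0.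

Lemma coef_gp v q v' q' : is_path v q -> is_path v' q' ->
  coef v q (gp v' q') = ((v == v') && (q == q'))%:R.
Proof.
move=> p p'; rewrite /coef act_gp // /delta add0r.
case: (eqVneq v v') => [e|_]; last by case: ifP.
rewrite -e /= in p' *.
case: (eqVneq q q') => [<-|qq']; first by rewrite !eqxx.
case: ifP => // _; case: eqP => //= h1; case: eqP => //= -[h2].
by case/eqP: qq'; apply: sidx_inj p p' _ _.
Qed.

Lemma coef0 v q : coef v q 0 = 0. Proof. exact: act0. Qed.
Lemma coefD v q x y : coef v q (x + y) = coef v q x + coef v q y.
Proof. exact: actD. Qed.
Lemma coefZ v q a x : coef v q (a *: x) = a * coef v q x.
Proof. exact: actZ. Qed.
Lemma coef_sum (I : Type) (r : seq I) (P : pred I) (F : I -> L) v q :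
  coef v q (\sum_(i <- r | P i) F i) = \sum_(i <- r | P i) coef v q (F i).
Proof. exact: act_sum. Qed.

Definition inB x : Prop := exists2 s : seq (K * (vertex E * seq (edge E))),
  all (fun i => is_path i.2.1 i.2.2) s & x = \sum_(i <- s) i.1 *: gp i.2.1 i.2.2.

Lemma B_ind (P : L -> Prop) : P 0 ->
  (forall a v q y, is_path v q -> inB y -> P y -> P (a *: gp v q + y)) ->
  forall x, inB x -> P x.
Proof.
move=> P0 PD x [s sp ->]; elim: s sp => [|[a [v q]] s IH] /=.
  by rewrite big_nil.
case/andP=> pq ps; rewrite big_cons; apply: PD => //; last exact: IH.
by exists s.
Qed.

Lemma inB0 : inB 0. Proof. by exists [::]; rewrite ?big_nil. Qed.
Lemma inB_gp v q : is_path v q -> inB (gp v q).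
Proof.
move=> p; exists [:: (1, (v, q))]; rewrite /= ?p //.
by rewrite big_seq1 scale1r.
Qed.
Lemma inBD x y : inB x -> inB y -> inB (x + y).
Proof.
move=> [s ps ->] [s' ps' ->]; exists (s ++ s'); first by rewrite all_cat ps.
by rewrite big_cat.
Qed.
Lemma inBZ a x : inB x -> inB (a *: x).
Proof.
move=> [s ps ->]; exists [seq (a * i.1, i.2) | i <- s].
  by rewrite all_map.
by rewrite big_map scaler_sumr; apply: eq_bigr => i _; rewrite scalerA.
Qed.
Lemma inB_sum (I : Type) (r : seq I) (P : pred I) (F : I -> L) :
  (forall i, P i -> inB (F i)) -> inB (\sum_(i <- r | P i) F i).
Proof. by move=> H; elim/big_ind: _ => //; [exact: inB0|exact: inBD]. Qed.
Lemma inB_vert v : inB (vert K v).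
Proof. exact: (@inB_gp v [::]). Qed.

Lemma gp_vert v q : is_path v q -> gp v q * vert K v = gp v q.
Proof.
case: q => [|e q] /=; first by rewrite vertM_id.
by case/andP=> /eqP <- _; rewrite -mulrA ghost_vert.
Qed.
Lemma vert_gp v q : vert K (path_end v q) * gp v q = gp v q.
Proof.
elim: q v => [|e q IH] v /=; first by rewrite vertM_id.
by rewrite mulrA; congr (_ * _); rewrite -[in RHS]IH.
Qed.
Lemma vertM_gp w v q : vert K w * gp v q = if w == path_end v q then gp v q else 0.
Proof.
by rewrite -[in LHS]vert_gp mulrA vertM; case: eqP => [->|_]; rewrite ?vert_gp ?mul0r.
Qed.

Lemma is_path_cat v q q' :
  is_path v (q ++ q') = is_path v q && is_path (path_end v q) q'.
Proof. by elim: q v => [|e q IH] v //=; rewrite IH andbA. Qed.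
Lemma gp_cat v q q' : is_path v (q ++ q') ->
  gp v (q ++ q') = gp (path_end v q) q' * gp v q.
Proof.
elim: q v => [|e q IH] v /=; first by move=> p; rewrite gp_vert.
by case/andP=> _ p; rewrite IH // mulrA.
Qed.

Lemma gp_rcons v q e : is_path v (rcons q e) ->
  gp v (rcons q e) = ghost K e * gp v q.
Proof.
rewrite -cats1 => p; rewrite gp_cat //=.
by rewrite vert_ghost.
Qed.

Lemma is_path_rcons v q e :
  is_path v (rcons q e) = is_path v q && (src e == path_end v q).
Proof. by rewrite -cats1 is_path_cat /= andbT. Qed.

Lemma path_end_rcons v q e : path_end v (rcons q e) = rng e.
Proof. by rewrite /path_end map_rcons last_rcons. Qed.

Lemma ghost_gp e v q : is_path v q -> ghost K e * gp v q =
  if src e == path_end v q then gp v (rcons q e) else 0.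
Proof.
move=> p; case: ifP => [s|s]; first by rewrite gp_rcons // is_path_rcons p.
by rewrite -vert_gp mulrA ghost_vert_neq ?s // mul0r.
Qed.

Lemma gpM v q v' q' : is_path v q -> is_path v' q' -> gp v q * gp v' q' =
  if path_end v' q' == v then gp v' (q' ++ q) else 0.
Proof.
move=> p p'; case: eqP => [e|e]; first by rewrite gp_cat ?e // is_path_cat p' e.
rewrite -[gp v q]gp_vert // -mulrA vertM_gp; case: eqP => [h|_]; last by rewrite mulr0.
by rewrite h in e.
Qed.

Lemma inB_ghost e x : inB x -> inB (ghost K e * x).
Proof.
elim/B_ind=> [|a v q y p By IH]; first by rewrite mulr0; exact: inB0.
rewrite mulrDr -scaleLr ghost_gp //; apply: inBD => //; apply: inBZ.
by case: ifP => s; [apply: inB_gp; rewrite is_path_rcons p|exact: inB0].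
Qed.

Lemma inBM x y : inB x -> inB y -> inB (x * y).
Proof.
move=> Bx By; elim/B_ind: Bx => [|a v q z p Bz IH].
  by rewrite mul0r; exact: inB0.
rewrite mulrDl -scaleLl; apply: inBD => //; apply: inBZ.
elim/B_ind: By => [|b v' q' t p' Bt IHt]; first by rewrite mulr0; exact: inB0.
rewrite mulrDr -scaleLr gpM //; apply: inBD => //; apply: inBZ.
by case: ifP => [/eqP e|_]; [apply: inB_gp; rewrite is_path_cat p' e|exact: inB0].
Qed.

(** The component spanned by ghost paths of length n. Being built from [coef] it is linear on all of
    L, but it is a component of x only for x in B. *)
Definition hom (n : nat) x : L :=
  \sum_(p : vertex E * n.-tuple (edge E) | is_path p.1 p.2)
     coef p.1 p.2 x *: gp p.1 p.2.

Lemma hom0 n : hom n 0 = 0.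
Proof. by rewrite /hom big1 // => p _; rewrite coef0 scale0r. Qed.
Lemma homD n x y : hom n (x + y) = hom n x + hom n y.
Proof. by rewrite /hom -big_split; apply: eq_bigr => p _; rewrite coefD scalerDl. Qed.
Lemma homZ n a x : hom n (a *: x) = a *: hom n x.
Proof. by rewrite /hom scaler_sumr; apply: eq_bigr => p _; rewrite coefZ scalerA. Qed.
Lemma hom_sum n (I : Type) (r : seq I) (P : pred I) (F : I -> L) :
  hom n (\sum_(i <- r | P i) F i) = \sum_(i <- r | P i) hom n (F i).
Proof. exact: (big_morph (hom n) (homD n) (hom0 n)). Qed.
Lemma inB_hom n x : inB (hom n x).
Proof. by apply: inB_sum => p pp; apply/inBZ/inB_gp. Qed.

Lemma hom_gp n v q : is_path v q -> hom n (gp v q) = if size q == n then gp v q else 0.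
Proof.
move=> p; case: eqP => [sq|sq].
  rewrite /hom (bigD1 (v, tcast sq (in_tuple q))) /=; last by rewrite val_tcast.
  rewrite val_tcast coef_gp // !eqxx scale1r big1 ?addr0 // => -[v' q'] /=.
  case/andP=> p' ne; rewrite coef_gp //; case: eqP => [e1|]; last by rewrite scale0r.
  case: eqP => [e2|]; last by rewrite scale0r.
  case/eqP: ne; congr pair => //; apply: val_inj => /=; by rewrite val_tcast.
rewrite /hom big1 // => -[v' q'] /= p'; rewrite coef_gp //.
case: (_ =P q) => [e2|]; last by rewrite andbF scale0r.
by case: sq; rewrite -e2 size_tuple.
Qed.

Lemma hom_hom n m x : hom n (hom m x) = if n == m then hom m x else 0.
Proof.
rewrite [X in hom n X]/hom hom_sum; case: eqP => [->|nm].
  apply: eq_bigr => p pp; by rewrite homZ hom_gp // size_tuple eqxx.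
rewrite big1 // => p pp; rewrite homZ hom_gp // size_tuple; case: eqP => [e|]; last by rewrite scaler0.
by case: nm.
Qed.

Lemma inB_hom_bound x : inB x -> exists N, forall n, (N <= n)%N -> hom n x = 0.
Proof.
elim/B_ind=> [|a v q y p By [N HN]]; first by exists 0%N => n _; rewrite hom0.
exists (maxn N (size q).+1) => n; rewrite geq_max => /andP[h1 h2].
by rewrite homD homZ hom_gp // HN // ltn_eqF // scaler0 addr0.
Qed.

Lemma inB_sum_hom x N : inB x -> (forall n, (N <= n)%N -> hom n x = 0) ->
  x = \sum_(n < N) hom n x.
Proof.
move=> Bx HN.
suff [M HM] : exists M, forall m, (M <= m)%N -> x = \sum_(n < m) hom n x.
  rewrite {1}(HM (maxn M N) (leq_maxl _ _)).
  rewrite -!(big_mkord xpredT (fun n => hom n x)) (big_cat_nat (leq0n N) (leq_maxr M N)) /=.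
  by rewrite [X in _ + X]big_nat [X in _ + X]big1 ?addr0 // => i /andP[h _]; rewrite HN.
elim/B_ind: Bx {HN} => [|a v q y p By [M HM]].
  by exists 0%N => m _; rewrite big1 // => i _; rewrite hom0.
exists (maxn M (size q).+1) => m; rewrite geq_max => /andP[h1 h2].
under eq_bigr do rewrite homD homZ hom_gp //.
rewrite big_split /= -HM //; congr (_ + _).
rewrite (bigD1 (Ordinal h2)) //= eqxx big1 ?addr0 // => i; rewrite -(inj_eq val_inj) eq_sym /=.
by move=> /negPf ->; rewrite scaler0.
Qed.

Lemma inB_hom_eq0 x : inB x -> (forall n, hom n x = 0) -> x = 0.
Proof.
by move=> Bx H; rewrite (@inB_sum_hom x 0) ?big_ord0 // => n _.
Qed.

Lemma inB_coef_eq0 x : inB x -> (forall v q, is_path v q -> coef v q x = 0) -> x = 0.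
Proof.
move=> Bx H; apply: inB_hom_eq0 => // n; rewrite /hom big1 // => p pp.
by rewrite H // scale0r.
Qed.

Lemma homM n x y : inB x -> inB y ->
  hom n (x * y) = \sum_(i < n.+1) hom (n - i) x * hom i y.
Proof.
move=> Bx By; elim/B_ind: Bx => [|a v q z p Bz IH].
  by rewrite mul0r hom0 big1 // => i _; rewrite hom0 mul0r.
rewrite mulrDl homD IH -scaleLl homZ.
under [RHS]eq_bigr do rewrite homD mulrDl homZ -scaleLl.
rewrite [RHS]big_split /= -scaler_sumr; congr (_ *: _ + _).
elim/B_ind: By {IH} => [|b v' q' t p' Bt IHt].
  by rewrite mulr0 hom0 big1 // => i _; rewrite hom0 mulr0.
rewrite mulrDr homD IHt -scaleLr homZ.
under [RHS]eq_bigr do rewrite homD mulrDr homZ -scaleLr.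
rewrite [RHS]big_split /= -scaler_sumr; congr (_ *: _ + _) => {IHt}.
rewrite gpM //; under [RHS]eq_bigr do rewrite !hom_gp //.
have -> : hom n (if path_end v' q' == v then gp v' (q' ++ q) else 0) =
    if (size q' + size q == n)%N then gp v q * gp v' q' else 0.
  rewrite gpM //; case: eqP => [e|_]; last by rewrite hom0; case: ifP.
  by rewrite hom_gp ?size_cat // is_path_cat p' e.
case: eqP => [nn|nn].
  have h : (size q' < n.+1)%N by rewrite ltnS -nn leq_addr.
  rewrite (bigD1 (Ordinal h)) //= eqxx -{1}nn addKn eqxx big1 ?addr0 // => i.
  by rewrite -(inj_eq val_inj) eq_sym /= => /negPf ->; rewrite mulr0.
rewrite big1 // => i _; case: eqP => [e1|]; last by rewrite mul0r.
case: eqP => [e2|]; last by rewrite mulr0.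
by case: nn; rewrite e1 e2 subnKC // -ltnS.
Qed.

Definition homog d x : Prop := hom d x = x.

Lemma homog_inB d x : homog d x -> inB x.
Proof. by move<-; exact: inB_hom. Qed.
Lemma homog_hom d x : homog d (hom d x).
Proof. by rewrite /homog hom_hom eqxx. Qed.
Lemma homog0 d : homog d 0. Proof. exact: hom0. Qed.
Lemma homogD d x y : homog d x -> homog d y -> homog d (x + y).
Proof. by rewrite /homog homD => -> ->. Qed.
Lemma homogZ d a x : homog d x -> homog d (a *: x).
Proof. by rewrite /homog homZ => ->. Qed.
Lemma homog_neq d n x : homog d x -> n != d -> hom n x = 0.
Proof. by move=> <- /negPf h; rewrite hom_hom h. Qed.
Lemma homog_gp v q : is_path v q -> homog (size q) (gp v q).
Proof. by move=> p; rewrite /homog hom_gp // eqxx. Qed.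
Lemma homog_sum d (I : Type) (r : seq I) (P : pred I) (F : I -> L) :
  (forall i, P i -> homog d (F i)) -> homog d (\sum_(i <- r | P i) F i).
Proof. by move=> H; elim/big_ind: _ => //; [exact: homog0|exact: homogD]. Qed.

Lemma homM_homog n d x y : inB x -> homog d y ->
  hom n (x * y) = if (d <= n)%N then hom (n - d) x * y else 0.
Proof.
move=> Bx hy; rewrite homM //; last exact: homog_inB hy.
case: leqP => h.
  rewrite (bigD1 (Ordinal (h : (d < n.+1)%N))) //= hy big1 ?addr0 // => i.
  by rewrite -(inj_eq val_inj) /= => /(homog_neq hy) ->; rewrite mulr0.
rewrite big1 // => i _; rewrite (homog_neq hy) ?mulr0 //.
by rewrite ltn_eqF // (leq_ltn_trans _ h) // -ltnS.
Qed.

Lemma homogM n d x y : homog n x -> homog d y -> homog (n + d) (x * y).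
Proof.
move=> hx hy; rewrite /homog (homM_homog _ _ hy) ?leq_addl ?addnK ?hx //.
exact: homog_inB hx.
Qed.

Lemma homog_vert v : homog 0 (vert K v).
Proof. exact: (@homog_gp v [::]). Qed.
Lemma homog_vertl v d x : homog d x -> homog d (vert K v * x).
Proof. by move=> h; rewrite -[d]add0n; apply: homogM => //; exact: homog_vert. Qed.
Lemma homog_vertr v d x : homog d x -> homog d (x * vert K v).
Proof. by move=> h; rewrite -[d]addn0; apply: homogM => //; exact: homog_vert. Qed.
Lemma homog_ghost e : homog 1 (ghost K e).
Proof.
have -> : ghost K e = gp (src e) [:: e] by rewrite /= vert_ghost.
by apply: (@homog_gp _ [:: e]); rewrite /= eqxx.
Qed.
Lemma hom_vertl w n x : inB x -> hom n (vert K w * x) = vert K w * hom n x.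
Proof.
elim/B_ind=> [|a v q y p By IH]; first by rewrite mulr0 !hom0 mulr0.
rewrite mulrDr !homD mulrDr IH -scaleLr !homZ -scaleLr; congr (_ *: _ + _).
rewrite vertM_gp hom_gp // (fun_if (hom n)) hom_gp // hom0.
by case: (size q == n); [rewrite vertM_gp|rewrite mulr0; case: ifP].
Qed.

Lemma homog0_vert b w : homog 0 b -> exists a : K, b * vert K w = a *: vert K w.
Proof.
move=> <-; rewrite /hom mulr_suml.
apply: (big_ind (fun x => exists a : K, x = a *: vert K w)).
- by exists 0; rewrite scale0r.
- by move=> _ _ [a ->] [b' ->]; exists (a + b'); rewrite scalerDl.
case=> v q /= _; rewrite (tuple0 q) /= -scaleLl vertM; case: eqP => [->|_]; first by eexists.
by exists 0; rewrite scaler0 scale0r.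
Qed.

(** The ghost of the last edge of a path is the leftmost factor of the ghost path, so it can be
    split off; [ghost_indep] says that the cofactors are unique. *)
Lemma homogS_ghost n b : homog n.+1 b -> exists d : edge E -> L,
  [/\ b = \sum_e ghost K e * d e, forall e, homog n (d e) &
      forall e, vert K (src e) * d e = d e].
Proof.
move=> <-; rewrite /hom.
apply: (big_ind (fun b => exists d : edge E -> L,
  [/\ b = \sum_e ghost K e * d e, forall e, homog n (d e) &
      forall e, vert K (src e) * d e = d e])).
- exists (fun=> 0); split=> [|e|e]; rewrite ?mulr0 ?big1 //.
  + by move=> e _; rewrite mulr0.
  + exact: homog0.
- move=> _ _ [d [-> h1 h2]] [d' [-> h1' h2']]; exists (fun e => d e + d' e).
  split=> [|e|e].
  + by rewrite -big_split; apply: eq_bigr => e _; rewrite mulrDr.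
  + exact: homogD.
  + by rewrite mulrDr h2 h2'.
case=> v [q sq] /= p; case/lastP: q sq p => // q e; rewrite size_rcons => /eqP[sq].
rewrite is_path_rcons => /andP[p /eqP s].
set a := coef _ _ _.
exists (fun f : edge E => if f == e then a *: gp v q else 0); split=> [|f|f].
- rewrite (bigD1 e) //= eqxx big1 ?addr0 => [|f /negPf ->]; last by rewrite mulr0.
  by rewrite gp_rcons ?scaleLr // is_path_rcons p s eqxx.
- case: ifP => _; last exact: homog0.
  by apply: homogZ; rewrite -sq; apply: homog_gp.
- case: eqP => [->|_]; last by rewrite mulr0.
  by rewrite -scaleLr s vert_gp.
Qed.

Lemma coef_ghost v q e (f : edge E) y : is_path v (rcons q e) -> inB y ->
  coef v (rcons q e) (ghost K f * y) = if f == e then coef v q y else 0.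
Proof.
move=> p; elim/B_ind=> [|a v' q' z p' Bz IH].
  by rewrite mulr0 !coef0; case: ifP.
rewrite mulrDr coefD IH -scaleLr coefZ coefD coefZ ghost_gp //.
have pq : is_path v q by move: p; rewrite is_path_rcons => /andP[].
rewrite (coef_gp pq p') (fun_if (coef v (rcons q e))) coef0.
have -> : (if src f == path_end v' q' then coef v (rcons q e) (gp v' (rcons q' f)) else 0)
  = if f == e then ((v == v') && (q == q'))%:R else 0 :> K; last first.
  by case: ifP; rewrite ?mulr0 ?add0r ?addr0.
case: (eqVneq (src f) (path_end v' q')) => [s|s].
  rewrite coef_gp //; last by rewrite is_path_rcons p' s eqxx.
  rewrite eqseq_rcons [e == f]eq_sym.
  by case: (f == e); rewrite ?andbT ?andbF.
case: eqP => // fe; case: eqP => //= vv; case: eqP => //= qq.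
by move: p s; rewrite -vv -qq fe is_path_rcons => /andP[_ ->].
Qed.

(** The freeness of B: left multiplication by different ghost edges prolongs paths by different last
    edges, so the coefficients of the summands do not interfere. *)
Lemma ghost_indep (y : edge E -> L) : (forall e, inB (y e)) ->
  (forall e, vert K (src e) * y e = y e) -> \sum_e ghost K e * y e = 0 ->
  forall e, y e = 0.
Proof.
move=> By vy sy e; apply: inB_coef_eq0 => // v q p.
case: (eqVneq (src e) (path_end v q)) => [s|s].
  have p' : is_path v (rcons q e) by rewrite is_path_rcons p s eqxx.
  have := congr1 (coef v (rcons q e)) sy; rewrite coef0 coef_sum (bigD1 e) //=.
  rewrite coef_ghost // eqxx big1 ?addr0 // => f /negPf fe.
  by rewrite coef_ghost // fe.
rewrite -vy; elim/B_ind: (By e) => [|a v' q' z p' Bz IH].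
  by rewrite mulr0 coef0.
rewrite mulrDr coefD IH addr0 -scaleLr coefZ vertM_gp.
case: eqP => [h|_]; last by rewrite coef0 mulr0.
rewrite coef_gp //; case: eqP => [e1|]; last by rewrite mulr0.
case: eqP => [e2|]; last by rewrite mulr0.
by move: s; rewrite h e1 e2 eqxx.
Qed.

End Rep.

(** * Bases of finitely generated submodules *)

Lemma finType_bound (I : finType) (P : I -> nat -> Prop) :
  (forall i n m, (n <= m)%N -> P i n -> P i m) ->
  (forall i, exists n, P i n) -> exists n, forall i, P i n.
Proof.
move=> Pm /choice[f fP]; exists (\max_i f i) => i.
by apply: Pm (fP i); apply: leq_bigmax.
Qed.

Section Depth.
Variables (K : fieldType) (E : graph).
Local Notation L := (LPA K E).
Implicit Types (v w : vertex E) (e : edge E) (x y z : L).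

(* Dep n x : the products q^* x lie in B for all paths q that have length n, or
   are shorter and end at a sink. *)
Fixpoint Dep (n : nat) x : Prop :=
  if n is n'.+1 then (forall e, Dep n' (ghost K e * x)) /\
    (forall v, sink v -> inB (vert K v * x))
  else inB x.

Lemma DepS n x : Dep n x -> Dep n.+1 x.
Proof.
elim: n x => [|n IH] x.
  by move=> /= Bx; split=> [e|v _]; [exact: inB_ghost|apply: inBM => //; exact: inB_vert].
move=> [h1 h2]; split; last exact: h2.
move=> e; apply: IH; exact: h1.
Qed.

Lemma Dep_le n m x : (n <= m)%N -> Dep n x -> Dep m x.
Proof.
elim: m => [|m IH]; first by rewrite leqn0 => /eqP ->.
rewrite leq_eqVlt => /orP[/eqP -> //|/IH h /h]; exact: DepS.
Qed.

Lemma Dep_inB n x : inB x -> Dep n x.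
Proof. exact: (@Dep_le 0). Qed.

Lemma Dep_ghost n e x : Dep n x -> Dep n (ghost K e * x).
Proof. by case: n => [|n]; [exact: inB_ghost|case=> h _; apply: DepS; exact: h]. Qed.

Lemma Dep_sink n v x : Dep n x -> sink v -> inB (vert K v * x).
Proof.
case: n => [/= Bx _|n [_ h]]; last exact: h.
by apply: inBM => //; exact: inB_vert.
Qed.

Lemma DepD n x y : Dep n x -> Dep n y -> Dep n (x + y).
Proof.
elim: n x y => [|n IH] x y; first exact: inBD.
case=> h1 h2 [h3 h4]; split=> [e|v sv]; rewrite mulrDr.
  by apply: IH; [exact: h1|exact: h3].
by apply: inBD; [exact: h2|exact: h4].
Qed.

Lemma DepZ n (a : K) x : Dep n x -> Dep n (a *: x).
Proof.
elim: n x => [|n IH] x; first exact: inBZ.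
case=> h1 h2; split=> [e|v sv]; rewrite -scaleLr.
  by apply: IH; exact: h1.
by apply: inBZ; exact: h2.
Qed.

Lemma Dep_vert n v x : Dep n x -> Dep n (vert K v * x).
Proof.
case: n => [|n]; first by move=> Bx; apply: inBM => //; exact: inB_vert.
case=> h1 h2; split=> [e|w sw]; rewrite mulrA.
  case: (eqVneq (src e) v) => [<-|ev]; first by rewrite ghost_vert; exact: h1.
  by rewrite ghost_vert_neq // mul0r; apply/Dep_inB/inB0.
rewrite vertM; case: eqP => _; first exact: h2.
by rewrite mul0r; exact: inB0.
Qed.

Lemma Dep_gp n v q x : Dep n x -> Dep n (gp K v q * x).
Proof.
elim: q v x => [|e q IH] v x /=; first exact: Dep_vert.
by move=> h; rewrite -mulrA; apply/IH/Dep_ghost.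
Qed.

Lemma Dep_mulB n b x : inB b -> Dep n x -> Dep n (b * x).
Proof.
move=> Bb h; elim/B_ind: Bb => [|a v q y p By IH].
  by rewrite mul0r; apply/Dep_inB/inB0.
by rewrite mulrDl -scaleLl; apply: DepD => //; apply/DepZ/Dep_gp.
Qed.

(** After n ghost edges x has become an element of B, and left multiplication by B does not increase
    the depth of y. *)
Lemma DepM n m x y : Dep n x -> Dep m y -> Dep (n + m) (x * y).
Proof.
elim: n x => [|n IH] x; first exact: Dep_mulB.
case=> h1 h2 hy; split=> [e|v sv]; first by rewrite mulrA; apply: IH => //; exact: h1.
have -> : vert K v * (x * y) = vert K v * ((vert K v * x) * y).
  by rewrite !mulrA vertM_id.
by apply: (@Dep_sink m) => //; apply: Dep_mulB => //; exact: h2.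
Qed.

Lemma Dep_ex x : exists n, Dep n x.
Proof.
elim/LPA_ind: x => [v|e|e||x y [n hn] [m hm]|x [n hn]|a x [n hn]|x y [n hn] [m hm]].
- by exists 0%N; exact: inB_vert.
(* An edge e has depth 1: each f^* e is a vertex or 0, and a sink kills e. *)
- exists 1%N; split=> [f|v /forallP/(_ e) sv] /=.
    by rewrite ghost_edg; case: ifP => _; [exact: inB_vert|exact: inB0].
  by rewrite vert_edg_neq; [exact: inB0|rewrite eq_sym].
- by exists 0%N; rewrite -vert_ghost -[ghost K e]mul1r; rewrite mul1r vert_ghost; exact: homog_inB (homog_ghost K e).
- by exists 0%N; exact: inB0.
- by exists (maxn n m); apply: DepD; [apply: Dep_le hn; exact: leq_maxl|apply: Dep_le hm; exact: leq_maxr].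
- by exists n; rewrite -scaleN1r; apply: DepZ.
- by exists n; apply: DepZ.
- by exists (n + m)%N; apply: DepM.
Qed.

Lemma Dep_path n x v q : Dep n x -> is_path v q ->
  (n <= size q)%N || sink (path_end v q) -> inB (gp K v q * x).
Proof.
elim: q v n x => [|e q IH] v n x hx /=.
  move=> _ /orP[|sv]; last exact: Dep_sink hx sv.
  rewrite leqn0 => /eqP n0; rewrite n0 in hx.
  exact: (@Dep_vert 0 v x hx).
case/andP=> _ pq h; rewrite -mulrA.
case: n hx h => [|n] hx h.
  by apply: (IH _ 0%N) => //=; exact: inB_ghost.
case: hx => h1 _; apply: (IH _ n) => //; exact: h1.
Qed.

Lemma Dep_fin (I : finType) (x : I -> L) : exists n, forall i, Dep n (x i).
Proof.
apply: (@finType_bound I (fun i n => Dep n (x i))) => [i n m h|i]; first exact: Dep_le.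
exact: Dep_ex.
Qed.

Lemma eq0_CK2 x : (forall e, ghost K e * x = 0) ->
  (forall v, sink v -> vert K v * x = 0) -> x = 0.
Proof.
move=> h1 h2; rewrite [LHS](LPA1_CK2 x) !big1 ?addr0 // => e _.
by rewrite h1 mulr0.
Qed.
End Depth.

Section Family.
Variables (K : fieldType) (E : graph) (I J : finType).
Local Notation L := (LPA K E).
Variables (w : I -> vertex E) (x : I -> J -> L) (d : I -> nat).

(** The rows generate a left submodule of L^J. The number d a only bounds the degree of row a, so
    [lead a] may be zero; then b = 0 is a [reduction] of that row, which lowers the bound. *)
Definition family : Prop :=
  [/\ forall a i, inB (x a i), forall a i, vert K (w a) * x a i = x a i &
      forall a i n, (d a < n)%N -> hom n (x a i) = 0].

Definition lead a i : L := hom (d a) (x a i).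

(* The leading term of x a0 is a combination, with coefficients in B, of the
   leading terms of the other rows. *)
Definition reduction (a0 : I) (b : I -> L) : Prop :=
  [/\ forall a, homog (d a0 - d a) (b a), forall a, (d a0 < d a)%N -> b a = 0,
      forall a, vert K (w a0) * b a = b a /\ b a * vert K (w a) = b a,
      b a0 = 0 & forall i, lead a0 i + \sum_a b a * lead a i = 0].

Hypothesis F : family.
Hypothesis irr : forall a0 b, ~ reduction a0 b.

Lemma lead_vert a i : vert K (w a) * lead a i = lead a i.
Proof. by case: F => F1 F2 F3; rewrite /lead -hom_vertl // F2. Qed.

Lemma homog_lead a i : homog (d a) (lead a i).
Proof. exact: homog_hom. Qed.

(** For d a = D the coefficient has degree 0, hence is k times the vertex of row a. If k were
    nonzero, dividing the relation by k would yield a reduction of row a. *)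
Lemma lead_top D (b : I -> L) a :
  (forall a, (d a <= D)%N -> homog (D - d a) (b a)) ->
  (forall a, (D < d a)%N -> b a = 0) ->
  (forall a, b a * vert K (w a) = b a) ->
  (forall i, \sum_a b a * lead a i = 0) -> d a = D -> b a = 0.
Proof.
move=> h1 h2 h3 h4 da; apply: contrapT => ba0.
have ha : homog 0 (b a) by have := h1 a; rewrite da subnn; apply.
have [k kE] := homog0_vert (w a) ha; rewrite h3 in kE.
have k0 : k != 0 by apply/eqP => k0; apply: ba0; rewrite kE k0 scale0r.
apply: (@irr a (fun c => if c == a then 0 else k^-1 *: (vert K (w a) * b c))).
split=> [c|c|c||i]; rewrite ?eqxx //.
- case: ifP => _; first exact: homog0.
  apply/homogZ/homog_vertl; rewrite da.
  by case: (leqP (d c) D) => [/h1 //|/h2 ->]; exact: homog0.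
- by rewrite da => /h2 ->; rewrite mulr0 scaler0 if_same.
- case: ifP => _; first by rewrite mulr0 mul0r.
  by rewrite -scaleLr mulrA vertM_id -scaleLl -mulrA h3.
rewrite (bigD1 a) //= eqxx mul0r add0r.
have := congr1 (fun z => k^-1 *: (vert K (w a) * z)) (h4 i).
rewrite mulr0 scaler0 (bigD1 a) //= mulrDr scalerDr {1}kE -scaleLl -scaleLr.
rewrite scalerA mulVf // scale1r lead_vert lead_vert => hh; rewrite -[RHS]hh.
congr (_ + _); rewrite mulr_sumr scaler_sumr;  apply: eq_bigr => c /negPf ->.
by rewrite -scaleLl mulrA.
Qed.

(** Induction on D. The coefficients of degree 0 vanish by [lead_top]; the others are sums of e^*
    d_e, and [ghost_indep] splits the relation into one of total degree D - 1 for each e. *)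
Lemma lead_indep D (b : I -> L) :
  (forall a, (d a <= D)%N -> homog (D - d a) (b a)) ->
  (forall a, (D < d a)%N -> b a = 0) ->
  (forall a, b a * vert K (w a) = b a) ->
  (forall i, \sum_a b a * lead a i = 0) -> forall a, b a = 0.
Proof.
elim: D b => [|D IH] b h1 h2 h3 h4.
  by move=> a; case: (posnP (d a)) => [/(lead_top h1 h2 h3 h4)|/h2].
have top0 a : d a = D.+1 -> b a = 0 by exact: lead_top.
have /choice[dl dlP] : forall a, exists dl : edge E -> L,
    [/\ b a = \sum_e ghost K e * dl e,
        forall e, (d a <= D)%N -> homog (D - d a) (dl e),
        forall e, (D < d a)%N -> dl e = 0,
        forall e, vert K (src e) * dl e = dl e &
        forall e, dl e * vert K (w a) = dl e].
  move=> a; case: (leqP (d a) D) => da; last first.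
    exists (fun=> 0); split=> // *; rewrite ?mulr0 ?mul0r //.
    rewrite big1 => [|e _]; last by rewrite mulr0.
    by move: da; rewrite leq_eqVlt => /orP[/eqP/esym/top0|/h2].
  have := h1 a; rewrite leqW // subSn // => /(_ isT)/homogS_ghost[dl [e1 e2 e3]].
  exists (fun e => dl e * vert K (w a)); split=> [|e _|//|e|e].
  - by rewrite -h3 e1 mulr_suml; apply: eq_bigr => e _; rewrite mulrA.
  - exact: homog_vertr.
  - by rewrite mulrA e3.
  - by rewrite -mulrA vertM_id.
have z e a : dl a e = 0.
  apply: (IH (fun a => dl a e)) => [c|c|c|i].
  - by case: (dlP c) => _ h _ _ _; apply: h.
  - by case: (dlP c) => _ _ h _ _; apply: h.
  - by case: (dlP c).
  apply: (@ghost_indep K E (fun e => \sum_c dl c e * lead c i)) => [f|f|].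
  - apply: inB_sum => c _; apply: inBM; last exact: homog_inB (homog_lead _ _).
    case: (dlP c) => _ hh h0 _ _; case: (leqP (d c) D) => [/hh h|/h0 ->]; last exact: inB0.
    exact: homog_inB (h f).
  - by rewrite mulr_sumr; apply: eq_bigr => c _; rewrite mulrA; case: (dlP c) => _ _ _ -> _.
  rewrite -[RHS](h4 i); under eq_bigr do rewrite mulr_sumr.
  rewrite exchange_big; apply: eq_bigr => c _.
  case: (dlP c) => -> _ _ _ _; rewrite mulr_suml; apply: eq_bigr => f _.
  by rewrite mulrA.
by move=> a; case: (dlP a) => -> _ _ _ _; rewrite big1 // => e _; rewrite z mulr0.
Qed.

Lemma hom_family_sum D (b : I -> L) i : (forall a, inB (b a)) ->
  (forall a n, (D < n + d a)%N -> hom n (b a) = 0) ->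
  hom D (\sum_a b a * x a i) =
  \sum_a (if (d a <= D)%N then hom (D - d a) (b a) else 0) * lead a i.
Proof.
case: F => F1 F2 F3 Bb hb; rewrite hom_sum; apply: eq_bigr => a _.
rewrite homM //; case: leqP => da; last first.
  rewrite mul0r big1 // => j _; rewrite hb ?mul0r //.
  by rewrite ltn_addl.
rewrite (bigD1 (Ordinal (da : (d a < D.+1)%N))) //= big1 ?addr0 // => j ja.
have jD : (j <= D)%N by rewrite -ltnS.
case: (ltngtP j (d a)) => h.
- rewrite hb ?mul0r // -{1}(subnK jD) ltn_add2l //.
- by rewrite F3 ?mulr0.
- by move: ja; rewrite -(inj_eq val_inj) /= h eqxx.
Qed.

(** No cancellation in top degree: the highest component of a combination is a combination of
    leading rows, and these are independent. So no summand exceeds the degree of the sum. *)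
Lemma family_top D (b : I -> L) : (forall a, inB (b a)) ->
  (forall a, b a * vert K (w a) = b a) ->
  (forall i n, (D < n)%N -> hom n (\sum_a b a * x a i) = 0) ->
  forall a n, (D < n + d a)%N -> hom n (b a) = 0.
Proof.
move=> Bb bw hD.
have [N HN] : exists N, forall a n, (N <= n)%N -> hom n (b a) = 0.
  apply: (@finType_bound I (fun a N => forall n, (N <= n)%N -> hom n (b a) = 0)).
    by move=> a n m nm h k mk; apply: h; apply: leq_trans mk.
  by move=> a; apply: inB_hom_bound.
(* Descending induction, k steps below the crude bound given by N and the largest d a; in each step
   all higher components of the summands are already known to vanish. *)
suff H k : forall a n, (D + (N + \max_a d a) - k < n + d a)%N -> (D < n + d a)%N -> hom n (b a) = 0.
  by move=> a n h; apply: (H (N + \max_a d a)%N) => //; rewrite addnK.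
elim: k => [|k IH] a n h1 h2.
  apply: HN; rewrite subn0 in h1.
  have := leq_trans h1 (leq_add (leqnn n) (leq_bigmax a)).
  by rewrite addnA ltn_add2r => /ltnW/(leq_trans (leq_addl D N)).
case: (ltnP (D + (N + \max_a d a) - k) (n + d a)) => [h|h]; first exact: IH.
move: h1; rewrite subnS => h1.
pose m := (n + d a)%N.
have em : (D + (N + \max_a d a) - k)%N = m.
  apply/eqP; rewrite eqn_leq h andbT.
  by case: (D + _ - k)%N h1 => //= ?.
have key : forall c, (if (d c <= m)%N then hom (m - d c) (b c) else 0) = 0.
  apply: (@lead_indep m) => [c dc|c dc|c|i].
  - by rewrite dc; exact: homog_hom.
  - by rewrite leqNgt dc.
  - case: ifP => _; last by rewrite mul0r.
    by rewrite -{2}bw (homM_homog _ (Bb c) (homog_vert K (w c))) subn0.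
  rewrite -hom_family_sum // ?hD // => c n' h'.
  by apply: IH; [rewrite em|apply: ltn_trans h'].
by have := key a; rewrite leq_addl addnK.
Qed.

Lemma family_indepB (b : I -> L) : (forall a, inB (b a)) ->
  (forall a, b a * vert K (w a) = b a) ->
  (forall i, \sum_a b a * x a i = 0) -> forall a, b a = 0.
Proof.
move=> Bb bw h.
have H : forall a n, (0 < n + d a)%N -> hom n (b a) = 0.
  by apply: family_top => // i n _; rewrite h hom0.
have H0 : forall a, (if (d a <= 0)%N then hom (0 - d a) (b a) else 0) = 0.
  apply: (@lead_indep 0) => [c dc|c dc|c|i].
  - by rewrite dc; exact: homog_hom.
  - by rewrite leqNgt dc.
  - case: ifP => _; last by rewrite mul0r.
    by rewrite -{2}bw (homM_homog _ (Bb c) (homog_vert K (w c))) subn0.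
  by rewrite -hom_family_sum // h hom0.
move=> a; apply: inB_hom_eq0 => // n; case: (posnP (n + d a)) => [/eqP|/H //].
by rewrite addn_eq0 => /andP[/eqP -> /eqP da]; have := H0 a; rewrite da.
Qed.

(** From coefficients in B to coefficients in L: a relation is multiplied on the left by ghost edges
    and sinks until its coefficients lie in B, and [eq0_CK2] brings their vanishing back. *)
Lemma family_indep (y : I -> L) : (forall a, y a * vert K (w a) = y a) ->
  (forall i, \sum_a y a * x a i = 0) -> forall a, y a = 0.
Proof.
have [n hn] := Dep_fin y; elim: n y hn => [|n IH] y hn yw hy.
  by apply: family_indepB.
move=> a; apply: eq0_CK2 => [e|v sv].
  apply: (IH (fun a => ghost K e * y a)) => [c|c|i].
  - by case: (hn c) => h _; exact: h.
  - by rewrite -mulrA yw.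
  have := congr1 (fun z => ghost K e * z) (hy i).
  rewrite mulr0 mulr_sumr => hh; rewrite -[RHS]hh.
  by apply: eq_bigr => c _; rewrite mulrA.
apply: (family_indepB (b := fun a => vert K v * y a)) => [c|c|i].
- by case: (hn c) => _ h; exact: h.
- by rewrite -mulrA yw.
have := congr1 (fun z => vert K v * z) (hy i).
rewrite mulr0 mulr_sumr => hh; rewrite -[RHS]hh.
by apply: eq_bigr => c _; rewrite mulrA.
Qed.
End Family.

Section Span.
Variables (R : pzRingType) (J : finType).

Definition spanned (I : finType) (x : I -> J -> R) (z : J -> R) : Prop :=
  exists c : I -> R, forall i, z i = \sum_a c a * x a i.

Lemma spanned_mem (I : finType) (x : I -> J -> R) a : spanned x (x a).
Proof.
exists (fun b => (b == a)%:R) => i; rewrite (bigD1 a) //= eqxx mul1r.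
by rewrite big1 ?addr0 // => b /negPf ->; rewrite mul0r.
Qed.

Lemma spanned_mull (I : finType) (x : I -> J -> R) r z :
  spanned x z -> spanned x (fun i => r * z i).
Proof.
case=> c cE; exists (fun a => r * c a) => i; rewrite cE mulr_sumr.
by apply: eq_bigr => a _; rewrite mulrA.
Qed.

Lemma spannedD (I : finType) (x : I -> J -> R) z z' :
  spanned x z -> spanned x z' -> spanned x (fun i => z i + z' i).
Proof.
case=> c cE [c' cE']; exists (fun a => c a + c' a) => i; rewrite cE cE' -big_split.
by apply: eq_bigr => a _; rewrite mulrDl.
Qed.

Lemma spanned_eq (I : finType) (x : I -> J -> R) z z' :
  (forall i, z i = z' i) -> spanned x z -> spanned x z'.
Proof. by move=> zz [c cE]; exists c => i; rewrite -zz. Qed.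

Lemma spanned_trans (I I' : finType) (x : I -> J -> R) (y : I' -> J -> R) z :
  (forall a, spanned y (x a)) -> spanned x z -> spanned y z.
Proof.
move=> /choice[f fE] [c cE]; exists (fun b => \sum_a c a * f a b) => i.
rewrite cE; under eq_bigr do rewrite fE mulr_sumr.
rewrite exchange_big; apply: eq_bigr => b _; rewrite mulr_suml.
by apply: eq_bigr => a _; rewrite mulrA.
Qed.

End Span.

Section Reduce.
Variables (K : fieldType) (E : graph) (J : finType).
Local Notation L := (LPA K E).
Variables (I : finType) (w : I -> vertex E) (x : I -> J -> L) (d : I -> nat).

Definition update (a0 : I) (b : I -> L) (a : I) (i : J) : L :=
  if a == a0 then x a0 i + \sum_c b c * x c i else x a i.

Hypothesis F : family w x d.
Variables (a0 : I) (b : I -> L).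
Hypothesis red : reduction w x d a0 b.

Lemma reduction_inB a : inB (b a).
Proof. by case: red => h _ _ _ _; exact: homog_inB (h a). Qed.

(** In degree d a0 this is the last clause of [reduction]; in higher degrees the products b a * x a
    vanish because the degree of b a is d a0 - d a. *)
Lemma update_low i n : (d a0 <= n)%N -> hom n (update a0 b a0 i) = 0.
Proof.
case: F => F1 F2 F3; case: red => r1 r2 r3 r4 r5.
rewrite /update eqxx homD hom_sum leq_eqVlt => /orP[/eqP <-|h].
  rewrite -[RHS](r5 i); congr (_ + _); apply: eq_bigr => a _.
  rewrite homM //; last exact: reduction_inB.
  case: (leqP (d a) (d a0)) => da; last first.
    by rewrite r2 // mul0r big1 // => k _; rewrite hom0 mul0r.
  rewrite (bigD1 (Ordinal (da : (d a < (d a0).+1)%N))) //= r1 big1 ?addr0 // => k ka.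
  rewrite (homog_neq (r1 a)) ?mul0r //; apply: contraNneq ka => e.
  have kl : (k <= d a0)%N by rewrite -ltnS.
  by apply/eqP/val_inj; rewrite /= -(subKn kl) e subKn.
rewrite F3 // add0r big1 // => a _; rewrite homM //; last exact: reduction_inB.
rewrite big1 // => k _; case: (ltnP (d a) k) => ka; first by rewrite F3 ?mulr0.
case: (leqP (d a) (d a0)) => da; last by rewrite r2 // hom0 mul0r.
rewrite (homog_neq (r1 a)) ?mul0r //; apply/eqP => e.
have kn : (k <= n)%N by rewrite -ltnS.
by move: h; rewrite ltnNge -(subnK kn) e -{2}(subnK da) leq_add2l ka.
Qed.

Lemma update_inB a i : inB (update a0 b a i).
Proof.
case: F => F1 F2 F3; rewrite /update; case: ifP => _ //.
by apply: inBD => //; apply: inB_sum => c _; apply: inBM => //; exact: reduction_inB.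
Qed.

Lemma update_vert a i : vert K (w a) * update a0 b a i = update a0 b a i.
Proof.
case: F => F1 F2 F3; case: red => r1 r2 r3 r4 r5.
rewrite /update; case: eqP => [->|_] //; rewrite mulrDr F2 mulr_sumr.
by congr (_ + _); apply: eq_bigr => c _; case: (r3 c) => r3' _; rewrite mulrA r3'.
Qed.

Lemma update_span a : spanned x (update a0 b a).
Proof.
case: (eqVneq a a0) => [->|ne]; last first.
  apply: spanned_eq (spanned_mem x a) => i.
  by rewrite /update (negPf ne).
apply: (@spanned_eq _ _ _ _ (fun i => x a0 i + \sum_c b c * x c i)).
  by move=> i; rewrite /update eqxx.
apply: spannedD; first exact: spanned_mem.
by exists b.
Qed.

Lemma update_sum (c : I -> L) i :
  \sum_a c a * x a i = \sum_a (if a == a0 then c a0 else c a - c a0 * b a) * update a0 b a i.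
Proof.
case: red => r1 r2 r3 r4 r5.
rewrite (bigD1 a0) //= [RHS](bigD1 a0) //= eqxx /update eqxx mulrDr -addrA; congr (_ + _).
rewrite [X in _ = c a0 * X + _](bigD1 a0) //= r4 mul0r add0r mulr_sumr -big_split.
by apply: eq_bigr => a /negPf -> /=; rewrite mulrBl -mulrA addrC subrK.
Qed.

Lemma span_update a : spanned (update a0 b) (x a).
Proof.
have [c cE] := spanned_mem x a.
exists (fun a => if a == a0 then c a0 else c a - c a0 * b a) => i.
by rewrite cE update_sum.
Qed.

Lemma update_indep :
  (forall y : I -> L, (forall a, y a * vert K (w a) = y a) ->
    (forall i, \sum_a y a * x a i = 0) -> forall a, y a = 0) ->
  forall y : I -> L, (forall a, y a * vert K (w a) = y a) ->
    (forall i, \sum_a y a * update a0 b a i = 0) -> forall a, y a = 0.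
Proof.
case: red => _ _ r3 _ _ ind y yw hy.
have key : forall a, (if a == a0 then y a0 else y a + y a0 * b a) = 0.
  apply: ind => [a|i].
    by case: eqP => [->|_] //; rewrite mulrDl yw -mulrA (r3 a).2.
  rewrite update_sum -[RHS](hy i); apply: eq_bigr => a _; rewrite eqxx.
  by case: eqP => [->//|_]; rewrite addrK.
have y0 : y a0 = 0 by have := key a0; rewrite eqxx.
by move=> a; have := key a; rewrite y0 mul0r addr0; case: eqP => [->|].
Qed.
End Reduce.

Section SpanBasis.
Variables (K : fieldType) (E : graph) (J : finType).
Local Notation L := (LPA K E).

Definition indep_over (I : finType) (w : I -> vertex E) (x : I -> J -> L) : Prop :=
  forall y : I -> L, (forall a, y a * vert K (w a) = y a) ->
    (forall i, \sum_a y a * x a i = 0) -> forall a, y a = 0.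

(** Induction on a common depth of the entries. By [LPA1_CK2] the rows e^* y a, together with v y a
    for the sinks v, have the same span as the rows y a, and their depth is smaller by one. *)
Lemma span_family (I0 : finType) (y : I0 -> J -> L) :
  exists (I : finType) (w : I -> vertex E) (x : I -> J -> L) (d : I -> nat),
  [/\ family w x d, forall a, spanned x (y a) & forall a, spanned y (x a)].
Proof.
have [n hn] := @Dep_fin K E (I0 * J)%type (fun p => y p.1 p.2).
have {}hn a i : Dep n (y a i) := hn (a, i).
elim: n I0 y hn => [|n IH] I0 y hn.
  pose x (p : vertex E * I0) i := vert K p.1 * y p.2 i.
  have Bx p i : inB (x p i) by apply: inBM; [exact: inB_vert|exact: hn].
  have /choice[d dP] : forall p, exists m, forall i n, (m < n)%N -> hom n (x p i) = 0.
    move=> p; apply: (@finType_bound J (fun i m => forall n, (m < n)%N -> hom n (x p i) = 0)).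
      by move=> i m k mk h l kl; apply: h; apply: leq_ltn_trans kl.
    by move=> i; have [N HN] := inB_hom_bound (Bx p i); exists N => k /ltnW/HN.
  exists (vertex E * I0)%type, (fun p => p.1), x, d; split=> [|a|a].
  - by split=> // p i; rewrite /x mulrA vertM_id.
  - exists (fun p => (p.2 == a)%:R) => i.
    transitivity (\sum_v x (v, a) i); first by rewrite /x /= -mulr_suml -LPA1 mul1r.
    rewrite -(pair_bigA _ (fun v c => (c == a)%:R * x (v, c) i)) /=.
    apply: eq_bigr => v _; rewrite (bigD1 a) //= eqxx mul1r big1 ?addr0 // => c /negPf ->.
    by rewrite mul0r.
  - by apply: spanned_mull; exact: spanned_mem.
(* A vertex that is no sink contributes a zero row, so that the index set stays a plain product. *)
pose y' (p : (edge E * I0) + (vertex E * I0)) i : L :=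
  match p with
  | inl q => ghost K q.1 * y q.2 i
  | inr q => if sink q.1 then vert K q.1 * y q.2 i else 0
  end.
have hn' p i : Dep n (y' p i).
  case: p => [[e a]|[v a]] /=; first by case: (hn a i) => h _; exact: h.
  case: ifP => sv; last exact/Dep_inB/inB0.
  by apply: Dep_inB; case: (hn a i) => _; exact.
have [I [w [x [d [F h1 h2]]]]] := IH _ y' hn'; exists I, w, x, d; split=> // a.
  apply: (spanned_trans h1).
  exists (fun p => match p with inl q => if q.2 == a then edg K q.1 else 0
                   | inr q => if sink q.1 && (q.2 == a) then 1 else 0 end) => i.
  rewrite big_sumType /= [LHS](LPA1_CK2 (y a i)); congr (_ + _).
    rewrite -(pair_bigA _ (fun e c => (if c == a then edg K e else 0) * (ghost K e * y c i))) /=.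
    apply: eq_bigr => e _; rewrite (bigD1 a) //= eqxx big1 ?addr0 // => c /negPf ->.
    by rewrite mul0r.
  rewrite -(pair_bigA _ (fun v c => (if sink v && (c == a) then 1 else 0) *
    (if sink v then vert K v * y c i else 0))) /= big_mkcond /=.
  apply: eq_bigr => v _; case: ifP => sv; last by rewrite big1 // => c _; rewrite mulr0.
  rewrite (bigD1 a) //= eqxx mul1r big1 ?addr0 // => c /negPf ->.
  by rewrite mul0r.
apply: spanned_trans (h2 a) => -[[e c]|[v c]] /=.
  by apply: spanned_mull; exact: spanned_mem.
case sv: (sink v).
  apply: (@spanned_eq _ _ _ _ (fun i => vert K v * y c i)).
    by move=> i; rewrite /y' /= sv.
  by apply: spanned_mull; exact: spanned_mem.
by exists (fun=> 0) => i; rewrite /y' /= sv big1 // => k _; rewrite mul0r.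
Qed.

Lemma update_family (I : finType) (w : I -> vertex E) (x : I -> J -> L) (d : I -> nat)
  (a0 : I) (b : I -> L) : family w x d -> reduction w x d a0 b ->
  (0 < d a0)%N ->
  family w (update x a0 b) (fun a => if a == a0 then (d a0).-1 else d a).
Proof.
move=> F red da0; split.
- exact: update_inB F _ _ red.
- exact: update_vert F _ _ red.
move=> a i n; case: eqP => [->|/eqP/negPf ne] h.
  by apply: (update_low F red); rewrite -(prednK da0).
by case: F => _ _ F3; rewrite /update ne F3.
Qed.

Lemma update_measure (I : finType) (d : I -> nat) (a0 : I) : (0 < d a0)%N ->
  (\sum_a (if a == a0 then (d a0).-1 else d a).+1 < \sum_a (d a).+1)%N.
Proof.
move=> da0; rewrite (bigD1 a0) //= eqxx [X in (_ < X)%N](bigD1 a0) //= prednK //.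
rewrite addSn ltnS leq_add2l; apply: leq_sum => a /negPf -> //.
Qed.

(** Reductions are carried out as long as there are any. Each one lowers a degree bound, or, if the
    bound is already 0, turns the row into 0, and the row is dropped. The successor in the measure
    makes it fall in the second case too. *)
Theorem span_basis (I0 : finType) (y : I0 -> J -> L) :
  exists (I : finType) (w : I -> vertex E) (x : I -> J -> L),
  [/\ forall a i, vert K (w a) * x a i = x a i,
      forall a, spanned x (y a), forall a, spanned y (x a) &
      indep_over w x].
Proof.
have [I [w [x [d [F h1 h2]]]]] := span_family y.
have [m] := ubnP (\sum_a (d a).+1)%N.
elim: m => // m IH in I w x d F h1 h2 *; rewrite ltnS => hm.
have [[a0 [b red]]|irr] := pselect (exists a0 b, reduction w x d a0 b); last first.
  exists I, w, x; split=> //; first by case: F.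
  by apply: family_indep F _ => a0 b red; apply: irr; exists a0, b.
have [da0|da0] := posnP (d a0); last first.
  apply: (IH I w (update x a0 b) (fun a => if a == a0 then (d a0).-1 else d a)).
  - exact: update_family.
  - move=> a; apply: spanned_trans (h1 a) => c; exact: span_update red _.
  - move=> a; apply: spanned_trans (update_span x a0 b a) => c; exact: h2.
  - by apply: leq_trans hm; exact: update_measure.
have u0 i : update x a0 b a0 i = 0.
  apply: inB_hom_eq0; first exact: update_inB F _ _ red _ _.
  by move=> n; apply: (update_low F red); rewrite da0.
pose I' := {a : I | a != a0}.
have ud (a : I') i : update x a0 b (val a) i = x (val a) i.
  by rewrite /update (negPf (valP a)).
apply: (IH I' (w \o val) (x \o val) (d \o val)).
- by case: F => F1 F2 F3; split=> [a i|a i|a i n] /=; [exact: F1|exact: F2|exact: F3].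
- move=> a; apply: spanned_trans (h1 a) => c.
  have [f fE] := span_update red c; exists (f \o val) => i; rewrite fE.
  rewrite (bigD1 a0) //= u0 mulr0 add0r.
  rewrite (reindex_omap (val : I' -> I) insub) /=; last first.
    by move=> k kne; rewrite insubT.
  apply: eq_big => [k|k _]; first by rewrite valK eqxx andbT (valP k).
  by rewrite ud.
- move=> a; exact: h2.
apply: leq_trans hm; rewrite [X in (_ < X)%N](bigD1 a0) //= addSn ltnS.
apply: leq_trans (leq_addl _ _).
rewrite [X in (_ <= X)%N](reindex_omap (val : I' -> I) insub) /=; last first.
  by move=> k kne; rewrite insubT.
by rewrite leq_eqVlt; apply/orP; left; apply/eqP; apply: eq_bigl => k; rewrite valK eqxx andbT (valP k).
Qed.
End SpanBasis.

(** * Weights of bases *)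

(** Linear independence against a spanning family, for vectors of W^J: a matrix with more rows than
    columns has a nonzero kernel vector. *)
Lemma free_le_card (K : fieldType) (W : lmodType K) (J I1 I2 : finType)
  (X : I1 -> J -> W) (Y : I2 -> J -> W) :
  (forall p, exists c : I2 -> K, forall i, X p i = \sum_q c q *: Y q i) ->
  (forall c : I1 -> K, (forall i, \sum_p c p *: X p i = 0) -> forall p, c p = 0) ->
  (#|I1| <= #|I2|)%N.
Proof.
move=> /choice[C CE] fr; rewrite leqNgt; apply/negP => lt.
pose A := \matrix_(i < #|I1|, j < #|I2|) C (enum_val i) (enum_val j).
have : kermx A != 0.
  rewrite kermx_eq0 /row_free; apply: contraTneq lt => e.
  by rewrite -leqNgt -e rank_leq_col.
case/rowV0Pn => r /sub_kermxP rA; case/eqP; apply/rowP => i; rewrite mxE.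
have := fr (fun p => r 0 (enum_rank p)) _ (enum_val i); rewrite enum_valK; apply.
move=> k; under eq_bigr do rewrite CE scaler_sumr.
rewrite exchange_big big1 // => q _; under eq_bigr do rewrite scalerA.
rewrite -scaler_suml; have := congr1 (fun M : 'M[K]_(1, #|I2|) => M 0 (enum_rank q)) rA.
rewrite !mxE (reindex _ (onW_bij _ (enum_rank_bij I1))) /= => h.
suff -> : \sum_i0 r 0 (enum_rank i0) * C i0 q = 0 by rewrite scale0r.
by rewrite -[RHS]h; apply: eq_bigr => p _; rewrite mxE !enum_rankK.
Qed.

Section PathCount.
Variable E : graph.
Implicit Types v w : vertex E.

Definition npath n v w : nat :=
  #|[pred q : n.-tuple (edge E) | is_path v q && (path_end v q == w)]|.

Lemma npath0 v w : npath 0 v w = (v == w).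
Proof.
rewrite /npath; case: (eqVneq v w) => vw; last first.
  by apply/eq_card0 => q; rewrite !inE (tuple0 q) /path_end /= (negPf vw).
transitivity #|pred1 ([tuple] : 0.-tuple (edge E))|; last exact: card1.
apply: eq_card => q.
by rewrite !inE (tuple0 q) /path_end /= vw !eqxx.
Qed.

Lemma npathS n v w : npath n.+1 v w = (\sum_(e | src e == v) npath n (rng e) w)%N.
Proof.
rewrite /npath -sum1_card.
under [RHS]eq_bigr do rewrite -sum1_card.
rewrite pair_big_dep /=.
rewrite (reindex (fun p : edge E * n.-tuple (edge E) => [tuple of p.1 :: p.2])) /=.
  by apply: eq_bigl => -[e q]; rewrite !inE /= andbA.
exists (fun q : n.+1.-tuple (edge E) => (thead q, [tuple of behead q])) => [[e q] _|q _] /=.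
  by congr pair; apply: val_inj.
by rewrite [RHS]tuple_eta; apply: val_inj.
Qed.

Lemma npath_sink n v w : sink v -> npath n v w = ((n == 0) && (v == w))%N.
Proof.
case: n => [|n] sv; first by rewrite npath0.
rewrite npathS big1 // => e /eqP ev; move/forallP/(_ e): sv.
by rewrite ev eqxx.
Qed.

Variables (A : zmodType) (phi : vertex E -> A).
Hypothesis phiE : forall v, ~~ sink v -> phi v = \sum_(e | src e == v) phi (rng e).

(* The number of paths from v to w of length D, or of length at most D if w is a
   sink: expanding phi v along CK2 until depth D reaches w this often. *)
Definition cut_count D v w : nat :=
  if sink w then (\sum_(d < D.+1) npath d v w)%N else npath D v w.

Lemma cut_countS D v w : ~~ sink v ->
  cut_count D.+1 v w = (\sum_(e | src e == v) cut_count D (rng e) w)%N.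
Proof.
move=> nsv; rewrite /cut_count; case: ifP => sw; last exact: npathS.
rewrite exchange_big big_ord_recl npath0.
have -> : (v == w) = false by apply: contraTF sw => /eqP <-.
by rewrite add0n; apply: eq_bigr => d _; rewrite npathS.
Qed.

Lemma cut_sum D v : phi v = \sum_w phi w *+ cut_count D v w.
Proof.
elim: D v => [|D IH] v.
  rewrite (bigD1 v) //= big1 => [|w wv].
    by rewrite /cut_count big_ord1 if_same npath0 eqxx addr0.
  by rewrite /cut_count big_ord1 if_same npath0 eq_sym (negPf wv).
case sv : (sink v).
  rewrite (bigD1 v) //= big1 => [|w wv].
    rewrite /cut_count sv big_ord_recl npath0 eqxx big1 ?addr0 ?addn0 // => i _.
    by rewrite npath_sink.
  rewrite /cut_count; case: ifP => _; last by rewrite npath_sink.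
  by rewrite big1 // => i _; rewrite npath_sink // [v == w]eq_sym (negPf wv) andbF.
rewrite phiE ?sv //; under eq_bigr do rewrite IH.
rewrite exchange_big; apply: eq_bigr => w _.
by rewrite cut_countS ?sv // sumrMnr.
Qed.
End PathCount.

Section Weight.
Variables (K : fieldType) (E : graph) (J : finType) (u : J -> vertex E).
Local Notation L := (LPA K E).
Variables (A : zmodType) (phi : vertex E -> A).
Hypothesis phiE : forall v, ~~ sink v -> phi v = \sum_(e | src e == v) phi (rng e).

Definition unit_row i0 i : L := if i == i0 then vert K (u i0) else 0.

(* A basis, graded by vertices, of the sum of the modules L (u i). *)
Definition gbasis (I : finType) (w : I -> vertex E) (x : I -> J -> L) : Prop :=
  [/\ forall a i, vert K (w a) * x a i = x a i,
      forall a i, x a i * vert K (u i) = x a i,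
      indep_over w x & forall i0, spanned x (unit_row i0)].

(** At a vertex that emits edges the row x a is replaced by the rows e^* x a. The weight is
    preserved because phi satisfies [phiE], and the depth falls by one; the rows at sinks are kept,
    since they already lie in B. *)
Lemma gbasis_split (I : finType) (w : I -> vertex E) (x : I -> J -> L) :
  gbasis w x -> exists (I' : finType) (w' : I' -> vertex E) (x' : I' -> J -> L),
  [/\ gbasis w' x', \sum_a phi (w' a) = \sum_a phi (w a) &
      forall n, (forall a i, Dep n.+1 (x a i)) -> forall a i, Dep n (x' a i)].
Proof.
case=> G1 G2 G3 G4.
pose I1 := {p : edge E * I | src p.1 == w p.2}.
pose I2 := {a : I | sink (w a)}.
pose w' (p : I1 + I2) := match p with inl q => rng (val q).1 | inr q => w (val q) end.
pose x' (p : I1 + I2) i : L := match p with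
  | inl q => ghost K (val q).1 * x (val q).2 i | inr q => x (val q) i end.
exists (I1 + I2)%type, w', x'; split; last first.
- move=> n hn [[[e a] ea]|[a sa]] i /=; first by case: (hn a i) => h _; exact: h.
  by apply: Dep_inB; case: (hn a i) => _ h; rewrite -G1; exact: h.
- rewrite big_sumType /= (big_sig (fun p : edge E * I => src p.1 == w p.2) xpredT (fun p => phi (rng p.1))).
  rewrite (big_sig (fun a => sink (w a)) xpredT (fun a => phi (w a))) /=.
  rewrite [RHS](bigID (fun a => sink (w a))) /= addrC; congr (_ + _).
    by apply: eq_bigl => a; rewrite andbT.
  transitivity (\sum_a \sum_(e | src e == w a) phi (rng e)).
    rewrite pair_big_dep /=.
    rewrite (reindex (fun p : I * edge E => (p.2, p.1))) /=; last first.
      by exists (fun p => (p.2, p.1)) => -[].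
    by apply: eq_bigl => p; rewrite andbT.
  rewrite (bigID (fun a => sink (w a))) /= big1 ?add0r => [|a /forallP sa]; last first.
    by rewrite big_pred0 // => e; apply/negbTE/sa.
  by apply: eq_bigr => a sa; rewrite phiE.
split=> [[[[e a] /= ea]|[a sa]] i|[[[e a] /= ea]|[a sa]] i|y yw hy|i0] /=.
- by rewrite mulrA vert_ghost.
- exact: G1.
- by rewrite -mulrA G2.
- exact: G2.
(* The coefficient that the old row a receives from the new rows. Once it vanishes, right
   multiplication by an edge isolates each y by CK1. *)
- pose z a := \sum_(e : I1 | (val e).2 == a) y (inl e) * ghost K (val e).1
            + \sum_(c : I2 | val c == a) y (inr c).
  have zw a : z a * vert K (w a) = z a.
    rewrite mulrDl !mulr_suml; congr (_ + _).
      apply: eq_bigr => -[[e b] /= eb] /eqP ba; rewrite -mulrA; congr (_ * _).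
      by rewrite -ba -(eqP eb) ghost_vert.
    by apply: eq_bigr => -[b sb] /= /eqP ba; rewrite -ba -{2}yw.
  have z0 : forall a, z a = 0.
    apply: G3 => // i; rewrite -[RHS](hy i) big_sumType /=.
    under eq_bigr do rewrite mulrDl !mulr_suml.
    rewrite big_split; congr (_ + _).
      rewrite [RHS](partition_big (fun e : I1 => (val e).2) xpredT) //=.
      apply: eq_bigr => a _; apply: eq_bigr => e /eqP <-; by rewrite mulrA.
    rewrite [RHS](partition_big (fun e : I2 => val e) xpredT) //=.
    by apply: eq_bigr => a _; apply: eq_bigr => e /eqP <-.
  case=> [[[e a] ea]|[a sa]].
    have := congr1 (fun t => t * edg K e) (z0 a); rewrite mul0r mulrDl !mulr_suml.
    rewrite (bigD1 (exist _ (e, a) ea : I1)) //= -mulrA ghost_edg_id -{1}(yw (inl _)) /= -mulrA vertM_id.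
    rewrite -[X in X + _ + _]/(y (inl (exist _ (e, a) ea)) * vert K (w' (inl (exist _ (e, a) ea)))) yw.
    rewrite !big1 ?addr0 //.
      move=> -[b sb] /= /eqP ba; rewrite -yw /= -mulrA vert_edg_neq ?mulr0 //.
      by rewrite eq_sym; move/forallP: sb; apply.
    move=> -[[f b] fb] /= /andP[/eqP ba ne]; rewrite -mulrA ghost_edg; case: eqP => [fe|]; last by rewrite mulr0.
    by case/eqP: ne; apply: val_inj; rewrite /= fe ba.
  have := z0 a; rewrite /z big1 ?add0r => [|[[e b] eb] /= /eqP ba]; last first.
    by move/forallP/(_ e): sa; rewrite -ba (eqP eb) eqxx.
  by rewrite (big_pred1 (exist _ a sa : I2)).
- apply: spanned_trans (G4 i0) => a.
  exists (fun p => match p with inl q => if (val q).2 == a then edg K (val q).1 else 0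
     | inr q => if val q == a then vert K (w a) else 0 end) => i.
  rewrite big_sumType /= [LHS](LPA1_CK2 (x a i)); congr (_ + _).
    rewrite (big_sig (fun p : edge E * I => src p.1 == w p.2) xpredT
      (fun p => (if p.2 == a then edg K p.1 else 0) * (ghost K p.1 * x p.2 i))) /=.
    transitivity (\sum_(e | src e == w a) edg K e * (ghost K e * x a i)).
      rewrite [RHS]big_mkcond; apply: eq_bigr => e _; case: ifP => // ea.
      by rewrite -G1 (mulrA (ghost K e)) ghost_vert_neq ?ea // mul0r mulr0.
    rewrite [RHS](bigID (fun p => p.2 == a)) /= [X in _ = _ + X]big1 ?addr0; last first.
      by move=> p /andP[_ /negPf ->]; rewrite mul0r.
    rewrite [RHS](reindex_omap (fun e => (e, a)) (fun p => if p.2 == a then Some p.1 else None)) /=.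
      by apply: eq_big => e; rewrite eqxx ?eqxx ?andbT //= .
    by move=> [e b] /andP[_ /= /eqP ->]; rewrite eqxx.
  rewrite (big_sig (fun a => sink (w a)) xpredT
    (fun b => (if b == a then vert K (w a) else 0) * x b i)) /=.
  case sa : (sink (w a)).
    rewrite (bigD1 (w a)) //= [RHS](bigD1 a) ?sa //= eqxx; congr (_ + _).
    rewrite !big1 // => [b /andP[_ /negPf ->]|v /andP[_ va]]; first by rewrite mul0r.
    by rewrite -G1 mulrA vertM (negPf va) mul0r.
  rewrite !big1 // => [b /andP[sb _]|v sv]; first by case: eqP => [ba|_]; [rewrite ba sa in sb|rewrite mul0r].
  rewrite -G1 mulrA vertM; case: eqP => [va|_]; last by rewrite mul0r.
  by rewrite -va sv in sa.
Qed.

Lemma gbasis_inB (I : finType) (w : I -> vertex E) (x : I -> J -> L) :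
  gbasis w x -> exists (I' : finType) (w' : I' -> vertex E) (x' : I' -> J -> L),
  [/\ gbasis w' x', \sum_a phi (w' a) = \sum_a phi (w a) &
      forall a i, inB (x' a i)].
Proof.
have [n hn] := @Dep_fin K E (I * J)%type (fun p => x p.1 p.2).
have {}hn a i : Dep n (x a i) := hn (a, i).
elim: n I w x hn => [|n IH] I w x hn G; first by exists I, w, x.
have [I1 [w1 [x1 [G1 s1 d1]]]] := gbasis_split G.
have [I2 [w2 [x2 [G2 s2 d2]]]] := IH I1 w1 x1 (d1 n hn) G1.
by exists I2, w2, x2; split=> //; rewrite s2.
Qed.

Lemma gbasis_update (I : finType) (w : I -> vertex E) (x : I -> J -> L) (d : I -> nat) a0 b :
  gbasis w x -> reduction w x d a0 b -> gbasis w (update x a0 b).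
Proof.
case=> G1 G2 G3 G4 red; split=> [a i|a i||i0].
- case: red => r1 r2 r3 r4 r5; rewrite /update; case: eqP => [->|_] //.
  rewrite mulrDr G1 mulr_sumr; congr (_ + _); apply: eq_bigr => c _.
  by rewrite mulrA (r3 c).1.
- rewrite /update; case: ifP => _ //; rewrite mulrDl G2 mulr_suml; congr (_ + _).
  by apply: eq_bigr => c _; rewrite -mulrA G2.
- exact: update_indep red G3.
- apply: spanned_trans (G4 i0) => a; exact: span_update red a.
Qed.

Lemma gbasis_irr (I : finType) (w : I -> vertex E) (x : I -> J -> L) :
  gbasis w x -> (forall a i, inB (x a i)) -> exists (x' : I -> J -> L) d,
  [/\ gbasis w x', family w x' d & forall a0 b, ~ reduction w x' d a0 b].
Proof.
move=> G Bx.
have [d F] : exists d, family w x d.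
  have /choice[d dP] : forall p, exists m, forall i n, (m < n)%N -> hom n (x p i) = 0.
    move=> p; apply: (@finType_bound J (fun i m => forall n, (m < n)%N -> hom n (x p i) = 0)).
      by move=> i m k mk h l kl; apply: h; apply: leq_ltn_trans kl.
    by move=> i; have [N HN] := inB_hom_bound (Bx p i); exists N => k /ltnW/HN.
  by exists d; case: G => G1 _ _ _; split.
have [m] := ubnP (\sum_a (d a).+1)%N.
elim: m => // m IH in x d F G {Bx} *; rewrite ltnS => hm.
have [[a0 [b red]]|irr] := pselect (exists a0 b, reduction w x d a0 b); last first.
  by exists x, d; split=> // a0 b red; apply: irr; exists a0, b.
have G' := gbasis_update G red.
have [da0|da0] := posnP (d a0); last first.
  apply: (IH (update x a0 b) (fun a => if a == a0 then (d a0).-1 else d a)) => //.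
  - exact: update_family.
  - by apply: leq_trans hm; exact: update_measure.
have u0 i : update x a0 b a0 i = 0.
  apply: inB_hom_eq0; first exact: update_inB F _ _ red _ _.
  by move=> n; apply: (update_low F red); rewrite da0.
case: G' => G1 _ G3 _.
(* Unlike in [span_basis] no row can become zero here: the rows are independent and stay so under
   [update]. *)
have := G3 (fun a => if a == a0 then vert K (w a0) else 0) _ _ a0.
rewrite eqxx => h; case/eqP: (vert_neq0 K (w a0)); apply: h.
  by move=> a; case: eqP => [->|_]; rewrite ?vertM_id ?mul0r.
by move=> i; rewrite (bigD1 a0) //= u0 mulr0 add0r big1 // => a /negPf ->; rewrite mul0r.
Qed.

Lemma homog_path_sum m v v' (b : L) : homog m b -> b * vert K v = b ->
  vert K v' * b = b ->
  b = \sum_(q : m.-tuple (edge E) | is_path v q && (path_end v q == v'))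
        coef v q b *: gp K v q.
Proof.
move=> hb bv vb; rewrite -{1}bv -{1}vb -{1}hb /hom mulr_sumr mulr_suml.
rewrite (eq_bigr (fun p : vertex E * m.-tuple (edge E) =>
  if (p.1 == v) && (path_end v p.2 == v') then coef v p.2 b *: gp K v p.2 else 0)); last first.
  move=> [v1 q] /= pq; rewrite -scaleLr -scaleLl vertM_gp.
  case: (eqVneq v1 v) pq => [->|ne] pq /=.
    by rewrite eq_sym; case: eqP => _; rewrite ?gp_vert ?mul0r ?scaler0.
  case: ifP => _; last by rewrite mul0r scaler0.
  rewrite -(gp_vert K pq) -mulrA vertM (negPf ne) mulr0 scaler0.
  by [].
rewrite -big_mkcondr /=.
rewrite (reindex_omap (pair v) (fun p : vertex E * _ => if p.1 == v then Some p.2 else None)) /=.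
  by apply: eq_bigl => q; rewrite !eqxx andbT.
by move=> [v1 q] /= /and3P[_ /eqP -> _]; rewrite eqxx.
Qed.

Section Count.
Variables (I : finType) (w : I -> vertex E) (x : I -> J -> L) (dg : I -> nat).
Hypothesis G : gbasis w x.
Hypothesis F : family w x dg.
Hypothesis irr : forall a0 b, ~ reduction w x dg a0 b.
Variables (d : nat) (w0 : vertex E).

Let Q := {p : J * d.-tuple (edge E) |
  is_path (u p.1) p.2 && (path_end (u p.1) p.2 == w0)}.
Let Tg := {a : I & (d - dg a).-tuple (edge E)}.
Let T := {p : Tg | [&& (dg (tag p) <= d)%N, is_path (w (tag p)) (tagged p) &
  path_end (w (tag p)) (tagged p) == w0]}.

(** X and Y are to be two bases of one vector space, the rows of degree d over w0 B with i-th entry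
    in B (u i): X consists of single ghost paths, Y of ghost paths times leading rows. Their sizes
    are the two sides of [count_eq]. *)
Let X (p : Q) (i : J) : L :=
  if i == (val p).1 then gp K (u (val p).1) (val p).2 else 0.
Let Y (p : T) (i : J) : L :=
  gp K (w (tag (val p))) (tagged (val p)) * lead x dg (tag (val p)) i.

Lemma card_Q : #|{: Q}| = (\sum_i npath d (u i) w0)%N.
Proof.
rewrite card_sig -sum1_card (eq_bigl (fun p : J * d.-tuple (edge E) =>
  is_path (u p.1) p.2 && (path_end (u p.1) p.2 == w0))) //.
rewrite -(pair_big_dep xpredT (fun i (q : d.-tuple (edge E)) =>
  is_path (u i) q && (path_end (u i) q == w0)) (fun _ _ => 1%N)) /=.
by apply: eq_bigr => i _; rewrite /npath -sum1_card.
Qed.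

Lemma card_T : #|{: T}| =
  (\sum_a (if (dg a <= d)%N then npath (d - dg a) (w a) w0 else 0))%N.
Proof.
rewrite card_sig -sum1_card (eq_bigl (fun p : Tg => (xpredT (tag p)) &&
  [&& (dg (tag p) <= d)%N, is_path (w (tag p)) (tagged p) &
  path_end (w (tag p)) (tagged p) == w0])) //.
rewrite -(sig_big_dep xpredT (fun a (q : (d - dg a).-tuple (edge E)) =>
  [&& (dg a <= d)%N, is_path (w a) q & path_end (w a) q == w0]) (fun _ _ => 1%N)) /=.
apply: eq_bigr => a _; case: ifP => _ /=; first by rewrite /npath -sum1_card.
by rewrite big_pred0.
Qed.

Lemma X_free (c : Q -> K) :
  (forall i, \sum_p c p *: X p i = 0) -> forall p, c p = 0.
Proof.
move=> h [[i q] /= pq]; have := congr1 (coef (u i) q) (h i).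
have pi : is_path (u i) q by case/andP: (pq).
rewrite coef0 coef_sum (bigD1 (exist _ (i, q) pq : Q)) //= coefZ /X /= eqxx.
rewrite coef_gp // !eqxx mulr1 big1 ?addr0 // => -[[j q'] pq'] /= ne.
rewrite coefZ; case: eqP => [ij|]; last by rewrite coef0 mulr0.
rewrite coef_gp //; last by case/andP: (pq').
case: (_ =P val q') => [qq|]; last by rewrite andbF mulr0.
case/eqP: ne; apply: val_inj => /=; congr pair; first by rewrite ij.
exact/val_inj/esym.
Qed.

(** For each a the scalars at its leading row combine to one element of B of degree d - dg a, so
    [lead_indep] applies. *)
Lemma Y_free (c : T -> K) :
  (forall i, \sum_p c p *: Y p i = 0) -> forall p, c p = 0.
Proof.
move=> h.
pose b a := \sum_(p : T | tag (val p) == a) c p *: gp K (w (tag (val p))) (tagged (val p)).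
have hb a : (dg a <= d)%N -> homog (d - dg a) (b a).
  move=> _; apply: homog_sum => -[[a1 q] /= pq] /eqP <-; apply: homogZ; have /and3P[h1 h2 h3] := pq.
  by rewrite -[X in homog X](size_tuple q); apply: homog_gp.
have b0 : forall a, b a = 0.
  apply: (lead_indep F irr (D := d)) => // [a|a|i].
  - move=> ha; rewrite /b big1 // => -[[a1 q] /= pq] /eqP e; have /and3P[h1 h2 h3] := pq.
    by move: ha; rewrite ltnNge -e h1.
  - rewrite /b mulr_suml; apply: eq_bigr => -[[a1 q] /= pq] /eqP <-; have /and3P[h1 h2 h3] := pq.
    by rewrite -scaleLl gp_vert.
  rewrite -[RHS](h i) [RHS](partition_big (fun p : T => tag (val p)) xpredT) //=.
  apply: eq_bigr => a _; rewrite mulr_suml; apply: eq_bigr => p /eqP <-.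
  by rewrite -scaleLl.
move=> [[a q] /= pq]; have := congr1 (coef (w a) q) (b0 a).
have /and3P[pq1 pq2 pq3] := pq.
rewrite coef0 coef_sum (bigD1 (exist _ (Tagged _ q) pq : T)) //= coefZ.
rewrite coef_gp // !eqxx mulr1 big1 ?addr0 // => -[[a' q'] /= pq'] /andP[/eqP e ne].
subst a'; case/and3P: (pq') => h1 h2 h3; rewrite coefZ coef_gp // eqxx /=.
case: eqP => [qq|]; last by rewrite mulr0.
case/eqP: ne; apply: val_inj => /=.
by congr (existT _ _ _); apply/val_inj/esym.
Qed.

Lemma Y_span (p : T) : exists c : Q -> K, forall i, Y p i = \sum_q c q *: X q i.
Proof.
case: G => G1 G2 G3 G4; have /and3P[p1 p2 /eqP p3] := valP p.
exists (fun q : Q => coef (u (val q).1) (val q).2 (Y p (val q).1)) => i.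
have hY : homog d (Y p i).
  rewrite -[X in homog X](subnK p1); apply: homogM; last exact: homog_hom.
  by rewrite -[X in homog X](size_tuple (tagged (val p))); apply: homog_gp.
rewrite {1}(@homog_path_sum d (u i) w0 (Y p i) hY); first last.
- by rewrite /Y mulrA vertM_gp p3 eqxx.
- rewrite -mulrA; congr (_ * _); rewrite /lead -{2}(G2 (tag (val p)) i).
  rewrite (homM_homog _ _ (homog_vert K (u i))) ?subn0 //.
  by case: F.
rewrite (bigID (fun q : Q => (val q).1 == i)) /= [X in _ = _ + X]big1 ?addr0; last first.
  by move=> q ne; rewrite /X eq_sym (negPf ne) scaler0.
rewrite (big_sig (fun p : J * d.-tuple (edge E) => is_path (u p.1) p.2 && (path_end (u p.1) p.2 == w0))
  (fun p => p.1 == i) (fun q => coef (u q.1) q.2 (Y p q.1) *: (if i == q.1 then gp K (u q.1) q.2 else 0))).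
rewrite [RHS](reindex_omap (pair i) (fun p : J * _ => if p.1 == i then Some p.2 else None)) /=.
  by apply: eq_big => q; rewrite !eqxx ?andbT.
by move=> [v1 q] /= /andP[_ /eqP ->]; rewrite eqxx.
Qed.

Variable c0 : J -> I -> L.
Hypothesis c0E : forall i0 i, unit_row i0 i = \sum_a c0 i0 a * x a i.
Hypothesis c0v : forall i0 a, c0 i0 a * vert K (w a) = c0 i0 a.
Variable D : nat.
Hypothesis c0D : forall i0 a, Dep D (c0 i0 a).
Hypothesis hd : (d == D) || sink w0.

(** The product of q^* with the expansion of a unit row in the basis has coefficients in B, because
    q has length D or ends at a sink. By [family_top] no summand exceeds degree d, so its degree d
    component involves leading rows only. *)
Lemma X_span (p : Q) : exists c : T -> K, forall i, X p i = \sum_q c q *: Y q i.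
Proof.
case: G => G1 G2 G3 G4; case: p => -[i0 q] /= pq; have /andP[p1 /eqP p2] := pq.
pose b a := gp K (u i0) q * c0 i0 a.
have Bb a : inB (b a).
  apply: Dep_path (c0D i0 a) p1 _; rewrite p2 size_tuple.
  by case/orP: hd => [/eqP ->|->]; rewrite ?leqnn ?orbT.
have bw a : b a * vert K (w a) = b a by rewrite -mulrA c0v.
have bx i : \sum_a b a * x a i = if i == i0 then gp K (u i0) q else 0.
  transitivity (gp K (u i0) q * unit_row i0 i).
    by rewrite c0E mulr_sumr; apply: eq_bigr => a _; rewrite mulrA.
  by rewrite /unit_row; case: eqP => _; rewrite ?mulr0 // gp_vert.
have top : forall a n, (d < n + dg a)%N -> hom n (b a) = 0.
  apply: (family_top F irr) => // i n dn; rewrite bx; case: eqP => _; last by rewrite hom0.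
  by rewrite hom_gp // size_tuple ltn_eqF.
pose h a := hom (d - dg a) (b a).
exists (fun t : T => coef (w (tag (val t))) (tagged (val t)) (h (tag (val t)))) => i.
transitivity (hom d (\sum_a b a * x a i)).
  by rewrite bx /X /=; case: eqP => _; rewrite ?hom0 // hom_gp // size_tuple eqxx.
rewrite (hom_family_sum F) //.
rewrite [RHS](partition_big (fun p : T => tag (val p)) xpredT) //=.
apply: eq_bigr => a _; case: leqP => da; last first.
  rewrite mul0r big1 // => -[[a1 q1] /= pq1] /eqP e; have /and3P[h1 _ _] := pq1.
  by move: da; rewrite ltnNge -e h1.
rewrite -[hom (d - dg a) (b a)]/(h a) (@homog_path_sum (d - dg a) (w a) w0 (h a)); first last.
- by rewrite /h -hom_vertl //; congr hom; rewrite /b mulrA vertM_gp p2 eqxx.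
- by rewrite /h -{2}bw (homM_homog _ (Bb a) (homog_vert K (w a))) subn0.
- exact: homog_hom.
rewrite mulr_suml.
rewrite (big_sig (fun p : Tg => [&& (dg (tag p) <= d)%N, is_path (w (tag p)) (tagged p) &
  path_end (w (tag p)) (tagged p) == w0]) (fun p => tag p == a)
  (fun p => coef (w (tag p)) (tagged p) (h (tag p)) *: (gp K (w (tag p)) (tagged p) * lead x dg (tag p) i))).
rewrite [RHS](eq_bigl (fun p : Tg => (tag p == a) && [&& (dg (tag p) <= d)%N, is_path (w (tag p)) (tagged p) &
  path_end (w (tag p)) (tagged p) == w0])); last by move=> p; rewrite andbC.
rewrite -(sig_big_dep (fun a1 => a1 == a) (fun a (q : (d - dg a).-tuple (edge E)) =>
  [&& (dg a <= d)%N, is_path (w a) q & path_end (w a) q == w0])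
  (fun a1 q => coef (w a1) q (h a1) *: (gp K (w a1) q * lead x dg a1 i))) /=.
rewrite big_pred1_eq da; apply: eq_bigr => t _.
by rewrite scaleLl.
Qed.

Lemma count_eq : (\sum_i npath d (u i) w0 =
  \sum_a (if (dg a <= d)%N then npath (d - dg a) (w a) w0 else 0))%N.
Proof.
rewrite -card_Q -card_T; apply/eqP; rewrite eqn_leq; apply/andP; split.
  exact: free_le_card X_span X_free.
exact: free_le_card Y_span Y_free.
Qed.
End Count.

Lemma sum_shift (f : nat -> nat) D k : (k <= D)%N ->
  (\sum_(d < D.+1) (if (k <= d)%N then f (d - k) else 0) = \sum_(d < (D - k).+1) f d)%N.
Proof.
move=> kD; rewrite -(big_mkord xpredT (fun d => if (k <= d)%N then f (d - k)%N else 0%N)).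
rewrite (big_cat_nat (n := k)) ?leqW //= big_nat big1 ?add0n => [|d /andP[_ dk]]; last first.
  by rewrite leqNgt dk.
rewrite -{1}[k]add0n big_addn big_mkord subSn //; apply: eq_bigr => d _.
by rewrite leq_addl addnK.
Qed.

(** Both weights are expanded by [cut_sum], phi (u i) to depth D and phi (w a) to depth D - dg a,
    and the multiplicities of each phi w0 are compared. *)
Theorem gbasis_weight (I : finType) (w : I -> vertex E) (x : I -> J -> L) :
  gbasis w x -> \sum_a phi (w a) = \sum_i phi (u i).
Proof.
move=> /gbasis_inB[I1 [w1 [x1 [G1 <- B1]]]].
have [x2 [dg [G F irr]]] := gbasis_irr G1 B1.
have [_ G2 _ G4] := G; have [_ G1' _] := F.
have /choice[c cE] := G4.
pose c0 i0 a := c i0 a * vert K (w1 a).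
have c0E i0 i : unit_row i0 i = \sum_a c0 i0 a * x2 a i.
  by rewrite cE; apply: eq_bigr => a _; rewrite -mulrA G1'.
have c0v i0 a : c0 i0 a * vert K (w1 a) = c0 i0 a by rewrite -mulrA vertM_id.
have [D0 hD0] := @Dep_fin K E (J * I1)%type (fun p => c0 p.1 p.2).
(* Large enough for the coefficients [c0], and at least every dg a, so that D - dg a is a true
   difference. *)
pose D := maxn D0 (\max_a dg a).
have c0D i0 a : Dep D (c0 i0 a) by apply: Dep_le (hD0 (i0, a)); exact: leq_maxl.
have dgD a : (dg a <= D)%N by apply: leq_trans (leq_maxr _ _); exact: leq_bigmax.
have -> : \sum_a phi (w1 a) = \sum_a \sum_v phi v *+ cut_count (D - dg a) (w1 a) v.
  by apply: eq_bigr => a _; exact: cut_sum.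
have -> : \sum_i phi (u i) = \sum_i \sum_v phi v *+ cut_count D (u i) v.
  by apply: eq_bigr => i _; exact: cut_sum.
rewrite exchange_big [RHS]exchange_big /=; apply: eq_bigr => w0 _.
rewrite !sumrMnr; congr (_ *+ _).
have cnt d : (d == D) || sink w0 -> (\sum_i npath d (u i) w0 =
    \sum_a (if (dg a <= d)%N then npath (d - dg a) (w1 a) w0 else 0))%N.
  by move=> hd; apply: (count_eq G F irr c0E c0v c0D hd).
(* If w0 is no sink, only length D counts; at a sink the equality of counts is summed over all
   lengths up to D. *)
rewrite /cut_count; case sw : (sink w0); last first.
  by rewrite cnt ?eqxx //; apply: eq_bigr => a _; rewrite dgD.
rewrite [RHS]exchange_big /= (eq_bigr (fun d : 'I_D.+1 => (\sum_a
  (if (dg a <= d)%N then npath (d - dg a) (w1 a) w0 else 0))%N)); last first.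
  by move=> d _; rewrite cnt // sw orbT.
rewrite [RHS]exchange_big; apply: eq_bigr => a _.
by rewrite (sum_shift (fun k => npath k (w1 a) w0) (dgD a)).
Qed.
End Weight.

(** * Modules generated by an idempotent, and bases of projective modules *)

Section LeftModule.
Variables (R : pzRingType) (e : R).

(** For an idempotent e this is the left ideal R e, given by an equation so that it is a decidable
    subset and a subtype can carry the module structure. *)
Definition fixr : pred R^o := fun x => x * e == x :> R.

Lemma fixr_submod : submod_closed fixr.
Proof.
split; first by apply/eqP; rewrite mul0r.
move=> a x y /eqP hx /eqP hy; apply/eqP.
by rewrite mulrDl -mulrA hx hy.
Qed.

HB.instance Definition _ := GRing.isSubmodClosed.Build R R^o fixr fixr_submod.

Record lmod_at := LmodAt { lmod_val :> R^o; _ : lmod_val \in fixr }.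
HB.instance Definition _ := [isSub for lmod_val].
HB.instance Definition _ := [Choice of lmod_at by <:].
HB.instance Definition _ := [SubChoice_isSubLmodule of lmod_at by <:].

End LeftModule.

Section LeftModuleProj.
Variables (R : pzRingType) (e : R).
Hypothesis ee : e * e = e.
Local Notation M := (lmod_at e : lmodType R).

Definition lv (x : lmod_at e) : R := lmod_val x.

Lemma lv_inj : injective lv. Proof. exact: val_inj. Qed.
Lemma lvP (a : R) (x y : M) : lv (a *: x + y) = a * lv x + lv y.
Proof. exact: (linearP (val : M -> R^o)). Qed.
Lemma lv0 : lv 0 = 0. Proof. exact: (raddf0 (val : M -> R^o)). Qed.
Lemma lvZ (a : R) (x : M) : lv (a *: x) = a * lv x.
Proof. by rewrite -[a *: x]addr0 lvP lv0 addr0. Qed.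
Lemma lvD (x y : M) : lv (x + y) = lv x + lv y.
Proof. by rewrite -[x]scale1r lvP mul1r scale1r. Qed.
Lemma lv_sum (I : Type) (r : seq I) (P : pred I) (F : I -> M) :
  lv (\sum_(i <- r | P i) F i) = \sum_(i <- r | P i) lv (F i).
Proof. exact: (big_morph lv lvD lv0). Qed.
Lemma lv_mul (x : lmod_at e) : lv x * e = lv x.
Proof. exact/eqP/(valP x). Qed.

Lemma lmod_proj_subproof x : (x * e : R^o) \in fixr e.
Proof. by apply/eqP; rewrite -mulrA ee. Qed.
Definition lmod_proj (x : R^o) : lmod_at e := LmodAt (lmod_proj_subproof x).

Lemma lv_proj x : lv (lmod_proj x) = x * e.
Proof. by []. Qed.

Lemma lmod_proj_linear : linear (lmod_proj : R^o -> M).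
Proof.
by move=> a x y; apply: lv_inj; rewrite lvP !lv_proj mulrDl mulrA.
Qed.

Lemma lvK (x : lmod_at e) : lmod_proj (lv x) = x.
Proof. by apply: lv_inj; rewrite lv_proj lv_mul. Qed.

Lemma lv_linear : linear (lv : M -> R^o).
Proof. by move=> a x y; rewrite lvP. Qed.

Lemma fg_lmod_at : finitely_generated M.
Proof.
exists 1%N, (fun=> lmod_proj e) => m; exists (fun=> lv m).
rewrite big_ord_recl big_ord0 addr0; apply: lv_inj.
by rewrite lvZ lv_proj ee lv_mul.
Qed.

Lemma projective_lmod_at : projective M.
Proof.
move=> M1 N g f gs.
pose pr : {linear R^o -> M} := HB.pack (lmod_proj : R^o -> M)
  (GRing.isLinear.Build R R^o M _ _ lmod_proj_linear).
pose inc : {linear M -> R^o} := HB.pack (lv : M -> R^o)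
  (GRing.isLinear.Build R M R^o _ _ lv_linear).
have [h hE] := @projective_regular R M1 N g (f \o pr : {linear R^o -> N}) gs.
exists (h \o inc : {linear M -> M1}) => p /=.
by rewrite hE /= lvK.
Qed.

Definition fgproj_at : fgproj R := FGProj fg_lmod_at projective_lmod_at.
End LeftModuleProj.

Section ModuleBasis.
Variables (K : fieldType) (E : graph).
Local Notation L := (LPA K E).

(** An isomorphism of P with the direct sum of the modules L (w a), given by the images x a of the
    vertices. *)
Definition mbasis (P : lmodType L) (I : finType) (w : I -> vertex E) (x : I -> P) : Prop :=
  [/\ forall a, vert K (w a) *: x a = x a,
      forall p, exists y : I -> L, p = \sum_a y a *: x a &
      forall y : I -> L, (forall a, y a * vert K (w a) = y a) ->
        \sum_a y a *: x a = 0 -> forall a, y a = 0].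

Lemma mbasis_coord (P : lmodType L) (I : finType) (w : I -> vertex E) (x : I -> P) :
  mbasis w x -> forall p, exists y : I -> L,
    p = \sum_a y a *: x a /\ forall a, y a * vert K (w a) = y a.
Proof.
case=> h1 h2 _ p; have [y ->] := h2 p; exists (fun a => y a * vert K (w a)); split.
  by apply: eq_bigr => a _; rewrite -scalerA h1.
by move=> a; rewrite -mulrA vertM_id.
Qed.

Lemma mbasis_unique (P : lmodType L) (I : finType) (w : I -> vertex E) (x : I -> P)
  (y z : I -> L) : mbasis w x -> (forall a, y a * vert K (w a) = y a) ->
  (forall a, z a * vert K (w a) = z a) ->
  \sum_a y a *: x a = \sum_a z a *: x a -> forall a, y a = z a.
Proof.
move=> [_ _ h] hy hz e a; apply/eqP; rewrite -subr_eq0; apply/eqP.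
apply: (h (fun a => y a - z a)) => [b|]; first by rewrite mulrBl hy hz.
under eq_bigr do rewrite scalerBl.
by rewrite sumrB e subrr.
Qed.

(** A section h of a surjection g from L^n embeds P into a free module; [span_basis] is applied to
    the images of the generators, and the basis found is pulled back to P. *)
Lemma fgproj_basis (P : fgproj L) :
  exists (I : finType) (w : I -> vertex E) (x : I -> P), mbasis w x.
Proof.
have [n [x xP]] := @fgproj_fg _ P.
have lin : linear (fun r : 'rV[L]_n => \sum_i r 0 i *: x i : P).
  move=> a r s; rewrite scaler_sumr -big_split; apply: eq_bigr => i _ /=.
  by rewrite !mxE scalerDl scalerA.
pose g : {linear 'rV[L]_n -> P} := HB.pack (fun r : 'rV[L]_n => \sum_i r 0 i *: x i : P)
  (GRing.isLinear.Build L 'rV[L]_n P _ _ lin).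
have gs p : exists r, g r = p.
  have [a ->] := xP p; exists (\row_i a i) => /=.
  by apply: eq_bigr => i _; rewrite mxE.
have [h hg] := @fgproj_proj _ P _ _ g idfun gs.
have hinj : injective h by apply: (can_inj (g := g)).
have [I [w [z [z1 z2 z3 z4]]]] := span_basis (fun i j => h (x i) 0 j).
have /choice[c cE] := z3.
pose x' a := \sum_i c a i *: x i.
have hx' a j : h (x' a) 0 j = z a j.
  rewrite cE /x' linear_sum summxE; apply: eq_bigr => i _.
  by rewrite linearZ mxE.
have hs (y : I -> L) j : h (\sum_a y a *: x' a) 0 j = \sum_a y a * z a j.
  rewrite linear_sum summxE; apply: eq_bigr => a _.
  by rewrite linearZ mxE hx'.
exists I, w, x'; split=> [a|p|y yw hy].
- by apply: hinj; apply/rowP => j; rewrite linearZ mxE hx' z1.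
- have [d ->] := xP p; have /choice[f fE] := z2.
  exists (fun a => \sum_i d i * f i a); apply: hinj; apply/rowP => j; rewrite hs.
  rewrite linear_sum summxE.
  under [RHS]eq_bigr do rewrite mulr_suml.
  rewrite exchange_big; apply: eq_bigr => i _; rewrite linearZ mxE fE mulr_sumr.
  by apply: eq_bigr => a _; rewrite mulrA.
- by apply: z4 => // j; rewrite -hs hy raddf0 mxE.
Qed.

Section WeightMod.
Variables (A : zmodType) (phi : vertex E -> A).
Hypothesis phiE : forall v, ~~ sink v -> phi v = \sum_(e | src e == v) phi (rng e).

(** The coordinates of one basis with respect to the other form a [gbasis], to which [gbasis_weight]
    applies. *)
Lemma mbasis_weight (P : lmodType L) (I J : finType) (w : I -> vertex E) (x : I -> P)
  (u : J -> vertex E) (n : J -> P) : mbasis w x -> mbasis u n ->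
  \sum_a phi (w a) = \sum_i phi (u i).
Proof.
move=> bx bn; have /choice[C CE] := fun a => mbasis_coord bn (x a).
have C1 a : x a = \sum_i C a i *: n i by case: (CE a).
have C2 a i : C a i * vert K (u i) = C a i by case: (CE a) => _; apply.
have sC (y : I -> L) : \sum_a y a *: x a = \sum_i (\sum_a y a * C a i) *: n i.
  under eq_bigr do rewrite C1 scaler_sumr.
  rewrite exchange_big; apply: eq_bigr => i _; rewrite scaler_suml.
  by apply: eq_bigr => a _; rewrite scalerA.
have [x1 x2 x3] := bx; have [n1 n2 n3] := bn.
apply: (gbasis_weight phiE (u := u) (x := C)); split=> //.
- move=> a; apply: (mbasis_unique bn) => [i|i|]; rewrite -?mulrA ?C2 //.
  transitivity (vert K (w a) *: x a); last by rewrite x1 C1.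
  by rewrite C1 scaler_sumr; apply: eq_bigr => i _; rewrite scalerA.
- move=> y yw hy; apply: x3 => //; rewrite sC big1 // => i _.
  by rewrite hy scale0r.
- move=> i0; have [d dE] := x2 (n i0); exists d.
  apply: (mbasis_unique bn) => [i|i|].
  + by rewrite /unit_row; case: eqP => [->|_]; rewrite ?vertM_id ?mul0r.
  + by rewrite mulr_suml; apply: eq_bigr => a _; rewrite -mulrA C2.
  rewrite -sC -dE (bigD1 i0) //= /unit_row eqxx n1 big1 ?addr0 // => i /negPf ->.
  by rewrite scale0r.
Qed.
End WeightMod.
End ModuleBasis.

(** * Grothendieck groups *)

Section ModIso.
Variable R : pzRingType.
Implicit Types M N P Q : lmodType R.

Lemma mod_iso_intro M N (f : M -> N) : linear f -> bijective f -> mod_iso M N.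
Proof.
move=> lf bf.
pose g : {linear M -> N} := HB.pack f (GRing.isLinear.Build R M N _ _ lf).
by exists g.
Qed.

Lemma mod_iso_refl M : mod_iso M M.
Proof. by exists idfun; exists id. Qed.

Lemma mod_iso_trans M N P : mod_iso M N -> mod_iso N P -> mod_iso M P.
Proof.
move=> [f bf] [g bg]; exists (g \o f : {linear M -> P}).
exact: bij_comp.
Qed.

Lemma mod_iso_sym M N : mod_iso M N -> mod_iso N M.
Proof.
move=> [f [g fK gK]]; apply: (@mod_iso_intro _ _ g); last by exists f.
by move=> a x y; apply: (can_inj fK); rewrite linearP !gK.
Qed.

Lemma mod_iso_prod M N P Q : mod_iso M P -> mod_iso N Q -> mod_iso (M * N)%type (P * Q)%type.
Proof.
move=> [f [f' fK f'K]] [g [g' gK g'K]].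
apply: (@mod_iso_intro _ _ (fun x : M * N => (f x.1, g x.2))).
  by move=> a [x y] [z t]; rewrite /= !linearP.
by exists (fun x : P * Q => (f' x.1, g' x.2)) => -[x y] /=; rewrite ?fK ?gK ?f'K ?g'K.
Qed.

Lemma mod_iso_swap M N : mod_iso (M * N)%type (N * M)%type.
Proof.
apply: (@mod_iso_intro _ _ (fun x : M * N => (x.2, x.1))); first by move=> a [x y] [z t].
by exists (fun x : N * M => (x.2, x.1)) => -[].
Qed.

Lemma mod_iso_assoc M N P : mod_iso (M * (N * P))%type ((M * N) * P)%type.
Proof.
apply: (@mod_iso_intro _ _ (fun x : M * (N * P) => ((x.1, x.2.1), x.2.2))).
  by move=> a [x [y z]] [x' [y' z']].
by exists (fun x : (M * N) * P => (x.1.1, (x.1.2, x.2))) => [[x [y z]]|[[x y] z]].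
Qed.

Lemma mod_iso_zerol M : mod_iso ('rV[R]_0 * M)%type M.
Proof.
apply: (@mod_iso_intro _ _ (fun x : 'rV[R]_0 * M => x.2)); first by move=> a [x y] [z t].
exists (fun y => (0, y)) => [[x y]|] //=.
by congr pair; apply/rowP => -[].
Qed.

Definition msum (s : seq (fgproj R)) : fgproj R :=
  foldr (@fgproj_sum R) (fgproj_zero R) s.

Lemma msum_cat s t : mod_iso (msum (s ++ t)) (fgproj_sum (msum s) (msum t)).
Proof.
elim: s => [|P s IH] /=; first by apply: mod_iso_sym; exact: mod_iso_zerol.
apply: mod_iso_trans (mod_iso_assoc _ _ _).
by apply: mod_iso_prod => //; exact: mod_iso_refl.
Qed.

Lemma msum_perm (env : nat -> fgproj R) s t : perm_eq s t ->
  mod_iso (msum (map env s)) (msum (map env t)).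
Proof.
move=> st.
apply: (catCA_perm_ind (P := fun t => mod_iso (msum (map env s)) (msum (map env t))) _ st).
  move=> s1 s2 s3 /mod_iso_trans; apply.
  rewrite !map_cat; apply: mod_iso_trans (msum_cat _ _) _.
  apply: mod_iso_trans (mod_iso_prod (mod_iso_refl _) (msum_cat _ _)) _.
  apply: mod_iso_trans (mod_iso_assoc _ _ _) _.
  apply: mod_iso_sym; apply: mod_iso_trans (msum_cat _ _) _.
  apply: mod_iso_trans (mod_iso_prod (mod_iso_refl _) (msum_cat _ _)) _.
  apply: mod_iso_trans (mod_iso_assoc _ _ _) _.
  by apply: mod_iso_prod; [exact: mod_iso_swap|exact: mod_iso_refl].
exact: mod_iso_refl.
Qed.

(** Reflection for direct sums: rearranging summands and dropping zeros reduces to a permutation of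
    lists of numbers, which is decided by evaluation. *)
Inductive sum_tree := Leaf of nat | Zero | Node of sum_tree & sum_tree.

Fixpoint tree_eval (env : nat -> fgproj R) (t : sum_tree) : fgproj R :=
  match t with
  | Leaf n => env n
  | Zero => fgproj_zero R
  | Node t u => fgproj_sum (tree_eval env t) (tree_eval env u)
  end.

Fixpoint tree_leaves (t : sum_tree) : seq nat :=
  match t with
  | Leaf n => [:: n]
  | Zero => [::]
  | Node t u => tree_leaves t ++ tree_leaves u
  end.

Lemma tree_msum env t : mod_iso (tree_eval env t) (msum (map env (tree_leaves t))).
Proof.
elim: t => [n||t IHt u IHu] /=.
- apply: mod_iso_sym; apply: mod_iso_trans (mod_iso_swap _ _) _.
  exact: mod_iso_zerol.
- exact: mod_iso_refl.
rewrite map_cat; apply: mod_iso_trans (mod_iso_sym (msum_cat _ _)).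
exact: mod_iso_prod.
Qed.

Lemma tree_iso (env : seq (fgproj R)) t u : perm_eq (tree_leaves t) (tree_leaves u) ->
  mod_iso (tree_eval (nth (fgproj_zero R) env) t) (tree_eval (nth (fgproj_zero R) env) u).
Proof.
move=> tu; apply: mod_iso_trans (tree_msum _ _) _.
apply: mod_iso_trans (msum_perm _ tu) _.
exact/mod_iso_sym/tree_msum.
Qed.

Implicit Types x y z : K0 R.

Lemma K0_eq_sym x y : K0_eq x y -> K0_eq y x.
Proof. by case=> T h; exists T; apply: mod_iso_sym. Qed.

Notation "a + b" := (Node a b).
Notation "# n" := (Leaf n) (at level 5).

Lemma K0_eq_trans y x z : K0_eq x y -> K0_eq y z -> K0_eq x z.
Proof.
case: x y z => [x1 x2] [y1 y2] [z1 z2] [T h] [S k] /=; rewrite /= in h k.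
(* In the sum of the two given isomorphisms y1, y2, T and S occur on both sides; together they are
   the stabilizing module. *)
exists (fgproj_sum (fgproj_sum y1 y2) (fgproj_sum T S)) => /=.
have hk := mod_iso_prod h k.
have a := @tree_iso [:: x1; x2; y1; y2; z1; z2; T; S]
  ((#0 + #5) + ((#2 + #3) + (#6 + #7))) (((#0 + #3) + #6) + ((#2 + #5) + #7)) isT.
have b := @tree_iso [:: x1; x2; y1; y2; z1; z2; T; S]
  (((#2 + #1) + #6) + ((#4 + #3) + #7)) ((#4 + #1) + ((#2 + #3) + (#6 + #7))) isT.
exact: mod_iso_trans a (mod_iso_trans hk b).
Qed.

Lemma K0_eq_iso P Q (fP : finitely_generated P) (pP : projective P)
  (fQ : finitely_generated Q) (pQ : projective Q) : mod_iso P Q ->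
  K0_eq (FGProj fP pP, fgproj_zero R) (FGProj fQ pQ, fgproj_zero R).
Proof.
move=> h; exists (fgproj_zero R) => /=.
by apply: mod_iso_prod (mod_iso_refl _); apply: mod_iso_prod (mod_iso_refl _).
Qed.

Lemma K0_add_sum (P Q : fgproj R) :
  K0_eq (fgproj_sum P Q, fgproj_zero R)
        (K0_add (P, fgproj_zero R) (Q, fgproj_zero R)).
Proof.
exists (fgproj_zero R).
exact: (@tree_iso [:: P; Q] (((#0 + #1) + (Zero + Zero)) + Zero) (((#0 + #1) + Zero) + Zero) isT).
Qed.

Lemma K0_diff (P Q : fgproj R) :
  K0_eq (K0_add (P, Q) (Q, fgproj_zero R)) (P, fgproj_zero R).
Proof.
exists (fgproj_zero R).
exact: (@tree_iso [:: P; Q] (((#0 + #1) + Zero) + Zero) ((#0 + (#1 + Zero)) + Zero) isT).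
Qed.

Lemma K0_add_congr x x' y y' : K0_eq x x' -> K0_eq y y' ->
  K0_eq (K0_add x y) (K0_add x' y').
Proof.
case: x x' y y' => [x1 x2] [x1' x2'] [y1 y2] [y1' y2'] [T h] [S k]; rewrite /= in h k.
exists (fgproj_sum T S) => /=.
have hk := mod_iso_prod h k.
have a := @tree_iso [:: x1; x2; x1'; x2'; y1; y2; y1'; y2'; T; S]
  (((#0 + #4) + (#3 + #7)) + (#8 + #9)) (((#0 + #3) + #8) + ((#4 + #7) + #9)) isT.
have b := @tree_iso [:: x1; x2; x1'; x2'; y1; y2; y1'; y2'; T; S]
  (((#2 + #1) + #8) + ((#6 + #5) + #9)) (((#2 + #6) + (#1 + #5)) + (#8 + #9)) isT.
exact: mod_iso_trans a (mod_iso_trans hk b).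
Qed.

Definition khom (A : zmodType) (chi : fgproj R -> A) : Prop :=
  (forall P Q : fgproj R, mod_iso P Q -> chi P = chi Q) /\
  (forall P Q : fgproj R, chi (fgproj_sum P Q) = (chi P + chi Q)%R).

Lemma khom_zero (A : zmodType) (chi : fgproj R -> A) : khom chi -> chi (fgproj_zero R) = 0%R.
Proof.
case=> h1 h2; have := h2 (fgproj_zero R) (fgproj_zero R).
rewrite (h1 (fgproj_sum (fgproj_zero R) (fgproj_zero R)) (fgproj_zero R)); last exact: mod_iso_zerol.
by move=> /esym/eqP; rewrite -subr_eq0 addrK => /eqP.
Qed.

Definition kdiff (A : zmodType) (chi : fgproj R -> A) (x : K0 R) : A := (chi x.1 - chi x.2)%R.

Lemma kdiff_eq (A : zmodType) (chi : fgproj R -> A) x y : khom chi -> K0_eq x y ->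
  kdiff chi x = kdiff chi y.
Proof.
case=> h1 h2 [T /(h1 (fgproj_sum (fgproj_sum x.1 y.2) T) (fgproj_sum (fgproj_sum y.1 x.2) T))].
rewrite !h2 => /addIr e; rewrite /kdiff.
by apply/eqP; rewrite subr_eq addrAC eq_sym subr_eq e.
Qed.

Lemma kdiff_add (A : zmodType) (chi : fgproj R -> A) x y : khom chi ->
  kdiff chi (K0_add x y) = (kdiff chi x + kdiff chi y)%R.
Proof. by case=> h1 h2; rewrite /kdiff /= !h2 opprD addrACA. Qed.

Lemma kdiff_pos (A : zmodType) (chi : fgproj R -> A) (P : fgproj R) : khom chi ->
  kdiff chi (P, fgproj_zero R) = chi P.
Proof. by move=> h; rewrite /kdiff /= (khom_zero h) subr0. Qed.

End ModIso.

Lemma K0_pointed_iso_sym (R S : pzRingType) : K0_pointed_iso R S -> K0_pointed_iso S R.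
Proof.
case=> f [f1 f2 f3 f4].
have /choice[g gE] := f2.
exists g; split=> [x y|z|x y|].
- split=> h.
    apply/f1; apply: (K0_eq_trans (y := x)) (gE x) _.
    exact: (K0_eq_trans (y := y)) h (K0_eq_sym (gE y)).
  apply: (K0_eq_trans (y := f (g x))); first exact: K0_eq_sym (gE x).
  by apply: (K0_eq_trans (y := f (g y))) (gE y); apply/f1.
- by exists (f z); apply/f1; exact: gE.
- apply/f1; apply: (K0_eq_trans (y := K0_add x y)) (gE _) _.
  apply: K0_eq_sym; apply: (K0_eq_trans (y := K0_add (f (g x)) (f (g y)))); first exact: f3.
  by apply: K0_add_congr; exact: gE.
- by apply/f1; apply: (K0_eq_trans (y := K0_one S)) (gE _) (K0_eq_sym f4).
Qed.

(** * Additive functions on projective modules and harmonic functions on vertices *)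

Section KhomLPA.
Variables (K : fieldType) (E : graph) (A : zmodType).
Local Notation L := (LPA K E).

Definition Lvert (v : vertex E) : fgproj L := fgproj_at (vertM_id K v).

Section Coord.
Variables (I : finType) (w : I -> vertex E).

(** An iterated binary sum, so that additive functions can be evaluated on it. The map [crd] reads
    off the first occurrence of an index and determines the element if s has no repetitions. *)
Definition Mod (s : seq I) : fgproj L :=
  foldr (fun a M => fgproj_sum (Lvert (w a)) M) (fgproj_zero L) s.

Fixpoint crd (s : seq I) : Mod s -> I -> L :=
  match s return Mod s -> I -> L with
  | [::] => fun _ _ => 0
  | a :: s' => fun m b => if b == a then lv m.1 else crd m.2 b
  end.

Lemma crd_lin s (k : L) (m m' : Mod s) b : crd (k *: m + m') b = k * crd m b + crd m' b.
Proof.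
elim: s m m' => [|a s IH] m m' /=; first by rewrite mulr0 addr0.
by case: eqP => _; [exact: lvP|exact: IH].
Qed.

Lemma crd_vert s (m : Mod s) b : crd m b * vert K (w b) = crd m b.
Proof.
elim: s m => [|a s IH] m /=; first by rewrite mul0r.
by case: eqP => [->|_]; [exact: lv_mul|exact: IH].
Qed.

Lemma crd_supp s (m : Mod s) b : b \notin s -> crd m b = 0.
Proof.
elim: s m => [|a s IH] m //=; rewrite inE negb_or => /andP[/negPf -> h].
exact: IH.
Qed.

Lemma crd_inj s (m : Mod s) : uniq s -> (forall b, crd m b = 0) -> m = 0.
Proof.
elim: s m => [|a s IH] m /=; first by move=> _ _; apply/rowP => -[].
case: m => l m /andP[na us] h; congr pair.
  by apply: lv_inj; rewrite lv0; have := h a; rewrite /= eqxx.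
apply: IH => // b; case: (eqVneq b a) => [->|ne]; first exact: crd_supp.
by have := h b; rewrite /= (negPf ne).
Qed.

Lemma crd_surj s (y : I -> L) : uniq s -> (forall b, y b * vert K (w b) = y b) ->
  exists m : Mod s, forall b, crd m b = if b \in s then y b else 0.
Proof.
move=> us yw; elim: s us => [|a s IH] /=; first by move=> _; exists 0.
case/andP=> na /IH[m mE].
exists (lmod_proj (vertM_id K (w a)) (y a), m) => b /=; rewrite inE.
by case: eqP => [->|_] //=; rewrite lv_proj yw.
Qed.
End Coord.

Lemma mbasis_Mod (P : lmodType L) (I : finType) (w : I -> vertex E) (x : I -> P) :
  mbasis w x -> mod_iso (Mod w (enum I)) P.
Proof.
move=> b; have [b1 b2 b3] := b.
pose F (m : Mod w (enum I)) : P := \sum_a crd m a *: x a.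
have Flin : linear F.
  move=> k m m'; rewrite /F scaler_sumr -big_split; apply: eq_bigr => a _ /=.
  by rewrite crd_lin scalerDl scalerA.
pose G : {linear Mod w (enum I) -> P} := HB.pack F
  (GRing.isLinear.Build L (Mod w (enum I)) P _ _ Flin).
have Ginj : injective G.
  move=> m m' e; apply/eqP; rewrite -subr_eq0; apply/eqP.
  apply: crd_inj; first exact: enum_uniq.
  apply: b3 => [a|]; first exact: crd_vert.
  by rewrite -[LHS]/(G (m - m')) raddfB /= -[X in X - _]/(G m) e subrr.
have Gsurj p : exists m, G m = p.
  have [y [-> yw]] := mbasis_coord b p.
  have [m mE] := crd_surj (enum_uniq I) yw; exists m; rewrite /= /F.
  by apply: eq_bigr => a _; rewrite mE mem_enum.
exists G; have /choice[g gE] := Gsurj; exists g => // m.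
by apply: Ginj; rewrite gE.
Qed.

Lemma khom_basis (chi : fgproj L -> A) (P : fgproj L) (I : finType)
  (w : I -> vertex E) (x : I -> P) : khom chi -> mbasis w x ->
  chi P = \sum_a chi (Lvert (w a)).
Proof.
move=> hc /mbasis_Mod/mod_iso_sym h; have [c1 c2] := hc; rewrite (c1 _ _ h).
rewrite -[RHS]big_enum; elim: (enum I) => [|a s IH] /=.
  by rewrite big_nil khom_zero.
by rewrite big_cons c2 IH.
Qed.

Lemma mbasis_regular : mbasis (P := L^o) (fun v => v) (fun v => vert K v : L^o).
Proof.
split=> [v|p|y yw hy v]; first exact: vertM_id.
  exists (fun=> p); rewrite -[LHS]mulr1 LPA1 mulr_sumr.
  by apply: eq_bigr.
have := congr1 (fun z : L => z * vert K v) hy; rewrite mul0r mulr_suml (bigD1 v) //=.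
rewrite big1 ?addr0 => [|u uv]; last first.
  by rewrite -[_ * _]mulrA vertM (negPf uv) mulr0.
by rewrite -[_ * _]mulrA vertM_id yw.
Qed.

Lemma mbasis_Lvert v : mbasis (P := Lvert v) (fun _ : 'I_1 => v)
  (fun _ => lmod_proj (vertM_id K v) (vert K v)).
Proof.
split=> [_|p|y yw hy a].
- by apply: lv_inj; rewrite lvZ lv_proj !vertM_id.
- exists (fun=> lv p); apply: lv_inj; rewrite big_ord1 lvZ lv_proj vertM_id.
  by rewrite lv_mul.
have := congr1 (@lv _ _) hy; rewrite big_ord1 lvZ lv_proj vertM_id lv0 yw.
by rewrite [a]ord1.
Qed.

(** By CK1 and CK2 the ghosts of the edges leaving v form a second basis of L v besides v itself;
    comparing the two makes every additive function harmonic. *)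
Lemma mbasis_Lvert_out v : ~~ sink v ->
  mbasis (P := Lvert v) (fun e : {e : edge E | src e == v} => rng (val e))
  (fun e => lmod_proj (vertM_id K v) (ghost K (val e))).
Proof.
move=> nsv; have gv (e : {e : edge E | src e == v}) :
    ghost K (val e) * vert K v = ghost K (val e).
  by case: e => e /= /eqP <-; rewrite ghost_vert.
split=> [e|p|y yw hy e].
- by apply: lv_inj; rewrite lvZ lv_proj !gv vert_ghost.
- exists (fun e => lv p * edg K (val e)); apply: lv_inj; rewrite lv_sum.
  under eq_bigr do rewrite lvZ lv_proj gv -mulrA.
  rewrite (big_sig (fun e => src e == v) xpredT (fun e => lv p * (edg K e * ghost K e))).
  transitivity (lv p * \sum_(e | src e == v) edg K e * ghost K e).
    by rewrite -CK2 ?lv_mul //; exact/sinkPn.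
  by rewrite mulr_sumr; apply: eq_bigl => e; rewrite andbT.
have := congr1 (fun z => lv z * edg K (val e)) hy; rewrite lv0 mul0r lv_sum mulr_suml.
rewrite (bigD1 e) // lvZ lv_proj gv -mulrA ghost_edg_id yw big1.
  by rewrite /= addr0.
move=> f fe; rewrite lvZ lv_proj gv -mulrA ghost_edg.
case: eqP => [h|]; last by rewrite mulr0.
by case/eqP: fe; apply: val_inj.
Qed.

Definition harmonic (phi : vertex E -> A) : Prop :=
  forall v, ~~ sink v -> phi v = \sum_(e | src e == v) phi (rng e).

Lemma khom_harmonic (chi : fgproj L -> A) : khom chi -> harmonic (fun v => chi (Lvert v)).
Proof.
move=> hc v nsv; rewrite (khom_basis hc (mbasis_Lvert_out nsv)).
rewrite (big_sig (fun e => src e == v) xpredT (fun e => chi (Lvert (rng e)))).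
by apply: eq_bigl => e; rewrite andbT.
Qed.

(** The converse of [khom_harmonic]. The value at P is the weight of any basis of P, well defined by
    [mbasis_weight]; additivity holds because bases of P and Q join to one of the sum. *)
Lemma weight_ex (phi : vertex E -> A) : harmonic phi ->
  exists chi : fgproj L -> A, khom chi /\
   forall (P : fgproj L) (I : finType) (w : I -> vertex E) (x : I -> P),
     mbasis w x -> chi P = \sum_a phi (w a).
Proof.
move=> hp.
have /choice[chi chiE] : forall P : fgproj L, exists a,
    forall (I : finType) (w : I -> vertex E) (x : I -> P),
     mbasis w x -> a = \sum_a phi (w a).
  move=> P; have [I [w [x b]]] := fgproj_basis P; exists (\sum_a phi (w a)) => J u n bn.
  exact: mbasis_weight hp _ _ _ _ _ _ _ b bn.
exists chi; split=> //; split=> [P Q [f [g fK gK]]|P Q].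
  have [I [w [x b]]] := fgproj_basis P; rewrite (chiE P _ _ _ b).
  have [b1 b2 b3] := b; rewrite (chiE Q I w (fun a => f (x a))) //.
  split=> [a|p|y yw hy].
  - by rewrite -linearZ b1.
  - have [y yE] := b2 (g p); exists y; rewrite -[LHS]gK yE linear_sum.
    by apply: eq_bigr => a _; rewrite linearZ.
  apply: b3 => //; apply: (can_inj fK); rewrite raddf0 linear_sum -[RHS]hy.
  by apply: eq_bigr => a _; rewrite linearZ.
have [I [w [x b]]] := fgproj_basis P; rewrite (chiE P _ _ _ b).
have [J [u [n c]]] := fgproj_basis Q; rewrite (chiE Q _ _ _ c).
have [b1 b2 b3] := b; have [c1 c2 c3] := c.
pose wu (k : I + J) := match k with inl a => w a | inr i => u i end.
pose xn (k : I + J) : (P * Q)%type := match k with inl a => (x a, 0) | inr i => (0, n i) end.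
have s (y : I + J -> L) : \sum_k y k *: xn k =
    (\sum_a y (inl a) *: x a, \sum_i y (inr i) *: n i).
  rewrite big_sumType /=; apply: injective_projections; rewrite /= !raddf_sum /=.
    by rewrite [X in _ + X]big1 ?addr0 // => i _; rewrite scaler0.
  by rewrite [X in X + _]big1 ?add0r // => i _; rewrite scaler0.
rewrite (chiE (fgproj_sum P Q) _ wu xn) ?big_sumType //.
split=> [[a|i]|[p q]|y yw hy].
- by rewrite /= -{2}b1; congr pair; rewrite scaler0.
- by rewrite /= -{2}c1; congr pair; rewrite scaler0.
- have [y ->] := b2 p; have [z ->] := c2 q.
  by exists (fun k => match k with inl a => y a | inr i => z i end); rewrite s.
move: hy; rewrite s => -[h1 h2] [a|i].
  by apply: (b3 (fun a => y (inl a))) => // c'; exact: (yw (inl c')).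
by apply: (c3 (fun a => y (inr a))) => // c'; exact: (yw (inr c')).
Qed.
End KhomLPA.

(** * Restriction of scalars, and transport of K_0 along a ring isomorphism *)

Section Restr.
Variables (R S : pzRingType) (g : {rmorphism S -> R}).

(** A copy of the carrier, on which scalars from S can be declared without a clash with the scalars
    from R. *)
Definition restr (P : lmodType R) : Type := P.
HB.instance Definition _ (P : lmodType R) := GRing.Zmodule.on (restr P).

Section Inst.
Variable P : lmodType R.
Definition restr_scale (s : S) (p : restr P) : restr P := g s *: (p : P).
Lemma restr_scaleA a b v : restr_scale a (restr_scale b v) = restr_scale (a * b) v.
Proof. by rewrite /restr_scale scalerA rmorphM. Qed.
Lemma restr_scale1 : left_id 1 restr_scale.
Proof. by move=> v; rewrite /restr_scale rmorph1 scale1r. Qed.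
Lemma restr_scaleDr : right_distributive restr_scale +%R.
Proof. by move=> a u v; rewrite /restr_scale; exact: scalerDr. Qed.
Lemma restr_scaleDl v : {morph restr_scale^~ v : a b / a + b}.
Proof. by move=> a b; rewrite /restr_scale rmorphD; exact: scalerDl. Qed.
HB.instance Definition _ := GRing.Zmodule_isLmodule.Build S (restr P)
  restr_scaleA restr_scale1 restr_scaleDr restr_scaleDl.
End Inst.

Definition restr_mod (P : lmodType R) : lmodType S := (restr P : lmodType S).

Lemma restrZ (P : lmodType R) (s : S) (p : restr_mod P) : s *: p = g s *: (p : P) :> P.
Proof. by []. Qed.

Lemma linear_restr (M N : lmodType R) (f : {linear M -> N}) :
  linear (f : restr_mod M -> restr_mod N).
Proof. by move=> a x y; rewrite (linearP f (g a)). Qed.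

End Restr.

Section Transport.
Variables (R S : pzRingType) (g : {rmorphism S -> R}) (h : {rmorphism R -> S}).
Hypothesis gK : cancel g h.
Hypothesis hK : cancel h g.

Lemma restr_fg (P : lmodType R) : finitely_generated P -> finitely_generated (restr_mod g P).
Proof.
case=> n [x xP]; exists n, x => m; have [a aE] := xP m.
exists (fun i => h (a i)); rewrite [LHS]aE; apply: eq_bigr => i _.
by rewrite restrZ hK.
Qed.

(** A lifting problem over S is restricted along h to one over R, solved there, and read back over
    S. *)
Lemma restr_projective (P : lmodType R) : projective P -> projective (restr_mod g P).
Proof.
move=> pP M N q f qs.
have flin : linear (f : P -> restr_mod h N).
  move=> a x y; rewrite -{1}(hK a).
  by rewrite -[LHS]/(f (h a *: (x : restr_mod g P) + y)) linearP.
pose f' : {linear P -> restr_mod h N} := HB.pack (f : P -> restr_mod h N)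
  (GRing.isLinear.Build R P (restr_mod h N) _ _ flin).
pose q' : {linear restr_mod h M -> restr_mod h N} :=
  HB.pack (q : restr_mod h M -> restr_mod h N)
  (GRing.isLinear.Build R (restr_mod h M) (restr_mod h N) _ _ (@linear_restr _ _ h M N q)).
have [l lE] := pP (restr_mod h M) (restr_mod h N) q' f' qs.
have llin : linear (l : restr_mod g P -> M).
  move=> a x y; rewrite -[LHS]/(l (g a *: (x : P) + y)) linearP.
  by rewrite restrZ gK.
pose l' : {linear restr_mod g P -> M} := HB.pack (l : restr_mod g P -> M)
  (GRing.isLinear.Build S (restr_mod g P) M _ _ llin).
by exists l'.
Qed.

Definition restr_fgproj (P : fgproj R) : fgproj S :=
  FGProj (restr_fg (@fgproj_fg _ P)) (restr_projective (@fgproj_proj _ P)).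

Lemma restr_iso (M N : lmodType R) : mod_iso M N -> mod_iso (restr_mod g M) (restr_mod g N).
Proof. by case=> f bf; apply: (mod_iso_intro (@linear_restr _ _ g M N f)). Qed.

Lemma restr_sum (M N : lmodType R) :
  mod_iso (restr_mod g (M * N)%type) (restr_mod g M * restr_mod g N)%type.
Proof.
apply: (@mod_iso_intro S (restr_mod g (M * N)%type)
  (restr_mod g M * restr_mod g N)%type (fun x => x)); last by exists id.
by move=> a [x y] [z t].
Qed.

Lemma restrK (M : lmodType S) : mod_iso (restr_mod g (restr_mod h M)) M.
Proof.
apply: (@mod_iso_intro S (restr_mod g (restr_mod h M)) M (fun x => x)); last by exists id.
move=> a x y; rewrite -[LHS]/(h (g a) *: (x : M) + y); by rewrite gK.
Qed.

Lemma restr_zero : mod_iso (restr_mod g 'rV[R]_0) 'rV[S]_0.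
Proof.
apply: (@mod_iso_intro S (restr_mod g 'rV[R]_0) 'rV[S]_0 (fun _ => 0)); first by move=> a x y; rewrite scaler0 addr0.
by exists (fun _ => 0) => x; apply/rowP => -[].
Qed.

Lemma restr_regular : mod_iso (restr_mod g R^o) S^o.
Proof.
apply: (@mod_iso_intro S (restr_mod g R^o) S^o h); last by exists g.
by move=> a x y; rewrite -[LHS]/(h (g a * (x : R) + y)) rmorphD rmorphM gK.
Qed.
End Transport.

Lemma ring_iso_K0 (R S : pzRingType) : ring_iso R S -> K0_pointed_iso R S.
Proof.
case=> f [g0 fK gK].
have gB : zmod_morphism g0 by move=> x y; apply: (can_inj fK); rewrite gK rmorphB !gK.
have gM : monoid_morphism g0.
  split; first by apply: (can_inj fK); rewrite gK rmorph1.
  by move=> x y; apply: (can_inj fK); rewrite gK rmorphM !gK.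
pose g : {rmorphism S -> R} := HB.pack g0 (GRing.isZmodMorphism.Build S R g0 gB)
  (GRing.isMonoidMorphism.Build S R g0 gM).
have gK' : cancel g f := gK.
have fK' : cancel f g := fK.
pose r P := restr_fgproj gK' fK' P.
pose r' P := restr_fgproj fK' gK' P.
have rsum P Q : mod_iso (r (fgproj_sum P Q)) (fgproj_sum (r P) (r Q)) by exact: restr_sum.
have rK Q : mod_iso (r (r' Q)) Q by exact: restrK.
have r'sum P Q : mod_iso (r' (fgproj_sum P Q)) (fgproj_sum (r' P) (r' Q)) by exact: restr_sum.
have r'K Q : mod_iso (r' (r Q)) Q by exact: restrK.
have req x y : K0_eq x y -> K0_eq (r x.1, r x.2) (r y.1, r y.2).
  case=> T h; exists (r T) => /=.
  have s3 A B C : mod_iso (r (fgproj_sum (fgproj_sum A B) C))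
      (fgproj_sum (fgproj_sum (r A) (r B)) (r C)).
    by apply: mod_iso_trans (rsum _ _) _; apply: mod_iso_prod (rsum _ _) (mod_iso_refl _).
  apply: mod_iso_trans (mod_iso_sym (s3 _ _ _)) _.
  by apply: mod_iso_trans (s3 _ _ _); apply: restr_iso.
have r'eq x y : K0_eq x y -> K0_eq (r' x.1, r' x.2) (r' y.1, r' y.2).
  case=> T h; exists (r' T) => /=.
  have s3 A B C : mod_iso (r' (fgproj_sum (fgproj_sum A B) C))
      (fgproj_sum (fgproj_sum (r' A) (r' B)) (r' C)).
    by apply: mod_iso_trans (r'sum _ _) _; apply: mod_iso_prod (r'sum _ _) (mod_iso_refl _).
  apply: mod_iso_trans (mod_iso_sym (s3 _ _ _)) _.
  by apply: mod_iso_trans (s3 _ _ _); apply: restr_iso.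
have iso_eq T (P P' Q Q' : fgproj T) : mod_iso P P' -> mod_iso Q Q' -> K0_eq (P, Q) (P', Q').
  move=> a b; exists (fgproj_zero T) => /=; apply: mod_iso_prod (mod_iso_refl _).
  by apply: mod_iso_prod => //; exact: mod_iso_sym.
exists (fun x => (r x.1, r x.2)); split=> [[x1 x2] [y1 y2]|[z1 z2]|x y|] /=.
- split=> [/req //|/r'eq /= h].
  apply: (K0_eq_trans (y := (r' (r x1), r' (r x2)))).
    by apply: iso_eq; exact: mod_iso_sym.
  by apply: K0_eq_trans h _; exact: iso_eq.
- by exists (r' z1, r' z2) => /=; exact: iso_eq.
- by apply: iso_eq; exact: rsum.
- by apply: iso_eq; [exact: restr_regular|exact: restr_zero].
Qed.

Section HarmonicCount.
Variable A : finZmodType.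

Definition harm_set (E : graph) : {set {ffun vertex E -> A}} :=
  [set phi : {ffun vertex E -> A} | `[< @harmonic E A phi >]].
Definition harm0_set (E : graph) : {set {ffun vertex E -> A}} :=
  [set phi : {ffun vertex E -> A} | `[< @harmonic E A phi >] && (\sum_v phi v == 0)].

(** [T] composes the homomorphism from K_0(L_K(F)) given by phi with the isomorphism f, and
    evaluates at the classes of the L v. It is injective because these classes generate K_0 and f is
    onto; the sums agree because the sum of phi is the value at [1]. *)
Lemma harmonic_K0_inj (K : fieldType) (E F : graph) :
  K0_pointed_iso (LPA K E) (LPA K F) ->
  exists T : {ffun vertex F -> A} -> {ffun vertex E -> A},
    [/\ forall phi : {ffun vertex F -> A}, harmonic phi -> harmonic (T phi),
        forall phi psi : {ffun vertex F -> A}, harmonic phi -> harmonic psi -> T phi = T psi -> phi = psi &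
        forall phi : {ffun vertex F -> A}, harmonic phi -> \sum_v T phi v = \sum_v phi v].
Proof.
case=> f [f1 f2 f3 f4].
have /choice[T TP] : forall phi : {ffun vertex F -> A}, exists psi : {ffun vertex E -> A},
    harmonic phi -> exists chi' : fgproj (LPA K F) -> A,
    [/\ khom chi',
      forall (P : fgproj (LPA K F)) (I : finType) (w : I -> vertex F) (x : I -> P),
       mbasis w x -> chi' P = \sum_a phi (w a) &
      forall v, psi v = kdiff chi' (f (Lvert K v, fgproj_zero (LPA K E)))].
  move=> phi; have [hphi|] := pselect (harmonic phi); last by exists [ffun=> 0].
  have [chi' [k' kE]] := weight_ex K hphi.
  exists [ffun v => kdiff chi' (f (Lvert K v, fgproj_zero (LPA K E)))] => _.
  by exists chi'; split=> // v; rewrite ffunE.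
have kh chi' : khom chi' -> khom (fun P => kdiff chi' (f (P, fgproj_zero (LPA K E)))).
  move=> k'; split=> [P Q h|P Q].
    apply: kdiff_eq k' _; apply/f1; case: P Q h => P fP pP [Q fQ pQ]; exact: K0_eq_iso.
  rewrite -(kdiff_add _ _ k'); apply: kdiff_eq k' _.
  by apply: K0_eq_trans (f3 _ _); apply/f1; exact: K0_add_sum.
exists T; split=> [phi hphi|phi psi hphi hpsi e|phi hphi].
- have [chi' [k' _ tE]] := TP phi hphi.
  have := khom_harmonic (kh _ _ k') => H v nv; rewrite tE (H v nv).
  by apply: eq_bigr => e _; rewrite tE.
- have [c1 [k1 b1 t1]] := TP phi hphi; have [c2 [k2 b2 t2]] := TP psi hpsi.
  have eqP P : kdiff c1 (f (P, fgproj_zero (LPA K E))) = kdiff c2 (f (P, fgproj_zero (LPA K E))).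
    have [I [w [x b]]] := fgproj_basis P.
    rewrite (khom_basis (kh _ _ k1) b) (khom_basis (kh _ _ k2) b).
    by apply: eq_bigr => a _; rewrite -t1 -t2 e.
  (* From classes of modules to their formal differences, by [K0_diff]. *)
  have eqx x : kdiff c1 (f x) = kdiff c2 (f x).
    case: x => P Q; have dk c : khom c -> kdiff c (f (P, Q)) + kdiff c (f (Q, fgproj_zero _))
        = kdiff c (f (P, fgproj_zero _)).
      move=> kc; rewrite -(kdiff_add _ _ kc); apply: kdiff_eq kc _.
      apply: K0_eq_trans (K0_eq_sym (f3 _ _)) _; apply/f1; exact: K0_diff.
    by have := dk _ _ k1; rewrite (eqP P) -(dk _ _ k2) (eqP Q) => /addIr.
  apply/ffunP => v.
  have -> : phi v = c1 (Lvert K v) by rewrite (b1 _ _ _ _ (mbasis_Lvert K v)) big_ord1.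
  have -> : psi v = c2 (Lvert K v) by rewrite (b2 _ _ _ _ (mbasis_Lvert K v)) big_ord1.
  rewrite -(kdiff_pos _ k1) -(kdiff_pos _ k2).
  have [x xE] := f2 (Lvert K v, fgproj_zero (LPA K F)).
  by rewrite -(kdiff_eq k1 xE) -(kdiff_eq k2 xE).
- have [chi' [k' b' tE]] := TP phi hphi.
  under eq_bigr do rewrite tE.
  rewrite -(khom_basis (P := fgproj_regular _) (kh _ _ k') (mbasis_regular K E)).
  rewrite (kdiff_eq k' f4) kdiff_pos //.
  exact: (b' (fgproj_regular _) _ _ _ (mbasis_regular K F)).
Qed.

Lemma harm_setP (E : graph) (phi : {ffun vertex E -> A}) :
  phi \in harm_set E <-> harmonic phi.
Proof. by rewrite inE; split=> [h|h]; [exact: asboolW h|exact: asboolT]. Qed.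

Lemma harm0_setP (E : graph) (phi : {ffun vertex E -> A}) :
  phi \in harm0_set E <-> harmonic phi /\ \sum_v phi v = 0.
Proof.
rewrite inE; split=> [/andP[h /eqP s]|[h s]]; first by split=> //; exact: asboolW h.
by rewrite s eqxx andbT; exact: asboolT.
Qed.

Lemma harm_card_le (K : fieldType) (E F : graph) : K0_pointed_iso (LPA K E) (LPA K F) ->
  (#|harm_set F| <= #|harm_set E|)%N /\ (#|harm0_set F| <= #|harm0_set E|)%N.
Proof.
case/harmonic_K0_inj => T [T1 T2 T3]; split.
  rewrite -(card_in_imset (f := T) (D := harm_set F)); last first.
    by move=> p q hp hq; apply: T2; exact/harm_setP.
  apply: subset_leq_card; apply/fintype.subsetP => _ /imsetP[p hp ->].
  by apply/harm_setP/T1/harm_setP.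
rewrite -(card_in_imset (f := T) (D := harm0_set F)); last first.
  by move=> p q /harm0_setP[hp _] /harm0_setP[hq _]; exact: T2.
apply: subset_leq_card; apply/fintype.subsetP => _ /imsetP[p /harm0_setP[hp s] ->].
by apply/harm0_setP; split; [exact: T1|rewrite T3].
Qed.

Lemma harm_card (K : fieldType) (E F : graph) : K0_pointed_iso (LPA K E) (LPA K F) ->
  #|harm_set E| = #|harm_set F| /\ #|harm0_set E| = #|harm0_set F|.
Proof.
move=> h; have [a b] := harm_card_le h; have [c d] := harm_card_le (K0_pointed_iso_sym h).
by split; apply/eqP; rewrite eqn_leq ?a ?b ?c ?d.
Qed.
End HarmonicCount.

(** * Hereditary saturated sets and ideals *)

Lemma quot_ring_iso (A B : pzRingType) (I : ideal A) (f : A -> B) :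
  zmod_morphism f -> monoid_morphism f -> (forall x, I x <-> f x = 0) ->
  (forall y, exists x, f x = y) -> ring_iso (quot I) B.
Proof.
move=> fB [f1 fM] fI fs; pose g (x : quot I) := f (repr x).
have gE x : g (\pi_(quot I) x) = f x.
  by apply: subr0_eq; rewrite -fB; apply/fI; exact: quot_reprP.
apply: (@ring_iso_intro _ _ g).
- elim/quotW=> x; elim/quotW=> y.
  have -> : \pi_(quot I) x - \pi_(quot I) y = \pi_(quot I) (x - y) :> quot I.
    by rewrite [RHS]pi_quotD pi_quotN.
  by rewrite !gE fB.
- split; first by rewrite -f1 -gE.
  elim/quotW=> x; elim/quotW=> y.
  have -> : \pi_(quot I) x * \pi_(quot I) y = \pi_(quot I) (x * y) :> quot I.
    by rewrite [RHS]pi_quotM.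
  by rewrite !gE fM.
have /choice[h hE] := fs; exists (fun y => \pi_(quot I) (h y)) => [x|y]; last by rewrite gE.
elim/quotW: x => x; rewrite gE; apply/eqP/quot_eqP/fI.
by rewrite fB hE subrr.
Qed.

Lemma quot_iso_image (A B : pzRingType) (I : ideal A) (J : ideal B)
  (f : {rmorphism A -> B}) : bijective f -> (forall x, I x <-> J (f x)) ->
  ring_iso (quot I) (quot J).
Proof.
case=> g fK gK IJ; apply: (@quot_ring_iso _ _ _ (fun x => \pi_(quot J) (f x))).
- move=> x y; rewrite rmorphB; by rewrite [LHS]pi_quotD pi_quotN.
- by split=> [|x y]; rewrite ?rmorph1 ?rmorphM ?pi_quotM.
- move=> x; rewrite IJ; split=> [h|/eqP/quot_eqP]; last by rewrite subr0.
  by apply/eqP/quot_eqP; rewrite subr0.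
- by elim/quotW=> y; exists (g y); rewrite gK.
Qed.

Lemma quot_zero_ideal (A : pzRingType) (I : ideal A) : (forall x, I x -> x = 0) ->
  ring_iso (quot I) A.
Proof.
move=> I0; apply: (@quot_ring_iso _ _ _ id) => // [x|y]; last by exists y.
by split=> [/I0|->] //; exact: ideal0.
Qed.

Definition hs (E : graph) (H : {set vertex E}) : Prop := hereditary H /\ saturated H.

Section Generated.
Variables (K : fieldType) (E : graph).
Local Notation L := (LPA K E).
Implicit Types (v w : vertex E) (e : edge E) (x y z : L) (H : {set vertex E}) (J : ideal L).

Definition vset J : {set vertex E} := [set v | `[< J (vert K v) >]].

Lemma vsetP J v : v \in vset J <-> J (vert K v).
Proof. by rewrite inE; split=> [h|h]; [exact: asboolW h|exact: asboolT]. Qed.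

Lemma hereditary_edge H : (forall e, src e \in H -> rng e \in H) -> hereditary H.
Proof.
move=> h v w + [p [+ <-]]; elim: p v => [|e p IH] v //= vH /andP[/eqP ev].
by apply: IH; apply: h; rewrite ev.
Qed.

Lemma hereditary_rng H e : hereditary H -> src e \in H -> rng e \in H.
Proof. by move=> h /h; apply; exists [:: e]; rewrite /= eqxx. Qed.

Lemma ideal_rng J e : J (vert K (src e)) -> J (vert K (rng e)).
Proof.
move=> h; rewrite -ghost_edg_id -[ghost K e]ghost_vert -mulrA.
by apply/idealMl/idealMr.
Qed.

Lemma vset_hs J : hs (vset J).
Proof.
split.
  by apply: hereditary_edge => e /vsetP h; apply/vsetP; exact: ideal_rng.
move=> v ve h; apply/vsetP; rewrite (CK2 K ve); apply: ideal_sum => e /eqP ev.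
by rewrite -edg_vert -mulrA; apply/idealMl/idealMr/vsetP/h.
Qed.

(** The intersection of all ideals that contain H, so that membership is used by exhibiting a
    suitable ideal, such as a kernel or a preimage. *)
Definition gen_pred H x : Prop :=
  forall J, (forall v, v \in H -> J (vert K v)) -> J x.

Definition gen_ideal H : ideal L.
Proof.
refine (@Ideal _ (gen_pred H) _ _ _ _) => [J _|x y hx hy J h|r x hx J h|r x hx J h].
- exact: ideal0.
- by apply: idealD; [exact: hx|exact: hy].
- by apply/idealMl/hx.
- by apply/idealMr/hx.
Defined.

Lemma gen_ideal_vert H v : v \in H -> gen_ideal H (vert K v).
Proof. by move=> vH J; apply. Qed.

Lemma gen_ideal_sub H J x : (forall v, v \in H -> J (vert K v)) -> gen_ideal H x -> J x.
Proof. by move=> h; apply. Qed.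
End Generated.

Section QuotientGraph.
Variables (E : graph) (H : {set vertex E}).

(* The graph E \ H of a hereditary saturated H. *)
Definition quot_graph : graph :=
  @Graph {v : vertex E | v \notin H}
    {e : edge E | (src e \notin H) && (rng e \notin H)}
    (fun e => exist _ (src (val e)) (proj1 (andP (valP e))))
    (fun e => exist _ (rng (val e)) (proj2 (andP (valP e)))).

Variable K : fieldType.
Local Notation F := quot_graph.
Local Notation L := (LPA K E).
Local Notation Q := (LPA K F).

Hypothesis hsH : hs H.

Definition qvert (v : vertex E) : Q :=
  if (insub v : option (vertex F)) is Some u then vert K u else 0.
Definition qedg (e : edge E) : Q :=
  if (insub e : option (edge F)) is Some u then edg K u else 0.
Definition qghost (e : edge E) : Q :=
  if (insub e : option (edge F)) is Some u then ghost K u else 0.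

Lemma qvert_val (u : vertex F) : qvert (val u) = vert K u.
Proof. by rewrite /qvert valK. Qed.
Lemma qvert_out v : v \in H -> qvert v = 0.
Proof. by move=> vH; rewrite /qvert insubF ?vH. Qed.
Lemma qedg_val (u : edge F) : qedg (val u) = edg K u.
Proof. by rewrite /qedg valK. Qed.
Lemma qghost_val (u : edge F) : qghost (val u) = ghost K u.
Proof. by rewrite /qghost valK. Qed.
Lemma qedg_out e : rng e \in H -> qedg e = 0 /\ qghost e = 0.
Proof. by move=> eH; rewrite /qedg /qghost insubF // eH andbF. Qed.

Lemma edge_case e : rng e \in H \/ exists u : edge F, e = val u.
Proof.
have [eH|eH] := boolP (rng e \in H); [by left|right].
have p : (src e \notin H) && (rng e \notin H).
  rewrite eH andbT; apply: contra eH; exact: hereditary_rng (proj1 hsH).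
by exists (exist _ e p).
Qed.

Lemma rel_ok_quot : rel_ok qvert qedg qghost.
Proof.
split.
- move=> v w; have [vH|vH] := boolP (v \in H).
    by rewrite qvert_out // mul0r; case: ifP.
  have [wH|wH] := boolP (w \in H).
    by rewrite (qvert_out wH) mulr0; case: eqP => // vw; rewrite vw wH in vH.
  rewrite (qvert_val (exist _ v vH)) (qvert_val (exist _ w wH)) vertM.
  by rewrite -val_eqE.
- move=> e; have [eH|[u ->]] := edge_case e.
    by rewrite (qedg_out eH).1 mulr0 mul0r.
  by rewrite qedg_val (qvert_val (src u)) (qvert_val (rng u)) vert_edg edg_vert.
- move=> e; have [eH|[u ->]] := edge_case e.
    by rewrite (qedg_out eH).2 mulr0 mul0r.
  by rewrite qghost_val (qvert_val (src u)) (qvert_val (rng u)) vert_ghost ghost_vert.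
- move=> e f; have [eH|[u ->]] := edge_case e.
    by rewrite (qedg_out eH).2 mul0r; case: ifP => // _; rewrite qvert_out.
  have [fH|[u' ->]] := edge_case f.
    rewrite (qedg_out fH).1 mulr0; case: eqP => // uf.
    by rewrite uf qvert_out.
  by rewrite qghost_val qedg_val (qvert_val (rng u)) ghost_edg val_eqE.
- move=> v ve; have [vH|vH] := boolP (v \in H).
    rewrite qvert_out // big1 // => e /eqP ev; rewrite (qedg_out _).1 ?mul0r //.
    by apply: hereditary_rng (proj1 hsH) _; rewrite ev.
  pose u : vertex F := exist _ v vH.
  (* Saturation: a vertex outside H that emits edges in E still emits one in E \ H, so that CK2 is a
     relation there too. *)
  have ue : exists e, src e = u.
    apply: contrapT => nu; apply: (negP vH); apply: (proj2 hsH) => // e ev.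
    have [//|[e' ee]] := edge_case e; case: nu; exists e'.
    by apply: val_inj; rewrite /= -ee.
  rewrite (qvert_val u) (CK2 K ue).
  rewrite [RHS](bigID (fun e => (src e \notin H) && (rng e \notin H))) /=.
  rewrite [X in _ + X]big1 ?addr0; last first.
    move=> e /andP[_ ne]; have [eH|[e' ee]] := edge_case e.
      by rewrite (qedg_out eH).1 mul0r.
    by move: ne; rewrite ee (valP e').
  rewrite (reindex_omap (val : edge F -> edge E) insub) /=; last first.
    by move=> e /andP[_ p]; rewrite insubT.
  apply: eq_big => e; last by rewrite qedg_val qghost_val.
  by rewrite -val_eqE /= valK eqxx andbT (valP e) andbT.
Qed.

Definition qmap : L -> Q := lift qvert qedg qghost.

Lemma qmap_sum1 : \sum_v qvert v = 1.
Proof.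
rewrite LPA1 (bigID (fun v => v \notin H)) /= [X in _ + X]big1 ?addr0; last first.
  by move=> v; rewrite negbK => vH; rewrite qvert_out.
rewrite (reindex_omap (val : vertex F -> vertex E) insub) /=; last first.
  by move=> v p; rewrite insubT.
by apply: eq_big => u; [rewrite valK eqxx (valP u)|rewrite qvert_val].
Qed.

Lemma qmap_zmod : zmod_morphism qmap. Proof. exact: lift_zmod rel_ok_quot. Qed.
Lemma qmap_monoid : monoid_morphism qmap.
Proof.
split; first exact: (lift1 rel_ok_quot qmap_sum1).
exact: (liftM rel_ok_quot).
Qed.

Lemma qmap_vert v : qmap (vert K v) = qvert v. Proof. exact: (lift_vert rel_ok_quot). Qed.

Lemma qmap_ker_vert v : v \in H -> qmap (vert K v) = 0.
Proof. by move=> vH; rewrite qmap_vert qvert_out. Qed.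

Definition qker : ideal L.
Proof.
refine (@Ideal _ (fun x => qmap x = 0) _ _ _ _) => [|x y hx hy|r x hx|r x hx].
- exact: (lift0 rel_ok_quot).
- by rewrite [LHS](liftD rel_ok_quot) [X in X + _]hx [X in _ + X]hy addr0.
- by rewrite [LHS](liftM rel_ok_quot) [X in _ * X]hx mulr0.
- by rewrite [LHS](liftM rel_ok_quot) [X in X * _]hx mul0r.
Defined.

Lemma qmap_gen x : gen_ideal K H x -> qmap x = 0.
Proof. by apply: (@gen_ideal_sub K E H qker) => v vH; exact: qmap_ker_vert. Qed.

Lemma vert_gen_ideal v : gen_ideal K H (vert K v) <-> v \in H.
Proof.
split=> [/qmap_gen|]; last exact: gen_ideal_vert.
rewrite qmap_vert; have [//|vH] := boolP (v \in H).
by rewrite (qvert_val (exist _ v vH)) => /eqP; rewrite (negPf (vert_neq0 K _)).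
Qed.

Local Notation J := (gen_ideal K H).
Local Notation sec := (lift (fun u : vertex F => vert K (val u))
  (fun u : edge F => edg K (val u)) (fun u : edge F => ghost K (val u))).

Lemma gen_ideal_edg e : rng e \in H -> J (edg K e) /\ J (ghost K e).
Proof.
move=> eH; split; first by rewrite -edg_vert; apply/idealMl/gen_ideal_vert.
by rewrite -vert_ghost; apply/idealMr/gen_ideal_vert.
Qed.

(** In L the sum in CK2 also runs over the edges into H, so the relation of E \ H holds only modulo
    J. The resulting [sec] is inverse to [qmap] modulo J, and this identifies the kernel of
    [qmap]. *)
Lemma rel_mod_quot : rel_mod J (fun u : vertex F => vert K (val u))
  (fun u : edge F => edg K (val u)) (fun u : edge F => ghost K (val u)).
Proof.
split.
- by move=> v w; rewrite vertM val_eqE; apply: ideal_sub0.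
- by move=> e; split; apply: ideal_sub0; [exact: vert_edg|exact: edg_vert].
- by move=> e; split; apply: ideal_sub0; [exact: vert_ghost|exact: ghost_vert].
- by move=> e f; apply: ideal_sub0; rewrite ghost_edg val_eqE.
- move=> u [e eu]; have ve : exists e, src e = val u by exists (val e); rewrite -eu.
  rewrite (CK2 K ve) (bigID (fun e => (src e \notin H) && (rng e \notin H))) /=.
  rewrite (reindex_omap (val : edge F -> edge E) insub) /=; last first.
    by move=> e' /andP[_ p]; rewrite insubT.
  rewrite addrAC -[gen_pred H _]/(ideal_set J _); apply: idealD; last first.
    apply: ideal_sum => e' /andP[_ ne]; have [eH|[e1 ee]] := edge_case e'.
      by apply/idealMr; case: (gen_ideal_edg eH).
    by move: ne; rewrite ee (valP e1).
  apply: ideal_sub0; apply: eq_bigl => e'.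
  by rewrite -[RHS]val_eqE /= valK eqxx andbT (valP e') andbT.
Qed.

Lemma qmap_J x y : J (x - y) -> qmap x = qmap y.
Proof. by move/qmap_gen; rewrite qmap_zmod => /subr0_eq. Qed.

Lemma qmap_sec q : qmap (sec q) = q.
Proof.
have R := rel_mod_quot; have O := rel_ok_quot.
elim/LPA_ind: q => [v|e|e||x y hx hy|x hx|a x hx|x y hx hy].
- by rewrite (qmap_J (lift_mod_vert R v)) qmap_vert qvert_val.
- by rewrite (qmap_J (lift_mod_edg R e)) [LHS](lift_edg O) qedg_val.
- by rewrite (qmap_J (lift_mod_ghost R e)) [LHS](lift_ghost O) qghost_val.
- by rewrite (qmap_gen (lift_mod0 R)).
- by rewrite (qmap_J (lift_modD R x y)) [LHS](liftD O) [X in X + _]hx [X in _ + X]hy.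
- have : J (sec (- x) - - sec x) by rewrite opprK; exact: lift_modN R x.
  by move/qmap_J ->; rewrite [LHS](liftN O) [X in - X]hx.
- by rewrite (qmap_J (lift_modZ R a x)) [LHS](liftZ O) [X in _ *: X]hx.
- by rewrite (qmap_J (lift_modM R x y)) [LHS](liftM O) [X in X * _]hx [X in _ * X]hy.
Qed.

Lemma sec_qmap x : J (sec (qmap x) - x).
Proof.
have R := rel_mod_quot; have O := rel_ok_quot.
have sec0 : J (sec 0) := lift_mod0 R.
elim/LPA_ind: x => [v|e|e||x y hx hy|x hx|a x hx|x y hx hy].
- rewrite qmap_vert; have [vH|vH] := boolP (v \in H).
    by rewrite qvert_out //; apply: idealB => //; exact: gen_ideal_vert.
  by rewrite (qvert_val (exist _ v vH)); exact: lift_mod_vert R _.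
- rewrite [qmap _](lift_edg O); have [eH|[u ->]] := edge_case e.
    by rewrite (qedg_out eH).1; apply: idealB => //; case: (gen_ideal_edg eH).
  by rewrite qedg_val; exact: lift_mod_edg R _.
- rewrite [qmap _](lift_ghost O); have [eH|[u ->]] := edge_case e.
    by rewrite (qedg_out eH).2; apply: idealB => //; case: (gen_ideal_edg eH).
  by rewrite qghost_val; exact: lift_mod_ghost R _.
- by rewrite [qmap _](lift0 O) subr0.
- rewrite [qmap _](liftD O); apply: ideal_trans (lift_modD R _ _) _.
  exact: ideal_subD hx hy.
- rewrite [qmap _](liftN O) opprK.
  have h : J (sec (- qmap x) - - sec (qmap x)) by rewrite opprK; exact: lift_modN R _.
  rewrite -[X in _ + X]opprK; apply: ideal_trans h _; rewrite -opprD; exact: idealN.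
- rewrite [qmap _](liftZ O); apply: ideal_trans (lift_modZ R _ _) _.
  by rewrite -scalerBr; apply: idealZ.
- rewrite [qmap _](liftM O); apply: ideal_trans (lift_modM R _ _) _.
  exact: ideal_subM hx hy.
Qed.

Lemma qmap_ker x : J x <-> qmap x = 0.
Proof.
split; first exact: qmap_gen.
move=> x0; have := sec_qmap x; rewrite x0 => h.
by rewrite -[x](subKr (sec 0)); apply: idealB => //; exact: lift_mod0 rel_mod_quot.
Qed.

Lemma qmap_surj q : exists x, qmap x = q.
Proof. by exists (sec q); exact: qmap_sec. Qed.

Theorem quot_gen_ideal : ring_iso (quot J) Q.
Proof.
exact: quot_ring_iso qmap_zmod qmap_monoid qmap_ker qmap_surj.
Qed.
End QuotientGraph.

(** The decomposition of L e into modules L (w a), written with elements. It shows that e and the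
    vertices w a generate the same ideal, and that z -> y a * z * x a embeds the corner at w a into
    e L e. *)
Lemma idem_basis (K : fieldType) (E : graph) (e : LPA K E) : e * e = e ->
  exists (I : finType) (w : I -> vertex E) (x y : I -> LPA K E),
  [/\ e = \sum_a y a * x a,
      forall a, vert K (w a) * x a = x a /\ x a * e = x a,
      forall a, e * y a = y a /\ y a * vert K (w a) = y a &
      forall a b, x a * y b = if a == b then vert K (w a) else 0].
Proof.
move=> ee; have [I [w [x [xw sy sx ix]]]] :=
  @span_basis K E unit unit (fun _ _ => e).
have [c cE] := sy tt.
have xe a : x a tt * e = x a tt.
  by have [d dE] := sx a; rewrite dE mulr_suml; apply: eq_bigr => i _; rewrite -mulrA ee.
pose y a := e * c a * vert K (w a).
have eE : e = \sum_a y a * x a tt.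
  rewrite -{1}ee [X in _ * X](cE tt) mulr_sumr; apply: eq_bigr => a _.
  by rewrite /y -!mulrA xw.
have yw a : y a * vert K (w a) = y a by rewrite /y -mulrA vertM_id.
exists I, w, (fun a => x a tt), y; split=> // [a|a b]; first by rewrite /y !mulrA ee yw.
(* The sum of the z b * x b is x a * e - x a = 0, so z vanishes by independence. *)
pose z b := x a tt * y b - (if a == b then vert K (w a) else 0).
suff: z b = 0 by move/subr0_eq.
apply: (ix z) b => [b|[]].
  by rewrite /z mulrBl -mulrA yw; case: eqP => [->|_]; rewrite ?vertM_id ?mul0r.
rewrite /z; under eq_bigr do rewrite mulrBl -mulrA.
rewrite big_split /= -mulr_sumr -eE xe sumrN.
rewrite (bigD1 a) //= eqxx xw big1 ?addr0 ?subrr // => b.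
by rewrite eq_sym => /negPf ->; rewrite mul0r.
Qed.

Lemma ring_iso_inverse (A B : pzRingType) : ring_iso A B ->
  exists (f : {rmorphism A -> B}) (g : {rmorphism B -> A}), cancel f g /\ cancel g f.
Proof.
case=> f [g0 fK gK].
have gB : zmod_morphism g0 by move=> x y; apply: (can_inj fK); rewrite gK rmorphB !gK.
have gM : monoid_morphism g0.
  split; first by apply: (can_inj fK); rewrite gK rmorph1.
  by move=> x y; apply: (can_inj fK); rewrite gK rmorphM !gK.
pose g : {rmorphism B -> A} := HB.pack g0 (GRing.isZmodMorphism.Build B A g0 gB)
  (GRing.isMonoidMorphism.Build B A g0 gM).
by exists f, g.
Qed.

Section PreIdeal.
Variables (A B : pzRingType) (f : {rmorphism A -> B}) (J : ideal B).
Definition pre_ideal : ideal A.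
Proof.
refine (@Ideal _ (fun x => J (f x)) _ _ _ _) => [|x y hx hy|r x hx|r x hx].
- by rewrite rmorph0; exact: ideal0.
- by rewrite rmorphD; apply: idealD.
- by rewrite rmorphM; apply: idealMl.
- by rewrite rmorphM; apply: idealMr.
Defined.
End PreIdeal.

Section Transport.
Variables (K : fieldType) (E F : graph).

(** [Phi H] consists of the vertices of F whose preimages lie in I(H). For v in H the idempotent f v
    is equivalent to a sum of vertices w a, and these belong to [Phi H]. *)
Lemma hs_transport : ring_iso (LPA K E) (LPA K F) ->
  exists (f : {rmorphism LPA K E -> LPA K F}) (Phi : {set vertex E} -> {set vertex F}),
    bijective f /\ forall H, hs H -> hs (Phi H) /\
      forall x, gen_ideal K H x <-> gen_ideal K (Phi H) (f x).
Proof.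
case/ring_iso_inverse=> f [g [fK gK]].
exists f, (fun H => vset (pre_ideal g (gen_ideal K H))); split; first by exists g.
move=> H hH; split; first exact: vset_hs.
move=> x; split; last first.
  move=> h; rewrite -[x]fK.
  apply: (gen_ideal_sub (J := pre_ideal g (gen_ideal K H)) _ h) => v.
  by move/vsetP.
apply: (gen_ideal_sub (J := pre_ideal f (gen_ideal K _))) => v vH.
have ee : f (vert K v) * f (vert K v) = f (vert K v) by rewrite -rmorphM vertM_id.
have [I [w [x1 [y [eE xe ey xy]]]]] := idem_basis ee.
change (gen_ideal K (vset (pre_ideal g (gen_ideal K H))) (f (vert K v))).
rewrite eE; apply: ideal_sum => a _.
rewrite -(ey a).2 -mulrA; apply/idealMl/idealMr/gen_ideal_vert/vsetP.
change (gen_ideal K H (g (vert K (w a)))).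
(* Here w a = x a * f v * y a, so the preimage of w a lies in the ideal generated by v. *)
have := xy a a; rewrite eqxx => <-; rewrite -(xe a).2 !rmorphM fK.
by apply/idealMr/idealMl/gen_ideal_vert.
Qed.

Lemma hs_quot_transport : ring_iso (LPA K E) (LPA K F) ->
  exists Phi : {set vertex E} -> {set vertex F},
    [/\ forall H, hs H -> hs (Phi H),
        forall H H', hs H -> hs H' -> Phi H = Phi H' -> H = H' &
        forall H, hs H -> ring_iso (LPA K (quot_graph H)) (LPA K (quot_graph (Phi H)))].
Proof.
case/hs_transport=> f [Phi [bf P]]; exists Phi; split=> [H|H H' hH hH' e|H hH].
- by case/P.
- have [_ PH] := P _ hH; have [_ PH'] := P _ hH'; apply/setP => v.
  apply/idP/idP => h.
    by apply/(vert_gen_ideal K hH')/PH'; rewrite -e; apply/PH/(vert_gen_ideal K hH).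
  by apply/(vert_gen_ideal K hH)/PH; rewrite e; apply/PH'/(vert_gen_ideal K hH').
- have [hPH PH] := P _ hH.
  apply: ring_iso_trans (ring_iso_sym (quot_gen_ideal K hH)) _.
  apply: ring_iso_trans (quot_gen_ideal K hPH); exact: quot_iso_image bf PH.
Qed.
End Transport.

(** * Counting harmonic functions on quotient graphs *)

Definition vanish (A : zmodType) (E : graph) (H : {set vertex E})
  (phi : vertex E -> A) : bool := [forall v in H, phi v == 0].

Lemma vanishP (A : zmodType) (E : graph) (H : {set vertex E}) (phi : vertex E -> A) :
  reflect (forall v, v \in H -> phi v = 0) (vanish H phi).
Proof.
apply: (iffP forallP) => [h v vH|h v]; first by have := h v; rewrite vH => /eqP.
by apply/implyP => /h ->.
Qed.

Section Relative.
Variables (A : finZmodType) (E : graph) (H : {set vertex E}).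
Hypothesis hsH : hs H.
Local Notation F := (quot_graph H).

(** Extension by 0 identifies functions on E \ H with functions on E that vanish on H. The counts
    for quotient graphs can thus be taken on E itself, where the vertex type is concrete. *)
Definition ext (psi : {ffun vertex F -> A}) : {ffun vertex E -> A} :=
  [ffun v => if (insub v : option (vertex F)) is Some u then psi u else 0].

Lemma ext_val psi (u : vertex F) : ext psi (val u) = psi u.
Proof. by rewrite ffunE valK. Qed.
Lemma ext_out psi v : v \in H -> ext psi v = 0.
Proof. by move=> vH; rewrite ffunE insubF ?vH. Qed.

Lemma ext_inj : injective ext.
Proof. by move=> p q e; apply/ffunP => u; rewrite -!ext_val e. Qed.

Lemma ext_sum psi : \sum_v ext psi v = \sum_u psi u.
Proof.
rewrite (bigID (fun v => v \notin H)) /= [X in _ + X]big1 ?addr0; last first.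
  by move=> v; rewrite negbK => vH; rewrite ext_out.
rewrite (reindex_omap (val : vertex F -> vertex E) insub) /=; last first.
  by move=> v p; rewrite insubT.
by apply: eq_big => u; [rewrite valK eqxx (valP u)|rewrite ext_val].
Qed.

(** Edges that end in H contribute 0, edges that start in H also end there, and by saturation no
    vertex becomes a sink in E \ H. *)
Lemma ext_harmonic psi : harmonic (ext psi) <-> harmonic psi.
Proof.
have sumE (u : vertex F) : \sum_(e | src e == val u) ext psi (rng e) =
    \sum_(e : edge F | src e == u) psi (rng e).
  rewrite (bigID (fun e => (src e \notin H) && (rng e \notin H))) /=.
  rewrite [X in _ + X]big1 ?addr0; last first.
    move=> e /andP[_ ne]; have [eH|[e' ee]] := edge_case hsH e; first exact: ext_out.
    by move: ne; rewrite ee (valP e').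
  rewrite (reindex_omap (val : edge F -> edge E) insub) /=; last first.
    by move=> e /andP[_ p]; rewrite insubT.
  apply: eq_big => e; last by rewrite -ext_val.
  by rewrite -[RHS]val_eqE /= valK eqxx andbT (valP e) andbT.
split=> h v ve; last first.
  have [vH|vH] := boolP (v \in H).
    rewrite ext_out // big1 // => e /eqP ev; apply: ext_out.
    by apply: hereditary_rng (proj1 hsH) _; rewrite ev.
  pose u : vertex F := exist _ v vH.
  rewrite (ext_val psi u) -[v]/(val u) sumE; apply: h.
  apply/sinkPn; apply: contrapT => nu.
  apply: (negP vH); apply: (proj2 hsH); first exact/sinkPn.
  move=> e ev; have [//|[e' ee]] := edge_case hsH e; case: nu; exists e'.
  by apply: val_inj; rewrite /= -ee.
rewrite -ext_val (h (val v)) ?sumE //.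
by move/sinkPn: ve => [e ev]; apply/sinkPn; exists (val e); rewrite -ev.
Qed.

Lemma ext_surj (phi : {ffun vertex E -> A}) : vanish H phi -> exists psi, ext psi = phi.
Proof.
move/vanishP=> v0; exists [ffun u => phi (val u)]; apply/ffunP => v.
have [vH|vH] := boolP (v \in H); first by rewrite ext_out // v0.
by rewrite (ext_val _ (exist _ v vH)) ffunE.
Qed.

Lemma card_ext (P : pred {ffun vertex E -> A}) :
  #|[set psi | P (ext psi)]| = #|[set phi | P phi & vanish H phi]|.
Proof.
rewrite -(card_imset _ ext_inj); apply: eq_card => phi; apply/imsetP/idP.
  case=> psi; rewrite !inE => Pp ->; rewrite Pp; apply/vanishP; exact: ext_out.
rewrite inE => /andP[Pp /ext_surj[psi e]]; exists psi => //.
by rewrite inE e.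
Qed.

Definition lift_set (T : {set vertex F}) : {set vertex E} := H :|: [set val u | u in T].

Lemma lift_set_val T (u : vertex F) : (val u \in lift_set T) = (u \in T).
Proof.
rewrite inE (negPf (valP u)) /=; apply/imsetP/idP => [[u' h /val_inj -> //]|h].
by exists u.
Qed.

Lemma lift_set_sub T v : v \in H -> v \in lift_set T.
Proof. by move=> vH; rewrite inE vH. Qed.

Lemma lift_set_inj : injective lift_set.
Proof. by move=> T T' e; apply/setP => u; rewrite -!lift_set_val e. Qed.

Lemma lift_set_surj (H' : {set vertex E}) : H \subset H' -> exists T, lift_set T = H'.
Proof.
move/fintype.subsetP=> s; exists [set u | val u \in H']; apply/setP => v.
have [vH|vH] := boolP (v \in H); first by rewrite lift_set_sub ?s.
by rewrite (lift_set_val _ (exist _ v vH)) inE.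
Qed.

Lemma lift_set_hs T : hs (lift_set T) <-> hs T.
Proof.
split=> -[h1 h2]; split.
- apply: hereditary_edge => e; rewrite -!lift_set_val; exact: hereditary_rng.
- move=> u [e eu] he; rewrite -lift_set_val; apply: h2.
    by exists (val e); rewrite -eu.
  move=> e' e'u; have [/lift_set_sub //|[e1 ee]] := edge_case hsH e'.
  rewrite ee (lift_set_val T (rng e1)); apply: he; apply: val_inj.
  by rewrite -e'u ee.
- apply: hereditary_edge => e; have [/lift_set_sub //|[e1 ->]] := edge_case hsH e.
  by rewrite (lift_set_val T (rng e1)) (lift_set_val T (src e1)); exact: hereditary_rng.
- move=> v ve he; have [/lift_set_sub //|vH] := boolP (v \in H).
  pose u : vertex F := exist _ v vH; rewrite (lift_set_val T u); apply: h2.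
    apply: contrapT => nu; apply: (negP vH); apply: (proj2 hsH) => // e ev.
    have [//|[e' ee]] := edge_case hsH e; case: nu; exists e'.
    by apply: val_inj; rewrite /= -ee.
  move=> e eu; rewrite -lift_set_val; apply: he.
  by rewrite -[LHS]/(val (src e)) eu.
Qed.

Lemma vanish_ext T (psi : {ffun vertex F -> A}) : vanish T psi = vanish (lift_set T) (ext psi).
Proof.
apply/vanishP/vanishP => [h v|h u uT]; last by rewrite -ext_val h // lift_set_val.
have [vH|vH] := boolP (v \in H); first by rewrite ext_out.
by rewrite (lift_set_val T (exist _ v vH)) (ext_val _ (exist _ v vH)); exact: h.
Qed.

Lemma harm_set_ext psi : (psi \in harm_set A F) = (ext psi \in harm_set A E).
Proof. by apply/idP/idP => /harm_setP h; apply/harm_setP/ext_harmonic. Qed.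

Lemma harm_quot : #|harm_set A F| = #|[set phi in harm_set A E | vanish H phi]|.
Proof.
rewrite -(card_ext (fun phi => phi \in harm_set A E)).
by apply: eq_card => psi; rewrite [RHS]inE harm_set_ext.
Qed.

Lemma harm0_quot : #|harm0_set A F| = #|[set phi in harm0_set A E | vanish H phi]|.
Proof.
rewrite -(card_ext (fun phi => phi \in harm0_set A E)).
apply: eq_card => psi; rewrite [RHS]inE.
apply/idP/idP => /harm0_setP[h s]; apply/harm0_setP.
  by split; [exact/ext_harmonic|rewrite ext_sum].
by split; [exact/ext_harmonic|rewrite -ext_sum].
Qed.
End Relative.

Section Count.
Variable A : finZmodType.

Definition hsets (E : graph) : {set {set vertex E}} :=
  [set H | `[< hereditary H /\ saturated H >]].

Lemma hsetsP (E : graph) (H : {set vertex E}) : H \in hsets E <-> hs H.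
Proof. by rewrite inE; split=> [h|h]; [exact: asboolW h|exact: asboolT]. Qed.

(** By [harm_quot] each summand counts the homomorphisms from K_0(L / I(H)) to A. The sum is
    insensitive to the way an isomorphism of algebras permutes the sets H. *)
Definition harm_sum (E : graph) : nat :=
  \sum_(H in hsets E) #|[set phi in harm_set A E | vanish H phi]|.

Lemma hs_count_le (K : fieldType) (E F : graph) : ring_iso (LPA K E) (LPA K F) ->
  (#|hsets E| <= #|hsets F|)%N /\ (harm_sum E <= harm_sum F)%N.
Proof.
move/hs_quot_transport=> [Phi [h1 h2 h3]].
have inj : {in hsets E &, injective Phi} by move=> H H' /hsetsP a /hsetsP b; exact: h2.
have sub : Phi @: hsets E \subset hsets F.
  by apply/fintype.subsetP => _ /imsetP[H /hsetsP hH ->]; apply/hsetsP/h1.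
split; first by rewrite -(card_in_imset inj); exact: subset_leq_card.
rewrite /harm_sum (eq_bigr (fun H => #|[set phi in harm_set A F | vanish (Phi H) phi]|)).
  rewrite -(big_imset (fun H' => #|[set phi in harm_set A F | vanish H' phi]|) inj) /=.
  rewrite [X in (_ <= X)%N](big_setID (Phi @: hsets E)) /= (finset.setIidPr sub).
  exact: leq_addr.
move=> H /hsetsP hH; rewrite -!harm_quot //; last exact: h1.
exact: (harm_card A (ring_iso_K0 (h3 _ hH))).1.
Qed.

Lemma hs_count (K : fieldType) (E F : graph) : ring_iso (LPA K E) (LPA K F) ->
  #|hsets E| = #|hsets F| /\ harm_sum E = harm_sum F.
Proof.
move=> i; have [a b] := hs_count_le i; have [c d] := hs_count_le (ring_iso_sym i).
by split; apply/eqP; rewrite eqn_leq ?a ?b ?c ?d.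
Qed.

(** The hereditary saturated sets of E \ H0 correspond through [lift_set] to those of E that contain
    H0. *)
Lemma harm_sum_quot (E : graph) (H0 : {set vertex E}) : hs H0 ->
  harm_sum (quot_graph H0) = \sum_(H in hsets E | H0 \subset H)
    #|[set phi in harm_set A E | vanish H phi]|.
Proof.
move=> h0; rewrite /harm_sum.
transitivity (\sum_(H in [set lift_set T | T in hsets (quot_graph H0)])
    #|[set phi in harm_set A E | vanish H phi]|).
  rewrite big_imset /=; last by move=> T T' _ _; exact: lift_set_inj.
  apply: eq_bigr => T _.
  transitivity #|[set psi : {ffun vertex (quot_graph H0) -> A} |
      (ext psi \in harm_set A E) && vanish (lift_set T) (ext psi)]|.
    by apply: eq_card => psi; rewrite [LHS]inE [RHS]inE -vanish_ext -harm_set_ext.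
  rewrite (@card_ext A E H0 (fun phi => (phi \in harm_set A E) && vanish (lift_set T) phi)).
  apply: eq_card => phi; rewrite !inE -andbA; congr (_ && _).
  rewrite andb_idr // => /vanishP h; apply/vanishP => v vH; apply: h; exact: lift_set_sub.
apply: eq_bigl => H; apply/imsetP/andP => [[T /hsetsP hT ->]|[/hsetsP hH /lift_set_surj[T e]]].
  split; first by apply/hsetsP/lift_set_hs.
  by apply/fintype.subsetP => v; exact: lift_set_sub.
by exists T; rewrite ?e //; apply/hsetsP/(lift_set_hs h0); rewrite e.
Qed.
End Count.

(** * Commutative corners *)

Definition has_comm_corner (R : pzRingType) : Prop := exists e : R,
  [/\ e * e = e, e <> 0 &
      forall x y, e * x * e = x -> e * y * e = y -> x * y = y * x].

Lemma has_comm_corner_iso (A B : pzRingType) :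
  ring_iso A B -> has_comm_corner A -> has_comm_corner B.
Proof.
case/ring_iso_inverse=> f [g [fK gK]] [e [ee e0 ec]]; exists (f e); split.
- by rewrite -rmorphM ee.
- by move/(congr1 g); rewrite fK rmorph0.
- move=> x y hx hy; apply: (can_inj gK); rewrite !rmorphM; apply: ec.
    by rewrite -{2}hx !rmorphM fK.
  by rewrite -{2}hy !rmorphM fK.
Qed.

Section Corner.
Variables (K : fieldType) (E : graph).
Local Notation L := (LPA K E).
Implicit Types (v w : vertex E) (e c f : edge E) (x y z : L).

Section SingleLoop.
Variables (c : edge E).
Hypothesis c_loop : rng c = src c.
Hypothesis c_only : forall e, src e = src c -> e = c.
Local Notation v := (src c).

Let ccg : edg K c * ghost K c = vert K v.
Proof.
have ve : exists e, src e = v by exists c.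
rewrite (CK2 K ve) (bigD1 c) //= big1 ?addr0 // => e /andP[/eqP /c_only ->].
by rewrite eqxx.
Qed.
Let cgc : ghost K c * edg K c = vert K v.
Proof. by rewrite ghost_edg_id c_loop. Qed.

(** Since c c^* = v, an element z of the corner equals c (c^* z) with c^* z of smaller depth; in
    depth 0 it is a combination of powers of c^*. Applied first with y = c and y = c^*, this yields
    the hypotheses for an arbitrary y. *)
Lemma corner_comm y z : vert K v * y = y -> y * vert K v = y ->
  y * edg K c = edg K c * y -> y * ghost K c = ghost K c * y ->
  vert K v * z * vert K v = z -> y * z = z * y.
Proof.
move=> vy yv yc yg vz; have [n] := Dep_ex z.
have {}vz : vert K v * z = z /\ z * vert K v = z.
  by rewrite -vz !mulrA vertM_id -!mulrA vertM_id.
elim: n z vz => [|n IH] z [vz zv].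
  have gpC q : is_path v q -> y * gp K v q = gp K v q * y.
    elim: q => [|e q IH] /=; first by rewrite vy yv.
    by case/andP=> /eqP/c_only ->; rewrite c_loop => /IH h; rewrite mulrA h -!mulrA yg.
  suff H x : inB x -> y * (x * vert K v) = (x * vert K v) * y by move=> hz; rewrite -zv; exact: H hz.
  elim/B_ind=> [|a u q x' p _ IH]; first by rewrite !mul0r mulr0.
  rewrite mulrDl mulrDr [RHS]mulrDl IH; congr (_ + _).
  rewrite -!scaleLl -scaleLr; congr (_ *: _).
  case: (eqVneq u v) => [uv|uv]; first by rewrite uv gp_vert -?uv // uv gpC -?uv.
  by rewrite -[gp K u q]gp_vert // -mulrA vertM (negPf uv) !mulr0 mul0r.
case=> /(_ c) hz _; have zE : edg K c * (ghost K c * z) = z by rewrite mulrA ccg.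
have h : y * (ghost K c * z) = ghost K c * z * y.
  apply: IH => //; split; last by rewrite -mulrA zv.
  by rewrite mulrA -{1}c_loop vert_ghost.
by rewrite -zE mulrA yc -mulrA h !mulrA.
Qed.

Lemma single_loop_corner : has_comm_corner L.
Proof.
exists (vert K v); split; [exact: vertM_id|by apply/eqP; exact: vert_neq0|].
have vc : vert K v * edg K c = edg K c := vert_edg _ _.
have cv : edg K c * vert K v = edg K c by rewrite -c_loop edg_vert.
have vg : vert K v * ghost K c = ghost K c by rewrite -c_loop vert_ghost.
have gv : ghost K c * vert K v = ghost K c := ghost_vert _ _.
have cg : edg K c * ghost K c = ghost K c * edg K c by rewrite ccg cgc.
move=> x y hx hy; apply: corner_comm => //.
- by rewrite -hx !mulrA vertM_id.
- by rewrite -hx -!mulrA vertM_id.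
- by apply/esym/corner_comm.
- by apply/esym/corner_comm.
Qed.
End SingleLoop.

(** By [idem_basis] a commutative corner e L e would make c and c^* commute at some vertex w. Then c
    c^* = c^* c = w, and f^* = f^* c c^* = 0 for the other edge f. *)
Lemma no_comm_corner :
  (forall w, exists c f, [/\ src c = w, rng c = w, src f = w & f != c]) ->
  ~ has_comm_corner L.
Proof.
move=> H [e [ee e0 ec]]; have [I [w [x [y [eE xe ey xy]]]]] := idem_basis ee.
have [a _] : exists a : I, true.
  apply: contrapT => nI; apply: e0; rewrite eE big1 // => a _.
  by case: nI; exists a.
have [c [f [cs cr fs fc]]] := H (w a).
have xya : x a * y a = vert K (w a) by rewrite xy eqxx.
have in_e z : e * (y a * z * x a) * e = y a * z * x a.
  by rewrite !mulrA (ey a).1 -!mulrA (xe a).2.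
have key z z' : x a * (y a * z * x a * (y a * z' * x a)) * y a =
    vert K (w a) * z * vert K (w a) * z' * vert K (w a).
  by rewrite -!xya !mulrA.
have := congr1 (fun z => x a * z * y a) (ec _ _ (in_e (edg K c)) (in_e (ghost K c))).
have wc : vert K (w a) * edg K c = edg K c by rewrite -cs vert_edg.
have cw : edg K c * vert K (w a) = edg K c by rewrite -cr edg_vert.
have wg : vert K (w a) * ghost K c = ghost K c by rewrite -cr vert_ghost.
have gw : ghost K c * vert K (w a) = ghost K c by rewrite -cs ghost_vert.
have fw : ghost K f * vert K (w a) = ghost K f by rewrite -fs ghost_vert.
rewrite /= !key wc cw -mulrA gw wg gw -mulrA cw ghost_edg_id cr.
move/(congr1 (fun z => ghost K f * z)); rewrite mulrA ghost_edg (negPf fc) mul0r fw => f0.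
have := vert_neq0 K (rng f); by rewrite -ghost_edg_id -f0 mul0r eqxx.
Qed.
End Corner.

(** * The socle *)

Section SocleTheory.
Local Open Scope classical_set_scope.
Local Open Scope ring_scope.

Section Reduction.
Variables (K : fieldType) (E : graph).
Local Notation L := (LPA K E).
Implicit Types (v w u : vertex E) (e c f : edge E) (x y z b : L).

Lemma gp_neq0 v q : is_path v q -> gp K v q <> 0.
Proof.
move=> p h; have := coef_gp K p p; rewrite h coef0 !eqxx => /esym/eqP.
by rewrite oner_eq0.
Qed.

Lemma gp_reduce x : x <> 0 ->
  exists v q, [/\ is_path v q, inB (gp K v q * x) & gp K v q * x <> 0].
Proof.
have [n] := Dep_ex x; elim: n x => [|n IH] x hx x0.
  apply: contrapT => h; apply: x0; rewrite -[x]mul1r LPA1 mulr_suml big1 // => v _.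
  apply: contrapT => vx; apply: h; exists v, [::]; split=> //.
  by apply: inBM => //; exact: inB_vert.
have [[e ex]|ne] := pselect (exists e, ghost K e * x <> 0).
  have [v [q [p Bq q0]]] := IH _ (proj1 hx e) ex.
  have ve : v = rng e.
    apply/eqP; apply: contrapT => /negP ve; apply: q0.
    by rewrite -[gp K v q]gp_vert // -mulrA (mulrA _ (ghost K e)) vert_ghost_neq // mul0r mulr0.
  exists (src e), (e :: q); rewrite /= eqxx -ve -mulrA; split=> //.
apply: contrapT => h; apply: x0; apply: eq0_CK2 => [e|v sv].
  by apply: contrapT => ex; apply: ne; exists e.
apply: contrapT => vx; apply: h; exists v, [::]; split=> //.
exact: (proj2 hx).
Qed.

(** The single entry b, with its exact degree, is a one-row family. A reduction may not use the row
    itself, so none exists, and [family_indep] applies. *)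
Lemma B_torsion_free u b y : inB b -> b <> 0 -> vert K u * b = b ->
  y * vert K u = y -> y * b = 0 -> y = 0.
Proof.
move=> Bb b0 ub yu yb.
have [N HN] := inB_hom_bound Bb.
have ex : exists n, hom n b != 0.
  apply: contrapT => h; apply: b0; apply: inB_hom_eq0 => // n.
  by apply/eqP; apply: contrapT => /negP hn; apply: h; exists n.
have bd n : hom n b != 0 -> (n <= N)%N.
  by case: (leqP n N) => // /ltnW/HN ->; rewrite eqxx.
have [d hd dmax] := ex_maxnP ex bd.
have F : family (fun _ : unit => u) (fun _ _ : unit => b) (fun _ : unit => d).
  split=> // _ _ n dn; apply/eqP; apply: contraTT dn => /dmax; by rewrite -leqNgt.
apply: (@family_indep K E unit unit _ _ _ F _ (fun _ => y)) tt => //.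
- move=> [] c [_ _ _ c0 /(_ tt)]; rewrite /lead big1 ?addr0 => [h|[] _]; last by rewrite c0 mul0r.
  by rewrite h eqxx in hd.
- by move=> []; rewrite (bigD1 tt) //= big1 ?addr0 // => -[].
Qed.

Lemma sink_path v w q : sink w -> is_path w q -> q = [::].
Proof. by case: q => //= e q /forallP/(_ e) /negPf ->. Qed.

(** Only the trivial path starts at a sink, so B v = K v: a nonzero product q^* x in B is a nonzero
    scalar multiple of v. *)
Lemma sink_simple v x : sink v -> x * vert K v = x -> x <> 0 ->
  exists r, r * x = vert K v.
Proof.
move=> sv xv /gp_reduce[u [q [p Bq q0]]].
have [a aE] : exists a : K, gp K u q * x = a *: vert K v.
  have H z : inB z -> exists a : K, z * vert K v = a *: vert K v.
    elim/B_ind=> [|a w s y ps _ [a' aE]]; first by exists 0; rewrite mul0r scale0r.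
    rewrite mulrDl -scaleLl aE; case: (eqVneq w v) => [wv|wv].
      move: ps; rewrite wv => /(sink_path v sv) ->; exists (a + a').
      by rewrite /= vertM_id scalerDl.
    exists a'; rewrite -[gp K w s]gp_vert // -mulrA vertM (negPf wv).
    by rewrite mulr0 scaler0 add0r.
  by have := H _ Bq; rewrite -mulrA xv.
exists (a^-1 *: gp K u q); rewrite -scaleLl aE scalerA mulVf ?scale1r //.
by apply/eqP => a0; apply: q0; rewrite aE a0 scale0r.
Qed.

Lemma sink_socle v : sink v -> socle L (vert K v).
Proof.
move=> sv; exists 1%N, (fun=> vert K v); split; last by rewrite big_ord1.
move=> _; exists [set x | x * vert K v = x]; last exact: vertM_id.
split.
- split=> [|x y hx hy|r x hx] /=; first by rewrite mul0r.
    by rewrite mulrDl hx hy.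
  by rewrite -mulrA hx.
- move=> h; have : [set x : L | x * vert K v = x] (vert K v) by exact: vertM_id.
  by rewrite h => /= /eqP; rewrite (negPf (vert_neq0 K v)).
- move=> J [J0 JD JM] Js; have [[x Jx x0]|nx] := pselect (exists2 x, J x & x <> 0).
    right; apply/seteqP; split=> // y /= <-.
    have [r <-] := sink_simple sv (Js _ Jx) x0.
    exact: (JM _ _ (JM _ _ Jx)).
  left; apply/seteqP; split=> [x Jx /=|_ -> //].
  by apply: contrapT => x0; apply: nx; exists x.
Qed.

Section NoSink.
Hypothesis ns : forall v, ~~ sink v.

(** Follow one chosen edge at each vertex; among the first #|E^0| + 1 vertices of this trail two
    coincide. *)
Lemma closed_path v : exists q c : seq (edge E), [/\ is_path v q, is_path (path_end v q) c,
  path_end (path_end v q) c = path_end v q & c <> [::]].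
Proof.
have /choice[nx nxE] : forall w, exists e, src e = w by move=> w; apply/sinkPn/ns.
pose fix tr w n := if n is n'.+1 then nx w :: tr (rng (nx w)) n' else [::].
have trP n w : is_path w (tr w n) by elim: n w => //= n IH w; rewrite nxE eqxx IH.
have size_tr n w : size (tr w n) = n by elim: n w => //= n IH w; rewrite IH.
have tr_end n m w : path_end w (tr w (n + m)%N) = path_end (path_end w (tr w n)) (tr (path_end w (tr w n)) m).
  elim: n w => [|n IH] w //.
  by rewrite addSn /= -[LHS]/(path_end (rng (nx w)) (tr (rng (nx w)) (n + m)%N)) IH.
pose g (i : 'I_(#|vertex E|.+1)) := path_end v (tr v i).
have [i [j [ij gij]]] : exists i j : 'I_(#|vertex E|.+1), (i < j)%N /\ g i = g j.
  apply: contrapT => h; suff inj : injective g.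
    by have := leq_card g inj; rewrite card_ord ltnn.
  move=> i j e; apply: val_inj; apply/eqP; rewrite eqn_leq.
  apply/andP; split; rewrite leqNgt; apply/negP => ij; apply: h.
    by exists j, i.
  by exists i, j.
exists (tr v i), (tr (g i) (j - i)%N); split=> //.
  by rewrite -tr_end subnKC ?(ltnW ij).
by move/(congr1 size); rewrite size_tr /= => /eqP; rewrite subn_eq0 leqNgt ij.
Qed.

Lemma no_minimal_left_ideal (M : set L) : ~ minimal_left_ideal M.
Proof.
case=> -[M0 MD MM] Mn0 Mmin.
have [x Mx x0] : exists2 x, M x & x <> 0.
  apply: contrapT => h; apply: Mn0; apply/seteqP; split=> [x Mx /=|_ -> //].
  by apply: contrapT => x0; apply: h; exists x.
have [v [q [p Bq q0]]] := gp_reduce x0.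
have [s [c [sp cp ce c0]]] := closed_path (path_end v q).
set u := path_end (path_end v q) s in cp ce.
pose b := gp K (path_end v q) s * (gp K v q * x).
have Mb : M b by exact: (MM _ _ (MM _ _ Mx)).
have Bb : inB b by apply: inBM => //; exact: inB_gp.
have ub : vert K u * b = b by rewrite mulrA vert_gp.
have b0 : b <> 0.
  move=> b0; apply: (gp_neq0 sp); apply: (B_torsion_free Bq q0) b0; last exact: gp_vert.
  by rewrite mulrA vert_gp.
pose z := vert K u - gp K u c.
have zu : z * vert K u = z by rewrite mulrBl vertM_id gp_vert.
have zb0 : z * b <> 0.
  (* Otherwise u would equal the ghost of c, but their coefficients at the trivial path are 1 and
     0. *)
  move/(B_torsion_free Bb b0 ub zu)/subr0_eq => h.
  have := coef_gp K (v := u) (q := [::]) isT cp; rewrite /= -h.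
  rewrite (coef_gp K (v := u) (q := [::]) (v' := u) (q' := [::])) // !eqxx /=.
  by case: (c) c0 => // e c' _ /eqP; rewrite oner_eq0.
pose N := [set r * (z * b) | r in [set: L]].
have lN : left_ideal N.
  split; first by exists 0; rewrite ?mul0r.
    by move=> _ _ [r _ <-] [r' _ <-]; exists (r + r'); rewrite ?mulrDl.
  by move=> r _ [r' _ <-]; exists (r * r'); rewrite ?mulrA.
have sN : N `<=` M by move=> _ [r _ <-]; exact: (MM _ _ (MM _ _ Mb)).
have NM : N = M.
  have [N0|//] := Mmin N lN sN.
  have : N (z * b) by exists 1; rewrite ?mul1r.
  by rewrite N0.
have : M b := Mb; rewrite -NM => -[r _ rE].
have h : vert K u - r * z = 0.
  apply: (B_torsion_free Bb b0 ub); first by rewrite mulrBl vertM_id -mulrA zu.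
  by rewrite mulrBl ub -mulrA rE subrr.
(* Both u and the closed path fix the constant function 1 at u, so z kills it. *)
have z1 : act z (fun _ _ _ => 1) = (fun _ _ _ => 0).
  apply/funext => w; apply/funext => n; apply/funext => d.
  rewrite /z -scaleN1r actD actZ act_vert act_gp // ce.
  by case: ifP => _; rewrite ?mulr1 ?mulr0 ?addr0 ?subrr.
have := congr1 (fun y => act y (fun _ _ _ => 1) u 0%N 0) (subr0_eq h).
rewrite act_vert eqxx actM z1 /act rho0 => /eqP.
by rewrite oner_eq0.
Qed.
End NoSink.
End Reduction.

Section Socle.
Variables (K : fieldType) (E : graph).
Local Notation L := (LPA K E).
Implicit Types (v w u : vertex E) (e : edge E) (S : {set vertex E}).

Definition into S : {set vertex E} :=
  [set v | [forall e, (src e == v) ==> (rng e \in S)]]%SET.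

(* The vertices from which no infinite path starts. *)
Definition finite_paths : {set vertex E} := fixset into.

Lemma intoP S v : v \in into S <-> forall e, src e = v -> rng e \in S.
Proof.
rewrite inE; split=> [/forallP h e ev|h].
  by have /implyP := h e; apply; apply/eqP.
by apply/forallP => e; apply/implyP => /eqP; exact: h.
Qed.

Lemma into_mono : {homo into : S T / S \subset T}.
Proof.
move=> S T /fintype.subsetP ST; apply/fintype.subsetP => v /intoP h.
by apply/intoP => e /h/ST.
Qed.

Lemma finite_pathsP v : v \in finite_paths <-> forall e, src e = v -> rng e \in finite_paths.
Proof. by rewrite /finite_paths -{1}(fixsetK into_mono); exact: intoP. Qed.

Lemma finite_paths_hs : hs finite_paths.
Proof.
split; last by move=> v _ h; apply/finite_pathsP.
by apply: hereditary_edge => e /finite_pathsP; apply.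
Qed.

Lemma finite_paths_min S : saturated S -> (forall v, sink v -> v \in S) ->
  finite_paths \subset S.
Proof.
move=> sS kS; rewrite /finite_paths /fixset.
elim: #|vertex E| => [|n IH] /=; first exact: finset.sub0set.
apply/fintype.subsetP => v /intoP h; have [/kS //|/sinkPn ve] := boolP (sink v).
by apply: sS => // e /h; apply/fintype.subsetP.
Qed.

Lemma quot_finite_paths_sink (u : vertex (quot_graph finite_paths)) : ~~ sink u.
Proof.
apply/sinkPn; apply: contrapT => nu; apply: (negP (valP u)).
apply/finite_pathsP => e eu.
have [//|[e' ee]] := edge_case finite_paths_hs e; case: nu; exists e'.
by apply: val_inj; rewrite /= -ee.
Qed.

Lemma minimal_left_ideal_image (A B : pzRingType) (f : {rmorphism A -> B}) (M : set A) :
  (forall y, exists x, f x = y) -> minimal_left_ideal M ->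
  (forall x, M x -> f x = 0) \/ minimal_left_ideal [set f x | x in M].
Proof.
move=> fs [[M0 MD MM] _ Mmin].
have [h|nh] := pselect (forall x, M x -> f x = 0); [by left|right; split].
- split; first by exists 0; rewrite ?rmorph0.
    by move=> _ _ [x Mx <-] [y My <-]; exists (x + y); [exact: MD|rewrite rmorphD].
  by move=> r _ [x Mx <-]; have [s <-] := fs r; exists (s * x); [exact: MM|rewrite rmorphM].
- move=> h; apply: nh => x Mx; have : [set f x | x in M] (f x) by exists x.
  by rewrite h.
move=> J [J0 JD JM] Js; pose J' := [set x | M x /\ J (f x)].
have lJ' : left_ideal J'.
  split; first by split; rewrite ?rmorph0.
    by move=> x y [Mx Jx] [My Jy]; split; rewrite ?rmorphD; [exact: MD|exact: JD].
  by move=> r x [Mx Jx]; split; rewrite ?rmorphM; [exact: MM|exact: JM].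
have sJ' : J' `<=` M by move=> x [].
have [J'0|J'M] := Mmin J' lJ' sJ'; [left|right]; apply/seteqP; split.
- move=> y Jy; have [x Mx xy] := Js y Jy.
  have : J' x by split=> //; rewrite xy.
  by rewrite J'0 => /= x0; rewrite -xy x0 rmorph0.
- by move=> _ ->.
- exact: Js.
- by move=> _ [x Mx <-]; move: Mx; rewrite -J'M => -[].
Qed.

(** The vertices in the socle form a saturated set that contains the sinks, hence all of
    [finite_paths]. Conversely a minimal left ideal goes to 0 in the algebra of the quotient graph,
    as its image would otherwise be minimal. *)
Lemma socleE x : socle L x <-> gen_ideal K finite_paths x.
Proof.
have hH := finite_paths_hs; split; last first.
  apply: (@gen_ideal_sub K E finite_paths (socle_ideal L)) => v vH.
  have [_ sS] := vset_hs (socle_ideal L).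
  apply/vsetP; move: v vH; apply/fintype.subsetP; apply: finite_paths_min sS _ => v sv.
  by apply/vsetP; exact: sink_socle.
case=> n [y [yM ->]]; apply: ideal_sum => i _.
have [M mM My] := yM i; apply/(qmap_ker hH).
pose f : {rmorphism L -> LPA K (quot_graph finite_paths)} := HB.pack (@qmap E finite_paths K)
  (GRing.isZmodMorphism.Build _ _ _ (@qmap_zmod E finite_paths K hH))
  (GRing.isMonoidMorphism.Build _ _ _ (@qmap_monoid E finite_paths K hH)).
have [h|/no_minimal_left_ideal] := minimal_left_ideal_image (f := f) (qmap_surj hH) mM.
  exact: h.
by case; exact: quot_finite_paths_sink.
Qed.

Lemma quot_socle : ring_iso (quot (socle_ideal L)) (LPA K (quot_graph finite_paths)).
Proof.
apply: ring_iso_trans (quot_gen_ideal K finite_paths_hs).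
apply: (@quot_iso_image _ _ _ _ idfun); first by exists id.
exact: socleE.
Qed.
End Socle.

Section SocleTransport.
Variables (A B : pzRingType) (f : {rmorphism A -> B}) (g : {rmorphism B -> A}).
Hypotheses (fK : cancel f g) (gK : cancel g f).

Lemma minimal_left_ideal_iso (M : set A) :
  minimal_left_ideal M -> minimal_left_ideal [set f x | x in M].
Proof.
move=> mM; have [h|//] := minimal_left_ideal_image (f := f) (fun y => ex_intro _ (g y) (gK y)) mM.
case: mM => -[M0 _ _] n0 _; case: n0; apply/seteqP; split=> [x /h fx|_ -> //].
by rewrite /= -[x]fK fx rmorph0.
Qed.

Lemma socle_iso_sub x : socle A x -> socle B (f x).
Proof.
case=> n [y [yM ->]]; exists n, (fun i => f (y i)); rewrite rmorph_sum; split=> // i.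
have [M mM My] := yM i; exists [set f x | x in M]; first exact: minimal_left_ideal_iso.
by exists (y i).
Qed.
End SocleTransport.

Lemma socle_iso (A B : pzRingType) : ring_iso A B ->
  nonunital_iso (socle A) (socle B) /\
  ring_iso (quot (socle_ideal A)) (quot (socle_ideal B)).
Proof.
case/ring_iso_inverse=> f [g [fK gK]]; split.
  exists f; split; [|by move=> x y _ _; exact: rmorphD|by move=> x y _ _; exact: rmorphM].
  split=> [x|x y _ _ /(can_inj fK) //|y sy]; first exact: socle_iso_sub.
  by exists (g y); [exact: socle_iso_sub|rewrite gK].
apply: (@quot_iso_image _ _ _ _ f); first by exists g.
move=> x; split; first exact: socle_iso_sub.
by move/(socle_iso_sub gK fK); rewrite fK.
Qed.

End SocleTheory.

(** * Graded ideals *)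

Section GradedTheory.
Local Open Scope classical_set_scope.
Local Open Scope ring_scope.

Section Degree.
Variables (K : fieldType) (E : graph).
Local Notation L := (LPA K E).
Implicit Types (v w u : vertex E) (e f : edge E) (x y : L) (n m : int) (p q : seq (edge E)).

(* x shifts the third coordinate of the representation by n. *)
Definition shifts n x : Prop := forall (f g : fspace K E) w k d,
  (forall v j, f v j (d - n) = g v j (d - n)) -> act x f w k d = act x g w k d.

Lemma shifts0 n : shifts n 0.
Proof. by move=> f g w k d _; rewrite !act0. Qed.
Lemma shiftsD n x y : shifts n x -> shifts n y -> shifts n (x + y).
Proof. by move=> hx hy f g w k d h; rewrite !actD (hx f g) // (hy f g). Qed.
Lemma shiftsZ n a x : shifts n x -> shifts n (a *: x).
Proof. by move=> hx f g w k d h; rewrite !actZ (hx f g). Qed.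
Lemma shiftsM n m x y : shifts n x -> shifts m y -> shifts (n + m) (x * y).
Proof.
move=> hx hy f g w k d h; rewrite !actM; apply: hx => v j.
by apply: hy => u i; rewrite -addrA -opprD h.
Qed.
Lemma shifts_vert v : shifts 0 (vert K v).
Proof. by move=> f g w k d h; rewrite !act_vert; case: ifP => // _; rewrite -[d]subr0 h. Qed.
Lemma shifts_edg e : shifts 1 (edg K e).
Proof. by move=> f g w k d h; rewrite !act_edg h. Qed.
Lemma shifts_ghost e : shifts (-1) (ghost K e).
Proof. by move=> f g w k d h; rewrite !act_ghost -[d + 1]/(d + 1) -[1]opprK h. Qed.

Lemma shifts_gp v q : shifts (- (size q)%:Z) (gp K v q).
Proof.
elim: q v => [|e q IH] v /=; first exact: shifts_vert.
by rewrite -addn1 PoszD opprD; apply: shiftsM; [exact: IH|exact: shifts_ghost].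
Qed.

Lemma shifts_coef n x v q : shifts n x -> coef v q x <> 0 -> n = - (size q)%:Z.
Proof.
move=> hx c; apply/eqP; apply: contrapT => /negP nq; apply: c.
rewrite -(coef0 K v q) /coef act0 (hx _ (fun _ _ _ => 0)) /act ?rho0 // => u j.
rewrite /delta sub0r; case: eqP => // _; case: eqP => // _; case: eqP => //= h.
by rewrite -h opprK eqxx in nq.
Qed.

Fixpoint pe v p : L := if p is e :: p' then edg K e * pe (rng e) p' else vert K v.

Lemma vert_pe v p : is_path v p -> vert K v * pe v p = pe v p.
Proof.
case: p => [|e p] /=; first by rewrite vertM_id.
by case/andP=> /eqP <- _; rewrite mulrA vert_edg.
Qed.

Lemma gp_pe v q w p : is_path v q -> is_path w p -> size q = size p ->
  gp K v q * pe w p = if (v == w) && (q == p) then vert K (path_end v q) else 0.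
Proof.
elim: q v w p => [|e q IH] v w [|f p] //=.
  by move=> _ _ _; rewrite vertM andbT.
case/andP=> /eqP ev pq /andP[/eqP fw pp] [sz].
rewrite -mulrA (mulrA (ghost K e)) ghost_edg; case: (eqVneq e f) => [ef|ef]; last first.
  by rewrite mul0r mulr0 eqseq_cons (negPf ef) andbF.
rewrite -ev -fw ef !eqxx /= -ef vert_pe ?ef // -?ef (IH _ (rng e)) ?eqxx //=.
  by rewrite eqseq_cons eqxx.
by rewrite ef.
Qed.

(** By [shifts_coef] all ghost paths in x have the same length; right multiplication by the path of
    one of them kills the others by CK1. *)
Lemma shifts_B_vert n x : inB x -> shifts n x -> x <> 0 ->
  exists u r, x * r = vert K u.
Proof.
move=> Bx hx x0.
have [v [q [p c]]] : exists v q, is_path v q /\ coef v q x <> 0.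
  apply: contrapT => h; apply: x0; apply: inB_coef_eq0 => // v q p.
  by apply: contrapT => c; apply: h; exists v, q.
have nE := shifts_coef hx c.
have xE : homog (size q) x.
  apply: esym; have [N HN] := inB_hom_bound Bx.
  have h (k : nat) : k != size q -> hom k x = 0.
    move=> kq; rewrite /hom big1 // => -[u t] /= pt; case: (eqVneq (coef u t x) 0) => [->|].
      by rewrite scale0r.
    move/eqP/(shifts_coef hx); rewrite nE => /oppr_inj [sq].
    by rewrite sq size_tuple eqxx in kq.
  rewrite {1}(inB_sum_hom Bx HN); case: (ltnP (size q) N) => qN.
    by rewrite (bigD1 (Ordinal qN)) //= big1 ?addr0 // => i /negPf iq; apply: h; rewrite -val_eqE /= in iq; rewrite iq.
  by rewrite big1 ?HN // => i _; apply: h; rewrite neq_ltn (leq_trans (ltn_ord i) qN).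
exists (path_end v q), ((coef v q x)^-1 *: pe v q).
rewrite -scaleLr -{2}xE /hom mulr_suml.
rewrite (bigD1 (v, in_tuple q)) //= big1 ?addr0; last first.
  move=> [w t] /= /andP[pt ne]; rewrite -scaleLl gp_pe ?size_tuple //.
  case: ifP; last by rewrite scaler0.
  case/andP=> /eqP wv /eqP tq; case/negP: ne; apply/eqP; congr (_, _) => //.
  exact: val_inj.
rewrite -scaleLl gp_pe // !eqxx /= scalerA mulVf ?scale1r //.
exact/eqP.
Qed.
End Degree.

Section Graded.
Variables (K : fieldType) (E : graph).
Local Notation L := (LPA K E).
Local Notation deg := (@degree_component K E).
Implicit Types (v w u : vertex E) (e f : edge E) (x y : L) (n m : int) (p q : seq (edge E)).

Lemma path_eltE v p : is_path v p -> path_elt K v p = pe K v p.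
Proof.
rewrite /path_elt; elim: p v => [|e p IH] v /=; first by rewrite big_nil mulr1.
case/andP=> /eqP <- pp; rewrite big_cons mulrA vert_edg -IH // mulrA edg_vert.
by [].
Qed.

Lemma ghost_eltE w q : is_path w q -> ghost_elt K w q = gp K w q.
Proof.
rewrite /ghost_elt; elim: q w => [|e q IH] w /=; first by rewrite big_nil mul1r.
case/andP=> /eqP <- pq; rewrite rev_cons -cats1 big_cat big_seq1 /= -mulrA ghost_vert.
by rewrite -IH // -mulrA vert_ghost.
Qed.

Lemma degD n x y : deg n x -> deg n y -> deg n (x + y).
Proof.
move=> [m [k [p [q [h1 h2 ->]]]]] [m' [k' [p' [q' [h1' h2' ->]]]]].
pose s T (a : 'I_m -> T) (b : 'I_m' -> T) i :=
  match fintype.split i with inl j => a j | inr j => b j end.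
exists (m + m')%N, (s _ k k'), (s _ p p'), (s _ q q'); rewrite /s; split.
- by move=> i; case: (fintype.split i).
- by move=> i; case: (fintype.split i).
rewrite big_split_ord /=; congr (_ + _); apply: eq_bigr => i _.
  by rewrite (unsplitK (inl i)).
by rewrite (unsplitK (inr i)).
Qed.

Lemma degZ n a x : deg n x -> deg n (a *: x).
Proof.
move=> [m [k [p [q [h1 h2 ->]]]]]; exists m, (fun i => a * k i), p, q; split=> //.
by rewrite scaler_sumr; apply: eq_bigr => i _; rewrite scalerA.
Qed.

Lemma deg_mono v p w q : is_path v p -> is_path w q ->
  deg ((size p)%:Z - (size q)%:Z) (pe K v p * gp K w q).
Proof.
move=> pp pq; exists 1%N, (fun=> 1), (fun=> (v, p)), (fun=> (w, q)); split=> //.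
by rewrite big_ord1 scale1r path_eltE // ghost_eltE.
Qed.

Lemma deg0 n : deg n 0.
Proof.
exists 0%N; have h T : 'I_0 -> T by case.
by exists (h K), (h _), (h _); split=> [[]|[]|] //; rewrite big_ord0.
Qed.

Lemma deg_ind n x (P : L -> Prop) : P 0 ->
  (forall a y z, P y -> P z -> P (a *: y + z)) ->
  (forall v p w q, is_path v p -> is_path w q -> (size p)%:Z - (size q)%:Z = n ->
    P (pe K v p * gp K w q)) -> deg n x -> P x.
Proof.
move=> P0 PD Pm [m [k [p [q [h1 h2 ->]]]]].
apply: (big_ind P) => // [y z Py Pz|i _]; first by rewrite -[y]scale1r; apply: PD.
rewrite -[X in P X]addr0; apply: PD => //.
by case: (h1 i) => pp pq; rewrite path_eltE // ghost_eltE //; apply: Pm.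
Qed.

Lemma deg_mull (g : L) n m x :
  (forall v p w q, is_path v p -> is_path w q ->
    deg (m + ((size p)%:Z - (size q)%:Z)) (g * (pe K v p * gp K w q))) ->
  deg n x -> deg (m + n) (g * x).
Proof.
move=> H; elim/deg_ind=> [|a y z hy hz|v p w q pp pq <-]; last exact: H.
  by rewrite mulr0; exact: deg0.
by rewrite mulrDr -scaleLr; apply: degD => //; exact: degZ.
Qed.

Lemma deg_mulr (g : L) n m x :
  (forall v p w q, is_path v p -> is_path w q ->
    deg (((size p)%:Z - (size q)%:Z) + m) (pe K v p * gp K w q * g)) ->
  deg n x -> deg (n + m) (x * g).
Proof.
move=> H; elim/deg_ind=> [|a y z hy hz|v p w q pp pq <-]; last exact: H.
  by rewrite mul0r; exact: deg0.
by rewrite mulrDl -scaleLl; apply: degD => //; exact: degZ.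
Qed.

Lemma deg_vertl u n x : deg n x -> deg n (vert K u * x).
Proof.
rewrite -[n in deg n (_ * _)]add0r; apply: deg_mull => v p w q pp pq.
rewrite add0r mulrA -[pe K v p]vert_pe // mulrA vertM.
case: eqP => [->|_]; last by rewrite !mul0r; exact: deg0.
by rewrite vert_pe //; exact: deg_mono.
Qed.

Lemma deg_edgl e n x : deg n x -> deg (1 + n) (edg K e * x).
Proof.
apply: deg_mull => v p w q pp pq.
rewrite mulrA -[pe K v p]vert_pe // mulrA; case: (eqVneq (rng e) v) => [ev|ev]; last first.
  by rewrite edg_vert_neq // !mul0r; exact: deg0.
rewrite -ev edg_vert addrA; apply: (@deg_mono (src e) (e :: p)) => //=.
by rewrite eqxx ev.
Qed.

Lemma deg_ghostl e n x : deg n x -> deg (- 1 + n) (ghost K e * x).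
Proof.
apply: deg_mull => v [|f p] w q pp pq /=.
  rewrite mulrA; case: (eqVneq (src e) v) => [<-|ev]; last first.
    by rewrite ghost_vert_neq // mul0r; exact: deg0.
  rewrite ghost_vert ghost_gp //; case: eqP => [ee|_]; last exact: deg0.
  have := @deg_mono (rng e) [::] w (rcons q e) isT.
  rewrite is_path_rcons pq ee eqxx size_rcons /= => /(_ isT).
  rewrite -[X in vert K X](path_end_rcons w q e) vert_gp !sub0r -addn1 PoszD opprD addrC.
  by [].
case/andP: pp => /eqP fv pp; rewrite !mulrA ghost_edg; case: ifP => [/eqP ->|_]; last first.
  by rewrite !mul0r; exact: deg0.
have -> : (-1 + ((size p).+1%:Z - (size q)%:Z) = (size p)%:Z - (size q)%:Z)%R by lia.
by rewrite vert_pe //; exact: deg_mono.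
Qed.

Lemma deg_vertr u n x : deg n x -> deg n (x * vert K u).
Proof.
rewrite -[n in deg n (_ * _)]addr0; apply: deg_mulr => v p w q pp pq.
rewrite addr0 -mulrA -[gp K w q]gp_vert // -mulrA vertM.
case: eqP => _; last by rewrite !mulr0; exact: deg0.
by rewrite gp_vert //; exact: deg_mono.
Qed.

Lemma deg_ghostr e n x : deg n x -> deg (n - 1) (x * ghost K e).
Proof.
apply: deg_mulr => v p w q pp pq.
rewrite -mulrA -[gp K w q]gp_vert // -mulrA; case: (eqVneq w (rng e)) => [ev|ev]; last first.
  by rewrite vert_ghost_neq // !mulr0; exact: deg0.
have := @deg_mono v p (src e) (e :: q) pp; rewrite /= eqxx -ev pq => /(_ isT).
have -> : ((size p)%:Z - (size q).+1%:Z = (size p)%:Z - (size q)%:Z - 1)%R by lia.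
by rewrite ev vert_ghost.
Qed.

Lemma pe_rcons v p e : is_path v p -> path_end v p = src e ->
  pe K v p * edg K e = pe K v (rcons p e).
Proof.
elim: p v => [|f p IH] v /=; first by move=> _ h; rewrite [v]h vert_edg edg_vert.
case/andP=> _ pp h; rewrite -mulrA; congr (_ * _); exact: IH.
Qed.

Lemma pe_end v p : is_path v p -> pe K v p * vert K (path_end v p) = pe K v p.
Proof.
elim: p v => [|e p IH] v /=; first by rewrite vertM_id.
by case/andP=> _ pp; rewrite -mulrA -[in RHS]IH.
Qed.

Lemma deg_edgr e n x : deg n x -> deg (n + 1) (x * edg K e).
Proof.
apply: deg_mulr => v p w [|f q] pp pq /=.
  rewrite -mulrA; case: (eqVneq w (src e)) => [->|ev]; last first.
    by rewrite vert_edg_neq // mulr0; exact: deg0.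
  rewrite vert_edg -[pe K v p]pe_end // -mulrA.
  case: (eqVneq (path_end v p) (src e)) => [pe|pe]; last first.
    by rewrite vert_edg_neq // mulr0; exact: deg0.
  rewrite pe vert_edg pe_rcons //.
  have := @deg_mono v (rcons p e) (rng e) [::]; rewrite is_path_rcons pp pe eqxx /=.
  move=> /(_ isT isT); rewrite -pe_rcons // -mulrA edg_vert size_rcons.
  by have -> : ((size p).+1%:Z - 0 = (size p)%:Z - 0 + 1)%R by lia.
case/andP: pq => /eqP fv pq; rewrite -!mulrA ghost_edg; case: ifP => [/eqP fe|_]; last first.
  by rewrite !mulr0; exact: deg0.
have -> : ((size p)%:Z - (size q).+1%:Z + 1 = (size p)%:Z - (size q)%:Z)%R by lia.
by rewrite gp_vert //; exact: deg_mono.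
Qed.

(** These elements form an ideal, since multiplication by a generator of L maps each degree
    component into another one. *)
Definition homogeneous_sum (J : ideal L) x : Prop := exists (k : nat) (y : 'I_k -> L),
  (forall i, J (y i) /\ exists n, deg n (y i)) /\ x = \sum_i y i.

Lemma homogeneous_sum0 J : homogeneous_sum J 0.
Proof. by exists 0%N, (fun=> 0); rewrite big_ord0; split=> // -[]. Qed.

Lemma homogeneous_sumD J x y :
  homogeneous_sum J x -> homogeneous_sum J y -> homogeneous_sum J (x + y).
Proof.
move=> [n [u [uP ->]]] [m [v [vP ->]]].
exists (n + m)%N,
  (fun k => match fintype.split k with inl i => u i | inr j => v j end); split.
  by move=> k; case: (fintype.split k).
rewrite big_split_ord /=; congr (_ + _); apply: eq_bigr => i _.
  by rewrite (unsplitK (inl i)).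
by rewrite (unsplitK (inr i)).
Qed.

Lemma homogeneous_sum_map (J : ideal L) (h : L -> L) x :
  (forall I (r : seq I) (P : pred I) F,
     h (\sum_(i <- r | P i) F i) = \sum_(i <- r | P i) h (F i)) ->
  (forall y, J y -> J (h y)) -> (forall y n, deg n y -> exists m, deg m (h y)) ->
  homogeneous_sum J x -> homogeneous_sum J (h x).
Proof.
move=> hs hJ hd [n [u [uP ->]]]; exists n, (fun i => h (u i)); split=> [i|]; last exact: hs.
by have [Ju [m /hd]] := uP i; split=> //; exact: hJ.
Qed.

Lemma homogeneous_sumZ J a x : homogeneous_sum J x -> homogeneous_sum J (a *: x).
Proof.
apply: homogeneous_sum_map => [I r P F|y|y n].
- by rewrite scaler_sumr.
- exact: idealZ.
- by exists n; exact: degZ.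
Qed.

Lemma homogeneous_sum_mull J r x : homogeneous_sum J x -> homogeneous_sum J (r * x).
Proof.
elim/LPA_ind: r x => [v|e|e||r s hr hs|r hr|a r hr|r s hr hs] x hx.
- apply: homogeneous_sum_map hx => [I t P F|y|y n]; [exact: mulr_sumr|exact: idealMl|].
  by exists n; exact: deg_vertl.
- apply: homogeneous_sum_map hx => [I t P F|y|y n]; [exact: mulr_sumr|exact: idealMl|].
  by exists (1 + n); exact: deg_edgl.
- apply: homogeneous_sum_map hx => [I t P F|y|y n]; [exact: mulr_sumr|exact: idealMl|].
  by exists (-1 + n); exact: deg_ghostl.
- by rewrite mul0r; exact: homogeneous_sum0.
- by rewrite mulrDl; apply: homogeneous_sumD; [exact: hr|exact: hs].
- by rewrite mulNr -scaleN1r; apply/homogeneous_sumZ/hr.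
- by rewrite -scaleLl; apply/homogeneous_sumZ/hr.
- by rewrite -mulrA; apply/hr/hs.
Qed.

Lemma homogeneous_sum_mulr J r x : homogeneous_sum J x -> homogeneous_sum J (x * r).
Proof.
elim/LPA_ind: r x => [v|e|e||r s hr hs|r hr|a r hr|r s hr hs] x hx.
- apply: (homogeneous_sum_map (h := fun x => x * vert K v)) hx => [I t P F|y|y n];
    [exact: mulr_suml|exact: idealMr|by exists n; exact: deg_vertr].
- apply: (homogeneous_sum_map (h := fun x => x * edg K e)) hx => [I t P F|y|y n];
    [exact: mulr_suml|exact: idealMr|by exists (n + 1); exact: deg_edgr].
- apply: (homogeneous_sum_map (h := fun x => x * ghost K e)) hx => [I t P F|y|y n];
    [exact: mulr_suml|exact: idealMr|by exists (n - 1); exact: deg_ghostr].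
- by rewrite mulr0; exact: homogeneous_sum0.
- by rewrite mulrDr; apply: homogeneous_sumD; [exact: hr|exact: hs].
- by rewrite mulrN -scaleN1r; apply/homogeneous_sumZ/hr.
- by rewrite -scaleLr; apply/homogeneous_sumZ/hr.
- by rewrite mulrA; apply/hs/hr.
Qed.

(** The sums of homogeneous elements of I(H) form an ideal that contains H, because vertices are
    homogeneous. *)
Lemma gen_ideal_graded (H : {set vertex E}) : graded_ideal (gen_ideal K H).
Proof.
pose J := @Ideal L (homogeneous_sum (gen_ideal K H)) (homogeneous_sum0 _)
  (@homogeneous_sumD _) (@homogeneous_sum_mull _) (@homogeneous_sum_mulr _).
move=> x; apply: (@gen_ideal_sub K E H J) => v vH.
exists 1%N, (fun=> vert K v); rewrite big_ord1; split=> // _; split.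
  by move=> J' hJ'; exact: hJ'.
by exists 0; have := @deg_mono v [::] v [::] isT isT; rewrite /= vertM_id.
Qed.

(** This takes the place of a direct sum decomposition into degree components, which are defined as
    spans: acting as a shift is a consequence of homogeneity that can be tested on coefficients. *)
Lemma qmap_shifts (H : {set vertex E}) n y : hs H -> deg n y -> shifts n (qmap H y).
Proof.
move=> hH; have O := rel_ok_quot K hH.
have qv v : shifts 0 (qvert H K v).
  by rewrite /qvert; case: insub => [u|]; [exact: shifts_vert|exact: shifts0].
have qe e : shifts 1 (qedg H K e).
  by rewrite /qedg; case: insub => [u|]; [exact: shifts_edg|exact: shifts0].
have qg e : shifts (-1) (qghost H K e).
  by rewrite /qghost; case: insub => [u|]; [exact: shifts_ghost|exact: shifts0].
have qp v p : shifts (size p)%:Z (qmap H (pe K v p)).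
  elim: p v => [|e p IH] v /=; first by rewrite qmap_vert //; exact: qv.
  rewrite [qmap _ _](liftM O) (lift_edg O) -add1n PoszD.
  by apply: shiftsM; [exact: qe|exact: IH].
have qq w q : shifts (- (size q)%:Z) (qmap H (gp K w q)).
  elim: q w => [|e q IH] w /=; first by rewrite qmap_vert //; exact: qv.
  rewrite [qmap _ _](liftM O) (lift_ghost O) -addn1 PoszD opprD.
  by apply: shiftsM; [exact: IH|exact: qg].
elim/deg_ind=> [|a x z hx hz|v p w q _ _ <-].
- by rewrite [qmap _ _](lift0 O); exact: shifts0.
- by rewrite [qmap _ _](liftD O) (liftZ O); apply: shiftsD => //; exact: shiftsZ.
- by rewrite [qmap _ _](liftM O); apply: shiftsM; [exact: qp|exact: qq].
Qed.

(** If a homogeneous y in J were nonzero modulo I([vset J]), then by [gp_reduce] and [shifts_B_vert]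
    some s y t would be congruent to a vertex outside [vset J]; but that vertex would lie in J. *)
Lemma graded_ideal_gen (J : ideal L) x :
  graded_ideal J -> J x -> gen_ideal K (vset J) x.
Proof.
move=> gJ /gJ [m [y [yP ->]]]; apply: ideal_sum => i _.
have [Jy [n dn]] := yP i; have hH := vset_hs J.
apply/(qmap_ker hH); apply: contrapT => y0.
have [v [q [pq Bq q0]]] := gp_reduce y0.
have := shiftsM (@shifts_gp K _ v q) (qmap_shifts hH dn).
case/(shifts_B_vert Bq)=> // u [r ur].
have [s sE] := qmap_surj hH (gp K v q); have [t tE] := qmap_surj hH r.
have O := rel_ok_quot K hH.
apply: (negP (valP u)); apply/vsetP.
have h : qmap (vset J) (s * y i * t - vert K (val u)) = 0.
  rewrite (qmap_zmod (K := K) hH) qmap_vert // qvert_val -ur.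
  rewrite [X in X - _](liftM O) [X in X * _ - _](liftM O).
  by rewrite [X in X * _ * _ - _]sE [X in _ * X - _]tE subrr.
have JH z : gen_ideal K (vset J) z -> J z by apply: gen_ideal_sub => w /vsetP.
have /JH := (qmap_ker (K := K) hH _).2 h.
have : J (s * y i * t) by apply/idealMr/idealMl.
by move=> a b; rewrite -[vert K _](subKr (s * y i * t)); apply: idealB.
Qed.

Lemma gen_ideal_nontrivial (H : {set vertex E}) : hs H ->
  nontrivial_graded_ideal (gen_ideal K H) <-> (H != finset.set0) && (H != [set: vertex E]%SET).
Proof.
move=> hH; split=> [[_ n0 nT]|/andP[H0 HT]].
  apply/andP; split; apply/eqP => HE.
    apply: n0; apply/seteqP; split=> [x|_ ->]; last exact: ideal0.
    move=> gx; apply/zero_idealE; apply: gen_ideal_sub gx => v.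
    by rewrite HE inE.
  apply: nT; apply/seteqP; split=> // x _; rewrite -[x]mulr1; apply: idealMl.
  by rewrite LPA1; apply: ideal_sum => v _; apply/(vert_gen_ideal K hH); rewrite HE inE.
split; first exact: gen_ideal_graded.
  move=> h; case/finset.set0Pn: H0 => v /(vert_gen_ideal K hH).
  by rewrite h => /eqP; rewrite (negPf (vert_neq0 K v)).
move=> h; case/negP: HT; apply/eqP/setP => v; rewrite [RHS]inE; apply/(vert_gen_ideal K hH).
by rewrite h.
Qed.
End Graded.

Lemma gen_ideal_only (K : fieldType) (E : graph) (H : {set vertex E}) : hs H ->
  (forall H', (hs H' /\ H' != finset.set0 /\ H' != [set: vertex E]%SET) <-> H' = H) ->
  only_nontrivial_graded_ideal (gen_ideal K H).
Proof.
move=> hH uH; split.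
  by apply/(gen_ideal_nontrivial K hH)/andP; case: (proj2 (uH H) erefl).
move=> J nJ; have hJ := vset_hs J.
have JE : ideal_set J = ideal_set (gen_ideal K (vset J)).
  apply/seteqP; split=> x; first by apply: graded_ideal_gen; case: nJ.
  by apply: gen_ideal_sub => w /vsetP.
have JH : nontrivial_graded_ideal (gen_ideal K (vset J)).
  by case: nJ => _; rewrite JE => a b; split=> //; exact: gen_ideal_graded.
rewrite JE (proj1 (uH (vset J))) //; split=> //.
by apply/andP/(gen_ideal_nontrivial K hJ).
Qed.

Lemma hs_set0 (E : graph) : hs (finset.set0 : {set vertex E}).
Proof.
split=> [v w|v [e ev] h]; first by rewrite inE.
by have := h e ev; rewrite inE.
Qed.

Lemma hs_setT (E : graph) : hs ([set: vertex E]%SET).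
Proof. by split=> v; rewrite ?inE. Qed.

Lemma only_hs (E : graph) : #|hsets E| = 3%N -> (0 < #|vertex E|)%N ->
  exists2 H : {set vertex E}, hs H & forall H', (hs H' /\ H' != finset.set0 /\ H' != [set: vertex E]%SET) <-> H' = H.
Proof.
move=> c3 V0.
have n0T : finset.set0 != [set: vertex E]%SET.
  by rewrite eq_sym -card_gt0 cardsT.
have c : #|hsets E :\: [set finset.set0; [set: vertex E]]%SET| = 1%N.
  have := cardsID [set finset.set0; [set: vertex E]]%SET (hsets E).
  rewrite c3 (finset.setIidPr _) ?cards2 ?n0T; last first.
    apply/fintype.subsetP => X; rewrite finset.in_set2 => /orP[] /eqP ->; apply/hsetsP.
      exact: hs_set0.
    exact: hs_setT.
  by move=> [].
have /cards1P[H HE] : #|hsets E :\: [set finset.set0; [set: vertex E]]%SET| == 1%N by rewrite c.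
have key H' : (hs H' /\ H' != finset.set0 /\ H' != [set: vertex E]%SET) <-> H' = H.
  have : (H' \in hsets E :\: [set finset.set0; [set: vertex E]]%SET) = (H' == H) by rewrite HE inE.
  rewrite finset.in_setD finset.in_set2 negb_or -andbA => e; split.
    case=> /hsetsP h [h0 hT]; apply/eqP; by rewrite -e h0 hT h.
  by move/eqP; rewrite -e => /and3P[h0 hT /hsetsP h].
by exists H => //; case: (proj2 (key H) erefl).
Qed.

Lemma quot_graded_iso (K : fieldType) (E F : graph) : (0 < #|vertex E|)%N ->
  ring_iso (LPA K E) (LPA K F) -> #|hsets E| = 3%N -> #|hsets F| = 3%N ->
  exists (I : ideal (LPA K E)) (J : ideal (LPA K F)),
    [/\ only_nontrivial_graded_ideal I, only_nontrivial_graded_ideal J &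
        ring_iso (quot I) (quot J)].
Proof.
move=> V0 iso cE cF; have [f [Phi [bf P]]] := hs_transport iso.
have [H hH uH] := only_hs cE V0; have [hPH PH] := P H hH.
have VF : (0 < #|vertex F|)%N.
  rewrite lt0n; apply/eqP => VF.
  have : (#|hsets F| <= #|{set vertex F}|)%N by exact: max_card.
  by rewrite cF -cardsT -powersetT card_powerset cardsT VF.
have [H' hH' uH'] := only_hs cF VF.
have e : Phi H = H'.
  apply/(uH' (Phi H)); split=> //; apply/andP/(gen_ideal_nontrivial K hPH); split.
  - exact: gen_ideal_graded.
  - have [_ [H0 _]] := proj2 (uH H) erefl.
    case/finset.set0Pn: H0 => v /(vert_gen_ideal K hH)/PH fv h.
    have : [set (0 : LPA K F)] (f (vert K v)) by rewrite -h.
    case: bf => g fK _ /= /(congr1 g); rewrite fK -(rmorph0 f) fK => /eqP.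
    by rewrite (negPf (vert_neq0 K v)).
  - move=> h; have [_ [_ /negP]] := proj2 (uH H) erefl; apply.
    apply/eqP/setP => v; rewrite [RHS]inE; apply/(vert_gen_ideal K hH)/PH.
    by rewrite h.
exists (gen_ideal K H), (gen_ideal K (Phi H)); split.
- exact: gen_ideal_only.
- by apply: gen_ideal_only => //; rewrite e.
- exact: quot_iso_image bf PH.
Qed.

End GradedTheory.

(** * Computation of the invariants *)

Section Tables.
Local Open Scope nat_scope.
Variable s : seq nat.

Definition adj (i j : nat) : bool := 10 * i.+1 + j.+1 \in s.
Definition i3 : seq nat := iota 0 3.
Definition triples (T : Type) (l : seq T) : seq (seq T) :=
  [seq a :: c | a <- l, c <- [seq [:: b; c] | b <- l, c <- l]].
Definition bool3 : seq bitseq := triples [:: false; true].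
Definition nat3 : seq (seq nat) := triples (iota 0 12).

Definition hs_tab (h : bitseq) : bool :=
  all (fun i => all (fun j => nth false h i && adj i j ==> nth false h j) i3) i3 &&
  all (fun i => has (adj i) i3 && all (fun j => adj i j ==> nth false h j) i3 ==>
                nth false h i) i3.

Definition harm_tab (t : seq nat) : bool :=
  all (fun i => has (adj i) i3 ==>
    (nth 0 t i == (sumn [seq if adj i j then nth 0 t j else 0 | j <- i3]) %% 12)) i3.

Definition van_tab (h : bitseq) (t : seq nat) : bool :=
  all (fun i => nth false h i ==> (nth 0 t i == 0)) i3.

Definition into_tab (h : bitseq) : bitseq :=
  [seq all (fun j => adj i j ==> nth false h j) i3 | i <- i3].
Definition fin_tab : bitseq := iter 3 into_tab [:: false; false; false].

(** The table of [key]: a function on a quotient graph appears as one that vanishes on H, and a set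
    of the quotient graph as one that contains [fin_tab]. *)
Definition key_tab : seq nat :=
  let H := [seq t <- nat3 | harm_tab t] in
  let H0 := [seq t <- H | sumn t %% 12 == 0] in
  [:: count hs_tab bool3; size H0; count (van_tab fin_tab) H0;
      sumn [seq if hs_tab h && all (fun i => nth false fin_tab i ==> nth false h i) i3
                then count (van_tab h) H else 0 | h <- bool3]].

(** On three vertices paths of length at most 2 suffice; the last clause of [tables_root] checks
    that a further edge leads to nothing new. *)
Definition reach_tab (i j : nat) : bool :=
  [|| i == j, adj i j | has (fun k => adj i k && adj k j) i3].
Definition mt3_tab : bool :=
  all (fun i => all (fun j => has (fun k => reach_tab i k && reach_tab j k) i3) i3) i3.

Definition seqs1 : seq (seq nat) := [seq [:: a] | a <- i3].
Definition seqs2 : seq (seq nat) := [seq a :: c | a <- i3, c <- seqs1].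
Definition seqs3 : seq (seq nat) := [seq a :: c | a <- i3, c <- seqs2].
Definition cycles_tab : seq (seq nat) := [seq c <- seqs1 ++ seqs2 ++ seqs3 | uniq c].
(** Without parallel edges a cycle is given by its vertices, and it has an exit exactly if one of
    them has two out-neighbours. *)
Definition condL_tab : bool :=
  all (fun c => cycle adj c ==> has (fun i => 1 < count (adj i) i3) c) cycles_tab.

Definition iln_tab : nat :=
  count (fun u => adj u u && all (fun i => all (fun j =>
    adj i j && ((i == u) || (j == u)) ==> (i == u) && (j == u)) i3) i3) i3.
End Tables.

(* The two representatives that the keys do not separate. *)
Definition special : seq (seq nat) :=
  [:: [:: 11; 12; 22; 32]; [:: 11; 12; 13; 22; 23; 32; 33]]%N.

Lemma key_separates :
  let ks := [seq (m, key_tab (mk m)) | m <- root_masks] in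
  all (fun x => all (fun y => (x.2 == y.2) ==> (x.1 == y.1) ||
    ((mk x.1 \in special) && (mk y.1 \in special))) ks) ks.
Proof. by vm_compute. Qed.

(** ILN and MT3+L agree with their values at the representative; this is what makes them invariants
    of the algebra. *)
Lemma tables_root : all (fun m => [&& iln_tab (mk m) == iln_tab (mk (root m)),
  mt3_tab (mk m) && condL_tab (mk m) == mt3_tab (mk (root m)) && condL_tab (mk (root m)) &
  all (fun i => all (fun j => all (fun k => reach_tab (mk m) i j && adj (mk m) j k ==>
    reach_tab (mk m) i k) i3) i3) i3]) (iota 0 512).
Proof. by vm_compute. Qed.

Lemma all_i3P (P : pred nat) : reflect (forall i : 'I_3, P i) (all P i3).
Proof.
apply: (iffP allP) => [h i|h i]; first by apply: h; rewrite mem_iota; exact: ltn_ord.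
by rewrite mem_iota => lt3; exact: (h (Ordinal lt3)).
Qed.

Lemma has_i3P (P : pred nat) : reflect (exists i : 'I_3, P i) (has P i3).
Proof.
apply: (iffP hasP) => [[i]|[i Pi]]; last first.
  by exists (i : nat) => //; rewrite mem_iota; exact: ltn_ord.
by rewrite mem_iota => lt3 Pi; exists (Ordinal lt3).
Qed.

Lemma map_o3 : [seq val i | i <- o3] = i3. Proof. by []. Qed.

Lemma enum_o3 : enum 'I_3 = o3.
Proof. by apply: (inj_map val_inj); rewrite val_enum_ord. Qed.

Lemma card_i3 (P : pred nat) : #|[set i : 'I_3 | P i]| = count P i3.
Proof.
rewrite cardsE cardE -map_o3 count_map -enum_o3 -size_filter enumT; congr size.
Qed.

Lemma mem_triples (T : eqType) (l t : seq T) : t \in triples l <->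
  exists a b c, [/\ a \in l, b \in l, c \in l & t = [:: a; b; c]].
Proof.
split.
  case/allpairsP=> [[a u]] /= [al /allpairsP[[b c] /= [bl cl ->]] ->].
  by exists a, b, c.
move=> [a [b [c [al bl cl ->]]]]; apply: allpairs_f => //; exact: allpairs_f.
Qed.

(** * Correctness of the tables *)

Section Tabulate.
Variables (T : finType) (X : eqType) (f : T -> X) (l : seq X).
Hypotheses (f_inj : injective f) (l_uniq : uniq l).
Hypotheses (f_in : forall x, f x \in l) (f_onto : forall y, y \in l -> exists x, f x = y).

Lemma perm_tab : perm_eq [seq f x | x <- enum T] l.
Proof.
apply: uniq_perm => //; first by rewrite map_inj_uniq ?enum_uniq.
move=> y; apply/mapP/idP => [[x _ ->] //|/f_onto[x <-]].
by exists x; rewrite ?mem_enum.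
Qed.

Lemma card_tab (P : pred T) (Q : pred X) : (forall x, P x = Q (f x)) ->
  #|[set x | P x]| = count Q l.
Proof.
move=> PQ; rewrite -(permP perm_tab) count_map cardsE cardE {1}/enum_mem -enumT size_filter.
by apply: eq_count => x /=; rewrite -PQ.
Qed.

Lemma sum_tab (F : X -> nat) : (\sum_x F (f x) = sumn [seq F y | y <- l])%N.
Proof.
rewrite sumnE big_map -(perm_big _ perm_tab) big_map /= big_enum /=.
by [].
Qed.
End Tabulate.

Definition fun_tab (phi : {ffun 'I_3 -> 'I_12}) : seq nat := [seq val (phi i) | i <- o3].
Definition set_tab (H : {set 'I_3}) : bitseq := [seq i \in H | i <- o3].

Lemma nth_fun_tab phi (i : 'I_3) : nth 0%N (fun_tab phi) i = phi i.
Proof. by case: i => [[|[|[|]]]] //= h; congr (val (phi _)); apply: val_inj. Qed.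

Lemma nth_set_tab H (i : 'I_3) : nth false (set_tab H) i = (i \in H).
Proof. by case: i => [[|[|[|]]]] //= h; congr (_ \in H); apply: val_inj. Qed.

Lemma fun_tab_inj : injective fun_tab.
Proof.
by move=> p q e; apply/ffunP => i; apply: val_inj; rewrite -[LHS]nth_fun_tab e nth_fun_tab.
Qed.
Lemma set_tab_inj : injective set_tab.
Proof. by move=> p q e; apply/setP => i; rewrite -!nth_set_tab e. Qed.

Lemma fun_tab_in phi : fun_tab phi \in nat3.
Proof.
apply/mem_triples; do 3 eexists; split; last by [].
all: by rewrite mem_iota ltn_ord.
Qed.
Lemma set_tab_in H : set_tab H \in bool3.
Proof.
apply/mem_triples; do 3 eexists; split; last by [].
all: by case: (_ \in H).
Qed.

Lemma fun_tab_onto t : t \in nat3 -> exists phi, fun_tab phi = t.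
Proof.
case/mem_triples=> a [b [c []]]; rewrite !mem_iota /= !add0n => a12 b12 c12 ->.
exists [ffun i : 'I_3 => nth ord0 [:: Ordinal a12; Ordinal b12; Ordinal c12] i].
by rewrite /fun_tab /= !ffunE.
Qed.
Lemma set_tab_onto h : h \in bool3 -> exists H, set_tab H = h.
Proof.
case/mem_triples=> a [b [c [_ _ _ ->]]].
by exists [set i : 'I_3 | nth false [:: a; b; c] i]; rewrite /set_tab /= !inE.
Qed.

Lemma uniq_nat3 : uniq nat3. Proof. by vm_compute. Qed.
Lemma uniq_bool3 : uniq bool3. Proof. by vm_compute. Qed.

Definition card_fun_tab := card_tab fun_tab_inj uniq_nat3 fun_tab_in fun_tab_onto.
Definition card_set_tab := card_tab set_tab_inj uniq_bool3 set_tab_in set_tab_onto.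
Definition sum_set_tab := sum_tab set_tab_inj uniq_bool3 set_tab_in set_tab_onto.

Section Correct.
Variable s : seq nat.
Local Notation G := (graph_of s).
Local Notation A := 'I_12.
Local Notation adj := (adj s).

Lemma adjP (i j : 'I_3) : reflect (exists e : edge G, src e = i /\ rng e = j) (adj i j).
Proof.
apply: (iffP idP) => [h|[[[a b] h] [<- <-]] //].
by exists (exist _ (i, j) h).
Qed.

Lemma has_adj (i : 'I_3) : has (adj i) i3 = ~~ @sink G i.
Proof.
apply/has_i3P/idP => [[j /adjP[e [ei _]]]|/sinkPn[e ei]].
  by apply/sinkPn; exists e.
by exists (rng e); apply/adjP; exists e.
Qed.

Lemma hs_tabE (H : {set vertex G}) : (H \in hsets G) = hs_tab s (set_tab H).
Proof.
apply/idP/andP => [/hsetsP[h1 h2]|[/all_i3P h1 /all_i3P h2]].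
  split; apply/all_i3P => i.
    apply/all_i3P => j; apply/implyP; rewrite !nth_set_tab.
    by case/andP=> iH /adjP[e [ei <-]]; apply: hereditary_rng h1 _; rewrite ei.
  apply/implyP; rewrite has_adj nth_set_tab => /andP[/sinkPn si /all_i3P h].
  apply: h2 => // e ei; have /implyP := h (rng e); rewrite nth_set_tab; apply.
  by apply/adjP; exists e.
apply/hsetsP; split.
  apply: hereditary_edge => e eH; have /all_i3P/(_ (rng e))/implyP := h1 (src e).
  by rewrite !nth_set_tab; apply; rewrite eH; apply/adjP; exists e.
move=> v /sinkPn sv h; have /implyP := h2 v; rewrite has_adj sv nth_set_tab; apply.
apply/all_i3P => j; apply/implyP => /adjP[e [ev <-]]; rewrite nth_set_tab; exact: h.
Qed.

Lemma into_tabE (H : {set vertex G}) : set_tab (into H) = into_tab s (set_tab H).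
Proof.
rewrite /into_tab -map_o3 -map_comp; apply: eq_map => i /=.
apply/idP/idP.
  move=> hi; have {hi}h := (intoP H (i : vertex G)).1 hi.
  change (all (fun j => adj i j ==> nth false (set_tab H) j) i3).
  by apply/all_i3P => j; apply/implyP => /adjP[e [ei <-]]; rewrite nth_set_tab; exact: h.
move=> h0; have {h0}/all_i3P h : all (fun j => adj i j ==> nth false (set_tab H) j) i3 by [].
apply: (intoP H (i : vertex G)).2 => e ei; have /implyP := h (rng e); rewrite nth_set_tab; apply.
by apply/adjP; exists e.
Qed.

Lemma fin_tabE : set_tab (finite_paths G) = fin_tab s.
Proof.
rewrite /finite_paths /fixset /= card_ord /= !into_tabE; congr (into_tab s (into_tab s (into_tab s _))).
by rewrite /set_tab /= !finset.in_set0.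
Qed.

Lemma van_tabE (H : {set vertex G}) (phi : {ffun vertex G -> A}) :
  vanish H phi = van_tab (set_tab H) (fun_tab phi).
Proof.
apply/vanishP/all_i3P => h i.
  by apply/implyP; rewrite nth_set_tab nth_fun_tab => /h ->.
have /implyP := h i; rewrite nth_set_tab nth_fun_tab => h' /h' /eqP e.
exact: val_inj.
Qed.

Lemma val_sumI12 (I : Type) (r : seq I) (P : pred I) (F : I -> A) :
  val (\sum_(i <- r | P i) F i) = ((\sum_(i <- r | P i) F i) %% 12)%N.
Proof.
apply: (big_ind2 (fun (x : A) y => val x = y %% 12)%N) => [|x x' y y' hx hy|i _] //.
  by rewrite -modnDm -hx -hy.
by rewrite modn_small.
Qed.

Lemma sum_rngE (phi : {ffun vertex G -> A}) (i : 'I_3) :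
  \sum_(e : edge G | src e == i) phi (rng e) = \sum_(j : 'I_3) (if adj i j then phi j else 0).
Proof.
rewrite (big_sig (fun p => edge_code p \in s) (fun p => p.1 == i) (fun p => phi p.2)).
rewrite big_mkcond -(pair_bigA _ (fun a b => if (edge_code (a, b) \in s) && (a == i)
  then phi b else 0)) /=.
rewrite (bigD1 i) //= [X in _ + X]big1 ?addr0 => [|a /negPf ai]; last first.
  by rewrite big1 // => b _; rewrite ai andbF.
by apply: eq_bigr => j _; rewrite eqxx andbT.
Qed.

Lemma harm_tabE (phi : {ffun vertex G -> A}) :
  (phi \in harm_set A G) = harm_tab s (fun_tab phi).
Proof.
have sumE (i : 'I_3) : val (\sum_(e : edge G | src e == i) phi (rng e)) =
    (sumn [seq if adj i j then nth 0 (fun_tab phi) j else 0 | j <- i3] %% 12)%N.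
  rewrite sum_rngE val_sumI12 sumnE big_map -map_o3 big_map -enum_o3 big_enum /=.
  congr (_ %% _)%N; apply: eq_bigr => j _; rewrite nth_fun_tab; by case: ifP.
apply/idP/all_i3P => [/harm_setP h i|h].
  apply/implyP; rewrite has_adj => si.
  by rewrite -sumE nth_fun_tab -h.
apply/harm_setP => v nv; apply: val_inj; rewrite /= [RHS]sumE -nth_fun_tab.
by have /implyP := h v; rewrite has_adj nv => /(_ isT)/eqP.
Qed.

Lemma harm0_tabE (phi : {ffun vertex G -> A}) :
  (phi \in harm0_set A G) = harm_tab s (fun_tab phi) && (sumn (fun_tab phi) %% 12 == 0)%N.
Proof.
rewrite -harm_tabE; have -> : (sumn (fun_tab phi) %% 12 == 0)%N = (\sum_v phi v == 0).
  have e : val (\sum_v phi v) = (sumn (fun_tab phi) %% 12)%N.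
    by rewrite val_sumI12 sumnE big_map -enum_o3 big_enum.
  by rewrite -e.
apply/idP/andP => [/harm0_setP[h ->]|[/harm_setP h /eqP e]].
  by split=> //; exact/harm_setP.
exact/harm0_setP.
Qed.

(* The group Z/12 is large enough for [key_separates]. *)
Definition key (E : graph) : seq nat :=
  [:: #|hsets E|; #|harm0_set A E|; #|harm0_set A (quot_graph (finite_paths E))|;
      harm_sum A (quot_graph (finite_paths E))].

Lemma key_tabE : key G = key_tab s.
Proof.
have hF := finite_paths_hs G; rewrite /key /key_tab; congr [:: _; _; _; _].
- rewrite -(card_set_tab (P := fun H => H \in hsets G)); last exact: hs_tabE.
  by apply: eq_card => H; rewrite [RHS]inE.
- rewrite size_filter count_filter; rewrite -(card_fun_tab (P := fun phi => phi \in harm0_set A G)).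
    by apply: eq_card => phi; rewrite [RHS]inE.
  by move=> phi; rewrite harm0_tabE /= andbC.
- rewrite harm0_quot // !count_filter.
  rewrite -(card_fun_tab (P := fun phi => (phi \in harm0_set A G) && vanish (finite_paths G) phi)).
    by apply: eq_card => phi; rewrite [LHS]inE [RHS]inE.
  by move=> phi; rewrite harm0_tabE van_tabE fin_tabE /= andbC (andbC (harm_tab _ _)) andbA.
- rewrite harm_sum_quot // big_mkcond.
  rewrite -(sum_set_tab (fun h =>
    if hs_tab s h && all (fun i => nth false (fin_tab s) i ==> nth false h i) i3
    then count (van_tab h) [seq t <- nat3 | harm_tab s t] else 0%N)).
  apply: eq_bigr => H _.
  rewrite hs_tabE -fin_tabE; congr (if _ && _ then _ else _).
    apply/fintype.subsetP/all_i3P => h i; rewrite ?nth_set_tab; first by apply/implyP/h.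
    by have /implyP := h i; rewrite !nth_set_tab.
  rewrite count_filter.
  rewrite -(card_fun_tab (P := fun phi => (phi \in harm_set A G) && vanish H phi)).
    by apply: eq_card => phi; rewrite [LHS]inE [RHS]inE.
  by move=> phi; rewrite harm_tabE van_tabE /= andbC.
Qed.
End Correct.

Section Mask.
Variables (E : graph) (s : seq nat) (f : 'I_3 -> vertex E).
Hypothesis singE : Sing E.
Hypothesis f_bij : bijective f.
Hypothesis fE : forall i j, has_edge s (i, j) =
  [exists e : edge E, (src e == f i) && (rng e == f j)].
Local Notation adj := (adj s).
Implicit Types i j k : 'I_3.

Lemma f_surj v : exists i, f i = v.
Proof. by case: f_bij => g _ gK; exists (g v). Qed.

Lemma f_injE i j : (f i == f j) = (i == j).
Proof. exact: (bij_eq f_bij). Qed.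

Lemma adj_edge i j : reflect (exists e, src e = f i /\ rng e = f j) (adj i j).
Proof.
rewrite -[adj i j]/(has_edge s (i, j)) fE; apply: (iffP existsP) => -[e].
  by case/andP=> /eqP a /eqP b; exists e.
by case=> a b; exists e; rewrite a b !eqxx.
Qed.

Lemma ILN_tab : ILN E = iln_tab s.
Proof.
rewrite /ILN /iln_tab -card_i3 -(card_imset _ (bij_inj f_bij)).
apply: eq_card => u; apply/idP/imsetP => [|[i + ->]].
  have [i <-] := f_surj u; rewrite inE => /andP[/cards1P[e eE] /forallP h].
  have : e \in [set e] by rewrite inE.
  rewrite -eE inE => /andP[/eqP se /eqP re].
  exists i => //; rewrite inE; apply/andP; split; first by apply/adj_edge; exists e.
  apply/all_i3P => j; apply/all_i3P => k; apply/implyP => /andP[/adj_edge[e' [s' r']] jk].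
  have := h e'; rewrite s' r' !f_injE -!val_eqE /=.
  by move/implyP; apply.
rewrite inE => /andP[/adj_edge[e [se re]] /all_i3P h]; rewrite inE; apply/andP; split.
  apply/cards1P; exists e; apply/setP => e'; rewrite !inE; apply/andP/eqP => [[/eqP a /eqP b]|->].
    by apply: singE; rewrite ?a ?b ?se ?re.
  by rewrite se re !eqxx.
apply/forallP => e'; have [j jE] := f_surj (src e'); have [k kE] := f_surj (rng e').
apply/implyP; rewrite -jE -kE !f_injE => jk.
have /all_i3P/(_ k)/implyP := h j; rewrite -!val_eqE /= in jk *.
by apply; rewrite jk andbT; apply/adj_edge; exists e'.
Qed.

Hypothesis closed : all (fun i : nat => all (fun j : nat => all (fun k : nat =>
  reach_tab s i j && adj j k ==> reach_tab s i k) i3) i3) i3.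

Lemma reaches_edge (u v w : vertex E) e : reaches u v -> src e = v -> rng e = w -> reaches u w.
Proof.
case=> p [pp pv] ev ew; exists (rcons p e).
by rewrite is_path_rcons pp ev pv eqxx path_end_rcons ew.
Qed.

Lemma reaches_tab i j : reaches (f i) (f j) <-> reach_tab s i j.
Proof.
split=> [[p [pp pe]]|]; last first.
  have r0 k : reaches (f k) (f k) by exists [::].
  case/or3P=> [/eqP/val_inj <- //|/adj_edge[e [a b]]|]; first exact: reaches_edge (r0 i) a b.
  case/has_i3P=> k /andP[/adj_edge[e [a b]] /adj_edge[e' [a' b']]].
  by apply: reaches_edge a' b'; exact: reaches_edge (r0 i) a b.
elim/last_ind: p j pp pe => [|p e IH] j.
  by move=> _ /eqP; rewrite f_injE /reach_tab -val_eqE => ->.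
rewrite is_path_rcons path_end_rcons => /andP[pp /eqP se] re.
have [k kE] := f_surj (src e); have ik : reach_tab s i k by apply: IH => //; rewrite kE.
move: closed => /all_i3P/(_ i)/all_i3P/(_ k)/all_i3P/(_ j)/implyP; apply.
by rewrite ik; apply/adj_edge; exists e.
Qed.

Lemma MT3_tab : condition_MT3 E <-> mt3_tab s.
Proof.
split=> [h|/all_i3P h v w].
  apply/all_i3P => i; apply/all_i3P => j; apply/has_i3P.
  have [u [iu ju]] := h (f i) (f j); have [k kE] := f_surj u.
  by exists k; apply/andP; split; apply/reaches_tab; rewrite kE.
have [i <-] := f_surj v; have [j <-] := f_surj w.
have /all_i3P/(_ j)/has_i3P[k /andP[a b]] := h i.
by exists (f k); split; apply/reaches_tab.
Qed.

(** A sequence of vertices without repetition has length at most 3. *)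
Lemma mem_cycles (c : seq 'I_3) : (map val c \in cycles_tab) = uniq c && (c != [::]).
Proof.
rewrite mem_filter (map_inj_uniq val_inj); case uc: (uniq c); last by [].
have lt i : (i : nat) \in i3 by rewrite mem_iota; exact: ltn_ord.
have sz : (size c <= 3)%N.
  by rewrite -(card_uniqP uc); apply: leq_trans (max_card _) _; rewrite card_ord.
have m1 i : [:: (i : nat)] \in seqs1 by apply/mapP; exists (i : nat).
have m2 i j : [:: (i : nat); (j : nat)] \in seqs2 by rewrite /seqs2; apply: allpairs_f.
have m3 i j k : [:: (i : nat); (j : nat); (k : nat)] \in seqs3 by rewrite /seqs3; apply: allpairs_f.
rewrite !andTb 2!mem_cat; case: c sz {uc} => [|i [|j [|k [|]]]] // _.
- by apply/orP; left; exact: m1.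
- by apply/orP; right; apply/orP; left; exact: m2.
- by apply/orP; right; apply/orP; right; exact: m3.
Qed.

Lemma condL_tabP : condition_L E <-> condL_tab s.
Proof.
have adjE i j : adj i j = adj (val i) (val j) by [].
pose R i j : bool := adj i j.
have cycE (c : seq 'I_3) : cycle adj (map val c) = cycle R c by rewrite cycle_map.
split=> [L|/allP T p].
  apply/allP => c0 hc0.
  have [c cE] : exists c : seq 'I_3, map val c = c0.
    have : all (fun i : nat => i < 3)%N c0.
      by move: hc0; apply/allP; vm_compute.
    elim: c0 {hc0} => [|i c0 IH]; first by exists [::].
    by case/andP=> lt3 /IH[c <-]; exists (Ordinal lt3 :: c).
  move: hc0; rewrite -cE mem_cycles cycE => /andP[uc c0n].
  apply/implyP => cyc.
  have pth (x y : 'I_3) r : path R x (rcons r y) -> exists p,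
      [/\ is_path (f x) p, path_end (f x) p = f y & map (@src E) p = map f (x :: r)].
    elim: r x => [|z r IH] x /=.
      by rewrite andbT => /adj_edge[e [a b]]; exists [:: e]; rewrite /path_end /= a b eqxx.
    case/andP=> /adj_edge[e [a b]] /IH[p [p1 p2 p3]]; exists (e :: p).
    by rewrite /= a b eqxx p1 p3; split=> //; rewrite -p2 -b.
  case: c uc c0n cyc {cE} => [|x r] // uc _ /pth[p [p1 p2 p3]].
  have [] := L p.
    exists (f x); split=> //; first by case: (p) p3.
    by rewrite p3 map_inj_uniq //; exact: bij_inj f_bij.
  move=> e [e' [ep se ne]].
  have : src e' \in map (@src E) p by exact: map_f.
  rewrite p3 => /mapP[v vc sv]; apply/hasP; exists (val v); first exact: map_f.
  rewrite -card_i3; have [j jE] := f_surj (rng e); have [k kE] := f_surj (rng e').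
  apply/card_gt1P; exists j, k; rewrite !inE; split.
  - by apply/adj_edge; exists e; rewrite se sv jE.
  - by apply/adj_edge; exists e'; rewrite sv kE.
  - apply: contra_notN ne => /eqP jk; apply: singE => //; by rewrite -jE -kE jk.
case=> v [p0 pv pe un].
have [g fK gK] := f_bij.
have cyc e q : is_path (src e) (e :: q) ->
    path R (g (src e)) (rcons (map (g \o @src E) q) (g (path_end (src e) (e :: q)))).
  elim: q e => [|e' q IH] e /=.
    by move=> _; rewrite andbT; apply/adj_edge; exists e; rewrite !gK.
  case/and3P=> _ /eqP ee pq; apply/andP; split.
    by apply/adj_edge; exists e; rewrite !gK.
  by apply: (IH e'); rewrite /= eqxx.
case: p p0 pv pe un => [|e q] // _ pv pe un.
have ve : src e = v by case/andP: pv => /eqP.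
rewrite -ve in pv pe.
pose c := map (g \o @src E) (e :: q).
have cT : map val c \in cycles_tab.
  by rewrite mem_cycles andbT /c map_comp map_inj_uniq //; exact: can_inj gK.
have := T _ cT; rewrite cycE => /implyP.
have := cyc e q pv; rewrite pe => h /(_ h) /hasP[_ /mapP[_ /mapP[e1 e1q ->] ->]].
rewrite -card_i3 => /card_gt1P[j [k []]]; rewrite !inE => /adj_edge[a [a1 a2]] /adj_edge[b [b1 b2]] jk.
rewrite /= !gK in a1 b1.
(* Of two edges that leave a vertex of the cycle at least one differs from the edge e1 of the cycle
   there, and this one is the exit. *)
have [ae|ae] := eqVneq a e1; last by exists a, e1; split=> //; apply/eqP.
exists b, e1; split=> //; rewrite -ae => ba; case/negP: jk.
by rewrite -f_injE -a2 -b2 ba.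
Qed.

Lemma MT3L_tab : MT3L E <-> mt3_tab s && condL_tab s.
Proof.
split=> [[/MT3_tab a /condL_tabP b]|/andP[/MT3_tab a /condL_tabP b]] //.
exact/andP.
Qed.
End Mask.

(** * Separation of the representatives *)

Section Keys.
Variable K : fieldType.

Lemma key_invariant (E F : graph) : K0_pointed_iso (LPA K E) (LPA K F) ->
  ring_iso (quot (socle_ideal (LPA K E))) (quot (socle_ideal (LPA K F))) ->
  #|hsets E| = #|hsets F| -> key E = key F.
Proof.
move=> k0 q h; rewrite /key h (harm_card _ k0).2.
have i : ring_iso (LPA K (quot_graph (finite_paths E))) (LPA K (quot_graph (finite_paths F))).
  apply: ring_iso_trans (ring_iso_sym (quot_socle K E)) _.
  exact: ring_iso_trans q (quot_socle K F).
by rewrite (harm_card _ (ring_iso_K0 i)).2 (hs_count _ i).2.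
Qed.

Lemma key_iso (E F : graph) : ring_iso (LPA K E) (LPA K F) -> key E = key F.
Proof.
move=> i; apply: key_invariant; first exact: ring_iso_K0.
  by case: (socle_iso i).
exact: (hs_count 'I_12 i).1.
Qed.

(** The graphs in [special] are of this kind, so an isomorphism of the quotients L/Soc is one of the
    algebras. *)
Lemma quot_socle0 (E : graph) : finite_paths E = finset.set0 ->
  ring_iso (quot (socle_ideal (LPA K E))) (LPA K E).
Proof.
move=> e; apply: quot_zero_ideal => x /socleE; rewrite e => gx.
by apply/zero_idealE; apply: gen_ideal_sub gx => v; rewrite inE.
Qed.

Lemma special_finite_paths s : s \in special -> finite_paths (graph_of s) = finset.set0.
Proof.
move=> hs; apply: set_tab_inj; rewrite fin_tabE; apply/eqP.
have -> : set_tab finset.set0 = [:: false; false; false] by rewrite /set_tab /= !finset.in_set0.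
by apply: (allP (a := fun s => fin_tab s == [:: false; false; false])) hs; vm_compute.
Qed.

(** Vertex 2 emits nothing but its loop. *)
Lemma special_corner (s0 := nth [::] special 0) : has_comm_corner (LPA K (graph_of s0)).
Proof.
pose c : edge (graph_of s0) := exist _ (Ordinal (isT : 1 < 3)%N, Ordinal (isT : 1 < 3)%N) isT.
apply: (@single_loop_corner K (graph_of s0) c) => // -[[[[|[|[|]]] // a] [[|[|[|]]] // b]] //= h] _.
apply: val_inj; congr (_, _); exact: val_inj.
Qed.

(** Every vertex has a loop and emits an edge to another vertex. *)
Lemma special_no_corner (s1 := nth [::] special 1) : ~ has_comm_corner (LPA K (graph_of s1)).
Proof.
apply: no_comm_corner => w.
have eP (i j : 'I_3) : has_edge s1 (i, j) ->
    exists e : edge (graph_of s1), src e = i /\ rng e = j by move=> h; exists (exist _ (i, j) h).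
have [x [xw h1 h2]] : exists x, [/\ x != w, has_edge s1 (w, w) & has_edge s1 (w, x)].
  case: w => [[|[|[|]]] // h].
  - by exists (Ordinal (isT : 1 < 3)%N).
  - by exists (Ordinal (isT : 2 < 3)%N).
  - by exists (Ordinal (isT : 1 < 3)%N).
have [c [cs cr]] := eP _ _ h1; have [f [fs fr]] := eP _ _ h2.
exists c, f; split=> //; apply: contra xw => /eqP fc.
by rewrite -fr fc cr.
Qed.

Lemma mk_inj :
  all (fun m => all (fun n => (mk m == mk n) ==> (m == n)) root_masks) root_masks.
Proof. by vm_compute. Qed.

(** Stated with data that an isomorphism of algebras and a coincidence of invariants both provide,
    so that it serves the count of classes and the completeness. The quotient by the socle decides
    the pair that the keys leave open. *)
Lemma root_unique m n : m \in root_masks -> n \in root_masks ->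
  key (graph_of (mk m)) = key (graph_of (mk n)) ->
  ring_iso (quot (socle_ideal (LPA K (graph_of (mk m)))))
           (quot (socle_ideal (LPA K (graph_of (mk n))))) -> m = n.
Proof.
move=> mi ni; rewrite !key_tabE => kk q.
have /allP/(_ (m, key_tab (mk m))) := key_separates.
have inl k : k \in root_masks -> (k, key_tab (mk k)) \in [seq (m, key_tab (mk m)) | m <- root_masks].
  by move=> ki; apply/mapP; exists k.
move=> /(_ (inl _ mi))/allP/(_ _ (inl _ ni)) /=; rewrite kk eqxx /=.
case/orP=> [/eqP //|/andP[ms ns]].
have i : ring_iso (LPA K (graph_of (mk m))) (LPA K (graph_of (mk n))).
  apply: ring_iso_trans (ring_iso_sym (quot_socle0 (special_finite_paths ms))) _.
  exact: ring_iso_trans q (quot_socle0 (special_finite_paths ns)).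
have eq_mk : mk m = mk n.
  move: ms ns i; rewrite !inE => /orP[] /eqP -> /orP[] /eqP -> // i.
    by case: special_no_corner; apply: has_comm_corner_iso i special_corner.
  by case: special_no_corner; apply: has_comm_corner_iso (ring_iso_sym i) special_corner.
have /allP/(_ _ mi)/allP/(_ _ ni) := mk_inj.
by rewrite eq_mk eqxx => /eqP.
Qed.

Lemma in_L3_root (E : graph) : in_L3 E -> exists m (f : 'I_3 -> vertex E),
  [/\ (m < 512)%N, bijective f,
    forall i j, has_edge (mk m) (i, j) =
      [exists e : edge E, (src e == f i) && (rng e == f j)] &
    ring_iso (LPA K E) (LPA K (graph_of (mk (root m))))].
Proof.
move=> E3; have [m [f [m512 bf fE]]] := in_L3_mask E3; exists m, f; split=> //.
exact: ring_iso_trans (mask_iso K (proj1 E3) bf fE) (root_iso K m512).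
Qed.

Lemma root_mem m : (m < 512)%N -> root m \in root_masks.
Proof. by move=> h; apply: (allP root_in); rewrite mem_iota. Qed.

Lemma HS_hsets (E : graph) : HS E = (#|hsets E| - 2)%N.
Proof. by []. Qed.

Lemma hsets_ge2 (E : graph) : (0 < #|vertex E|)%N -> (1 < #|hsets E|)%N.
Proof.
move=> V0; apply/card_gt1P; exists finset.set0, [set: vertex E]%SET; split.
- exact/hsetsP/hs_set0.
- exact/hsetsP/hs_setT.
- by rewrite eq_sym -card_gt0 cardsT.
Qed.
End Keys.

Theorem theorem4p7 (K : fieldType) :
  ((exists G : 'I_50 -> graph,
      [/\ forall i, in_L3 (G i),
          forall i j, ring_iso (LPA K (G i)) (LPA K (G j)) -> i = j &
          forall E, in_L3 E -> exists i, ring_iso (LPA K E) (LPA K (G i))]) /\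
   (forall s, s \in list3 -> in_L3 (graph_of s)) /\
   (forall E, in_L3 E ->
      exists2 s, s \in list3 & ring_iso (LPA K E) (LPA K (graph_of s)))) /\
  (forall E F, in_L3 E -> in_L3 F ->
     (ring_iso (LPA K E) (LPA K F) <-> same_invariants K E F)).
Proof.
have sz : size root_masks = 50%N by vm_compute.
split; [split; [|split]|].
- exists (fun i => graph_of (mk (nth 0%N root_masks i))); split.
  + by move=> i; exact: in_L3_graph_of.
  + move=> i j h; have mi k : (k < 50)%N -> nth 0%N root_masks k \in root_masks.
      by move=> k50; rewrite mem_nth // sz.
    have e := root_unique (mi _ (ltn_ord i)) (mi _ (ltn_ord j)) (key_iso h) (proj2 (socle_iso h)).
    have u : uniq root_masks by vm_compute.
    by apply: val_inj; apply/eqP; move/eqP: e; rewrite nth_uniq // sz.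
  + move=> E /(in_L3_root K)[m [f [m512 _ _ i]]].
    have rm := root_mem m512.
    have lt : (index (root m) root_masks < 50)%N by rewrite -sz index_mem.
    by exists (Ordinal lt); rewrite /= nth_index.
- by move=> s _; exact: in_L3_graph_of.
- move=> E /(in_L3_root K)[m [f [m512 _ _ i]]]; exists (mk (root m)) => //.
  have : all (fun m => mk m \in list3) root_masks by vm_compute.
  by move/allP; apply; exact: root_mem.
move=> E F E3 F3.
have [m [f [m512 bf fE im]]] := in_L3_root K E3.
have [n [g [n512 bg gE jn]]] := in_L3_root K F3.
have V0 : (0 < #|vertex E|)%N by rewrite (proj2 E3).
have W0 : (0 < #|vertex F|)%N by rewrite (proj2 F3).
split=> [i|[k0 [_ q] [_ hs] _ _]]; last first.
  (* The subtraction in [HS] loses nothing, since the empty set and the set of all vertices are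
     always counted. *)
  have hh : #|hsets E| = #|hsets F|.
    by move: hs (hsets_ge2 V0) (hsets_ge2 W0); rewrite !HS_hsets; lia.
  have rn : root m = root n.
    apply: (root_unique (K := K) (root_mem m512) (root_mem n512)).
      by rewrite -(key_iso im) -(key_iso jn); exact: key_invariant k0 q hh.
    apply: ring_iso_trans (proj2 (socle_iso (ring_iso_sym im))) _.
    exact: ring_iso_trans q (proj2 (socle_iso jn)).
  by apply: ring_iso_trans im _; rewrite rn; exact: ring_iso_sym.
(* From here on ILN and MT3+L of E and F are read off from the tables of this common
   representative. *)
have rn : root m = root n.
  have i' : ring_iso (LPA K (graph_of (mk (root m)))) (LPA K (graph_of (mk (root n)))).
    by apply: ring_iso_trans (ring_iso_sym im) _; exact: ring_iso_trans i jn.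
  exact: (root_unique (root_mem m512) (root_mem n512) (key_iso i') (proj2 (socle_iso i'))).
have tab k : (k < 512)%N -> [/\ iln_tab (mk k) = iln_tab (mk (root k)),
    mt3_tab (mk k) && condL_tab (mk k) = mt3_tab (mk (root k)) && condL_tab (mk (root k)) &
    all (fun i => all (fun j => all (fun l => reach_tab (mk k) i j && adj (mk k) j l ==>
      reach_tab (mk k) i l) i3) i3) i3].
  move=> k512; have kin : k \in iota 0 512 by rewrite mem_iota.
  by have /and3P[/eqP a /eqP b c] := allP tables_root _ kin.
have [il1 mt1 cl1] := tab _ m512; have [il2 mt2 cl2] := tab _ n512.
have hh := (hs_count 'I_12 i).1.
split.
- exact: ring_iso_K0.
- exact: socle_iso.
- split; last by rewrite !HS_hsets hh.
  by rewrite (ILN_tab (proj1 E3) bf fE) (ILN_tab (proj1 F3) bg gE) il1 il2 rn.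
- move=> h1; have c3 : #|hsets E| = 3%N.
    by move: h1 (hsets_ge2 V0); rewrite HS_hsets; lia.
  by apply: quot_graded_iso => //; rewrite -hh.
apply: iff_trans (MT3L_tab (proj1 E3) bf fE cl1) _.
apply: iff_trans (iff_sym (MT3L_tab (proj1 F3) bg gE cl2)).
by rewrite mt1 mt2 rn.
Qed.
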